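(* Let $\zeta\in\partial\mathbb{D}$ and $k_0\in\mathbb{Z}$. Then the following sets of two-dimensional Laurent polynomials $\{P(\zeta,k,k_0)\}_{k\in\mathbb{Z}}$ and $\{R(\zeta,k,k_0)\}_{k\in\mathbb{Z}}$, $$P(\zeta,k,k_0)=\binom{P_0(\zeta,k,k_0)}{P_1(\zeta,k,k_0)}=\begin{cases}\frac1{2\zeta}\begin{pmatrix}-\rho_{k_0}&\rho_{k_0}\\ \overline{b_{k_0}}&\overline{a_{k_0}}\end{pmatrix}\begin{pmatrix}q_+(\zeta,k,k_0)\\ p_+(\zeta,k,k_0)\end{pmatrix},&k_0\text{ odd},\\[4mm] \frac12\begin{pmatrix}\rho_{k_0}&\rho_{k_0}\\ -b_{k_0}&a_{k_0}\end{pmatrix}\begin{pmatrix}q_+(\zeta,k,k_0)\\ p_+(\zeta,k,k_0)\end{pmatrix},&k_0\text{ even},\end{cases}$$ $$R(\zeta,k,k_0)=\binom{R_0(\zeta,k,k_0)}{R_1(\zeta,k,k_0)}=\begin{cases}\frac12\begin{pmatrix}\rho_{k_0}&\rho_{k_0}\\ -b_{k_0}&a_{k_0}\end{pmatrix}\begin{pmatrix}s_+(\zeta,k,k_0)\\ r_+(\zeta,k,k_0)\end{pmatrix},&k_0\text{ odd},\\[4mm] \frac12\begin{pmatrix}-\rho_{k_0}&\rho_{k_0}\\ \overline{b_{k_0}}&\overline{a_{k_0}}\end{pmatrix}\begin{pmatrix}s_+(\zeta,k,k_0)\\ r_+(\zeta,k,k_0)\end{pmatrix},&k_0\text{ even},\end{cases}$$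 form complete orthonormal systems in $L^2(\partial\mathbb{D};d\Omega(\cdot,k_0)^\top)$ and $L^2(\partial\mathbb{D};d\Omega(\cdot,k_0))$, respectively.
   Context: $\mathbb{D}$ is the open unit disk in $\mathbb{C}$ and $\partial\mathbb{D}$ the unit circle. Let $\{\alpha_k\}_{k\in\mathbb{Z}}\subset\mathbb{D}$, $\rho_k=\sqrt{1-|\alpha_k|^2}$, $a_k=1+\alpha_k$, $b_k=1-\alpha_k$. Scalar products are linear in the second argument; $\{\delta_k\}$ is the standard basis of $\ell^2(\mathbb{Z})$. CMV operator: $\theta_k=\begin{pmatrix}-\alpha_k&\rho_k\\ \rho_k&\overline{\alpha_k}\end{pmatrix}$. $V$ (resp. $W$) is the unitary operator on $\ell^2(\mathbb{Z})$ whose matrix in the standard basis is block diagonal with blocks $\theta_{2k}$ on rows/columns $2k-1,2k$ (resp. $\theta_{2k+1}$ on rows/columns $2k,2k+1$), $k\in\mathbb{Z}$, and $U=VW$, with projection-valued spectral measure $dE_U$ on $\partial\mathbb{D}$. The $2\times2$ matrix-valued measure $d\Omega(\cdot,k_0)$ has entries $d\Omega_{\ell,\ell'}(\zeta,k_0)=d(\delta_{k_0-1+\ell},E_U(\zeta)\delta_{k_0-1+\ell'})_{\ell^2(\mathbb{Z})}$, $\ell,\ell'\in\{0,1\}$; $d\Omega^\top$ is its transpose. For a nonnegative matrix-valued measure $d\Sigma$, $L^2(\partial\mathbb{D};d\Sigma)$ is the Hilbert space of ($\mathbb{C}^2$-valued) functions with scalar product $\oint_{\partial\mathbb{D}}F(\zeta)^*\,d\Sigma(\zeta)\,G(\zeta)$.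 For $z\in\mathbb{C}\setminus\{0\}$, put $T(z,k)=\frac1{\rho_k}\begin{pmatrix}\alpha_k&z\\ 1/z&\overline{\alpha_k}\end{pmatrix}$ for $k$ odd and $T(z,k)=\frac1{\rho_k}\begin{pmatrix}\overline{\alpha_k}&1\\ 1&\alpha_k\end{pmatrix}$ for $k$ even. The Laurent polynomials $p_+,r_+,q_+,s_+$ (in $z$) are defined for all $k\in\mathbb{Z}$ by requiring that $(u,v)=(p_+,r_+)$ and $(u,v)=(q_+,s_+)$ solve $\binom{u(z,k,k_0)}{v(z,k,k_0)}=T(z,k)\binom{u(z,k-1,k_0)}{v(z,k-1,k_0)}$, $k\in\mathbb{Z}$, with initial values at $k=k_0$: $\binom{p_+}{r_+}=\binom{z}{1}$, $\binom{q_+}{s_+}=\binom{z}{-1}$ if $k_0$ is odd, and $\binom{p_+}{r_+}=\binom{1}{1}$, $\binom{q_+}{s_+}=\binom{-1}{1}$ if $k_0$ is even. *)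

(* Defs.v *)
From HB Require Import structures.
From mathcomp Require Import all_boot all_order all_algebra.
From mathcomp Require Import complex.
From mathcomp Require Import all_classical all_reals all_analysis.

Set Implicit Arguments.
Unset Strict Implicit.
Unset Printing Implicit Defensive.

Import Order.TTheory GRing.Theory Num.Theory numFieldNormedType.Exports.

Local Open Scope classical_set_scope.
Local Open Scope ring_scope.

(* R[i]^o carries the usual topology of the plane. Measures on the unit
   circle are represented by set functions on the Borel sets of the plane,
   of which only the values on Borel subsets of the circle matter. *)
Definition plane (R : realType) := g_sigma_algebraType (@open R[i]^o).

Definition unit_circle (R : realType) : set (plane R) :=
  [set z : R[i] | `|z| = 1].
Arguments unit_circle : clear implicits.

Definition cintegrable (R : realType) (mu : set (plane R) -> \bar R)
    (D : set (plane R)) (f : plane R -> R[i]) : Prop :=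
  mu.-integrable D (fun z => (complex.Re (f z))%:E) /\
  mu.-integrable D (fun z => (complex.Im (f z))%:E).

Definition cintegral (R : realType) (mu : set (plane R) -> \bar R)
    (D : set (plane R)) (f : plane R -> R[i]) : R[i] :=
  Complex (fine (\int[mu]_(z in D) (complex.Re (f z))%:E))
          (fine (\int[mu]_(z in D) (complex.Im (f z))%:E)).

Definition sqnorm (R : realType) (f : int -> R[i]) : \bar R :=
  (\esum_(k in [set: int]) (ComplexField.Normc.normc (f k) ^+ 2)%:E)%E.

Definition l2 (R : realType) (f : int -> R[i]) : Prop :=
  (sqnorm f < +oo)%E.

(* For f and g in l^2(Z) the series is
   absolutely convergent, so its sum is the limit of the sums over
   {-n, ..., n}. *)
Definition dotp (R : realType) (f g : int -> R[i]) : R[i] :=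
  limn (fun n : nat =>
    \sum_(i < n.*2.+1) conjc (f (i%:Z - n%:Z)) * g (i%:Z - n%:Z) : R[i]^o).

Definition delta (R : realType) (k : int) : int -> R[i] :=
  fun j => (j == k)%:R.
Arguments delta R k : clear implicits.

Record projection_valued_measure (R : realType)
    (E : set (plane R) -> (int -> R[i]) -> (int -> R[i])) : Prop :=
  ProjectionValuedMeasure {
    pvm_l2 : forall A f, measurable A -> l2 f -> l2 (E A f) ;
    pvm_linear : forall A (c : R[i]) f g, measurable A -> l2 f -> l2 g ->
      E A (fun k => c * f k + g k) = (fun k => c * E A f k + E A g k) ;
    pvm_selfadjoint : forall A f g, measurable A -> l2 f -> l2 g ->
      dotp (E A f) g = dotp f (E A g) ;
    (* with A = B : E A is idempotent *)
    pvm_setI : forall A B f, measurable A -> measurable B -> l2 f ->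
      E (A `&` B) f = E A (E B f) ;
    pvm_circle : forall f, l2 f -> E (unit_circle R) f = f ;
    (* convergence in the strong operator topology *)
    pvm_sigma_additive : forall (A : nat -> set (plane R)) f,
      (forall n, measurable (A n)) -> trivIset setT A -> l2 f ->
      (fun N : nat => sqnorm (fun k =>
         E (\bigcup_n A n) f k - \sum_(n < N) E (A n) f k)) @ \oo --> 0%E
  }.

(* E is the spectral measure of U, i.e. U is the integral of zeta dE(zeta);
   by polarization it is enough to say this for the quadratic forms, for
   which the scalar measures (f, E(.) f) are nonnegative. *)
Definition spectral_measure (R : realType)
    (U : (int -> R[i]) -> (int -> R[i]))
    (E : set (plane R) -> (int -> R[i]) -> (int -> R[i])) : Prop :=
  projection_valued_measure E /\
  forall f, l2 f ->
    dotp f (U f) =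
    cintegral (fun A => (complex.Re (dotp f (E A f)))%:E) (unit_circle R) id.

Definition trace_measure (R : realType) (S : set (plane R) -> 'M[R[i]]_2) :
    set (plane R) -> \bar R :=
  fun A => (complex.Re (\tr (S A)))%:E.

Definition is_density (R : realType) (S : set (plane R) -> 'M[R[i]]_2)
    (w : plane R -> 'M[R[i]]_2) : Prop :=
  forall l l' : 'I_2,
    cintegrable (trace_measure S) (unit_circle R) (fun z => w z l l') /\
    forall A, measurable A -> A `<=` unit_circle R ->
      S A l l' = cintegral (trace_measure S) A (fun z => w z l l').

(* The matrix of Radon-Nikodym derivatives of the entries of S with respect
   to the trace measure of S, which dominates them. *)
Definition density (R : realType) (S : set (plane R) -> 'M[R[i]]_2) :
    plane R -> 'M[R[i]]_2 :=
  xget (fun=> 0) (is_density S).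

(* The integrand of F^* dS G with respect to the trace measure. The entries
   of F and G need not be integrable against the entries of S one by one. *)
Definition L2_integrand (R : realType) (S : set (plane R) -> 'M[R[i]]_2)
    (F G : plane R -> 'cV[R[i]]_2) : plane R -> R[i] :=
  fun z => ((map_mx (@conjc R) (F z))^T *m density S z *m G z) 0 0.

Definition in_L2 (R : realType) (S : set (plane R) -> 'M[R[i]]_2)
    (F : plane R -> 'cV[R[i]]_2) : Prop :=
  (forall l : 'I_2,
     measurable_fun (unit_circle R) (fun z => F z l 0 : plane R)) /\
  cintegrable (trace_measure S) (unit_circle R) (L2_integrand S F F).

Definition L2_dotp (R : realType) (S : set (plane R) -> 'M[R[i]]_2)
    (F G : plane R -> 'cV[R[i]]_2) : R[i] :=
  cintegral (trace_measure S) (unit_circle R) (L2_integrand S F G).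

Definition L2_norm (R : realType) (S : set (plane R) -> 'M[R[i]]_2)
    (F : plane R -> 'cV[R[i]]_2) : R :=
  Num.sqrt (complex.Re (L2_dotp S F F)).

(* Complete: the linear span is dense. *)
Definition complete_orthonormal_system (R : realType)
    (S : set (plane R) -> 'M[R[i]]_2)
    (Phi : int -> plane R -> 'cV[R[i]]_2) : Prop :=
  [/\ forall k, in_L2 S (Phi k),
      forall k k', L2_dotp S (Phi k) (Phi k') = (k == k')%:R
    & forall F, in_L2 S F -> forall e : R, 0 < e ->
        exists (s : seq int) (c : int -> R[i]),
          L2_norm S (fun z => F z - \sum_(k <- s) c k *: Phi k z) < e].

Definition oddz (k : int) : bool := odd `|k|%N.

Definition mx22 (T : Type) (a b c d : T) : 'M[T]_2 :=
  \matrix_(i < 2, j < 2)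
    if i == 0 then (if j == 0 then a else b) else (if j == 0 then c else d).

Definition cv2 (T : Type) (x y : T) : 'cV[T]_2 :=
  \col_(i < 2) if i == 0 then x else y.

Definition rho (R : realType) (alpha : int -> R[i]) (k : int) : R[i] :=
  (Num.sqrt (1 - ComplexField.Normc.normc (alpha k) ^+ 2))%:C%C.

Definition theta (R : realType) (alpha : int -> R[i]) (k : int) : 'M[R[i]]_2 :=
  mx22 (- alpha k) (rho alpha k) (rho alpha k) (conjc (alpha k)).

(* The operator with the block theta_m on rows and columns m - 1, m, for
   all m of parity b (b = true: odd). *)
Definition block_operator (R : realType) (alpha : int -> R[i]) (b : bool)
    (f : int -> R[i]) : int -> R[i] :=
  fun j =>
    if oddz j == b
    then (theta alpha j *m cv2 (f (j - 1)) (f j)) 1 0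
    else (theta alpha (j + 1) *m cv2 (f j) (f (j + 1))) 0 0.

Definition cmvV (R : realType) (alpha : int -> R[i]) :
  (int -> R[i]) -> (int -> R[i]) := block_operator alpha false.

Definition cmvW (R : realType) (alpha : int -> R[i]) :
  (int -> R[i]) -> (int -> R[i]) := block_operator alpha true.

Definition cmvU (R : realType) (alpha : int -> R[i]) :
  (int -> R[i]) -> (int -> R[i]) := cmvV alpha \o cmvW alpha.

Definition Omega (R : realType)
    (E : set (plane R) -> (int -> R[i]) -> (int -> R[i])) (k0 : int) :
    set (plane R) -> 'M[R[i]]_2 :=
  fun A => \matrix_(l < 2, l' < 2)
    dotp (delta R (k0 - 1 + l%:Z)) (E A (delta R (k0 - 1 + l'%:Z))).

Definition transfer (R : realType) (alpha : int -> R[i]) (z : R[i]) (k : int) :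
    'M[R[i]]_2 :=
  (rho alpha k)^-1 *:
    (if oddz k then mx22 (alpha k) z z^-1 (conjc (alpha k))
     else mx22 (conjc (alpha k)) 1 1 (alpha k)).

Definition transfer_solution (R : realType) (alpha : int -> R[i]) (k0 : int)
    (init : R[i] -> 'cV[R[i]]_2) (u v : R[i] -> int -> R[i]) : Prop :=
  forall z : R[i], z != 0 ->
    cv2 (u z k0) (v z k0) = init z /\
    forall k, cv2 (u z k) (v z k) =
              transfer alpha z k *m cv2 (u z (k - 1)) (v z (k - 1)).

Definition init_pr (R : realType) (k0 : int) (z : R[i]) : 'cV[R[i]]_2 :=
  if oddz k0 then cv2 z 1 else cv2 1 1.

Definition init_qs (R : realType) (k0 : int) (z : R[i]) : 'cV[R[i]]_2 :=
  if oddz k0 then cv2 z (- 1) else cv2 (- 1) 1.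

(* The requirements on (p_+, r_+) and (q_+, s_+) can be met, the transfer
   matrices being invertible. *)
Lemma transfer_unit (R : realType) (alpha : int -> R[i]) (z : R[i]) (k : int) :
  (forall j, `|alpha j| < 1) -> z != 0 -> transfer alpha z k \in unitmx.
Proof.
move=> alpha1 z0.
have n1 : alpha k * conjc (alpha k) - 1 != 0.
  rewrite -sqr_normc subr_eq0 lt_eqF //.
  by rewrite expr_lt1 ?normr_ge0 ?alpha1.
have rho0 : rho alpha k != 0.
  rewrite /rho fmorph_eq0 sqrtr_eq0 -ltNge subr_gt0.
  have := alpha1 k; rewrite ltcR => a1.
  rewrite expr_lt1 //.
  by case: (alpha k) => x y /=; exact: sqrtr_ge0.
rewrite /transfer unitmxZ ?unitfE ?invr_eq0 // unitmxE unitfE.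
rewrite (expand_det_row _ 0) big_ord_recl big_ord1 /cofactor !det_mx11.
have -> : (0 + bump 0 0)%N = 1%N by [].
case: ifP => _; rewrite !mxE /= ?mxE /= !(expr0, expr1, mul1r, mulN1r, mulrN, mulr1).
  by rewrite divff.
by rewrite mulrC.
Qed.

Lemma transfer_solution_exists (R : realType) (alpha : int -> R[i]) (k0 : int)
    (init : R[i] -> 'cV[R[i]]_2) :
  (forall j, `|alpha j| < 1) ->
  exists u v : R[i] -> int -> R[i], transfer_solution alpha k0 init u v.
Proof.
move=> alpha1.
pose fwd z := fix f (n : nat) : 'cV[R[i]]_2 :=
  if n is m.+1 then transfer alpha z (k0 + m.+1%:Z) *m f m else init z.
pose bwd z := fix f (n : nat) : 'cV[R[i]]_2 :=
  if n is m.+1 then invmx (transfer alpha z (k0 - m%:Z)) *m f m else init z.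
pose x z k := match k - k0 with Posz n => fwd z n | Negz n => bwd z n.+1 end.
exists (fun z k => x z k 0 0), (fun z k => x z k 1 0) => z z0.
have cv2E (y : 'cV[R[i]]_2) : cv2 (y 0 0) (y 1 0) = y.
  apply/colP => i; rewrite !mxE.
  by case: (unliftP 0 i) => [j|] -> //=; rewrite (ord1 j); congr (y _ _); apply/val_inj.
split=> [|k]; rewrite !cv2E {1}/x; first by rewrite subrr.
rewrite /x; have -> : k - 1 - k0 = k - k0 - 1 by rewrite addrAC.
have [n kn] : exists n, k - k0 = n by eexists.
have -> : k = k0 + n by rewrite -kn addrC subrK.
rewrite addrAC subrr add0r; case: n {kn} => [[|m]|m] /=.
- by rewrite !(subnn, subr0, addr0) mulKVmx // transfer_unit.
- by rewrite subn1.
- by rewrite !addn0 NegzE mulKVmx // transfer_unit.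
Qed.

Definition aplus (R : realType) (alpha : int -> R[i]) (k : int) : R[i] :=
  1 + alpha k.

Definition bminus (R : realType) (alpha : int -> R[i]) (k : int) : R[i] :=
  1 - alpha k.

Definition Pvec (R : realType) (alpha : int -> R[i]) (k0 : int)
    (p q : R[i] -> int -> R[i]) (k : int) (z : plane R) : 'cV[R[i]]_2 :=
  let rho0 := rho alpha k0 in
  let a := aplus alpha k0 in
  let b := bminus alpha k0 in
  if oddz k0
  then (2 * (z : R[i]))^-1 *:
         (mx22 (- rho0) rho0 (conjc b) (conjc a) *m cv2 (q z k) (p z k))
  else 2^-1 *: (mx22 rho0 rho0 (- b) a *m cv2 (q z k) (p z k)).

Definition Rvec (R : realType) (alpha : int -> R[i]) (k0 : int)
    (r s : R[i] -> int -> R[i]) (k : int) (z : plane R) : 'cV[R[i]]_2 :=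
  let rho0 := rho alpha k0 in
  let a := aplus alpha k0 in
  let b := bminus alpha k0 in
  if oddz k0
  then 2^-1 *: (mx22 rho0 rho0 (- b) a *m cv2 (s z k) (r z k))
  else 2^-1 *:
         (mx22 (- rho0) rho0 (conjc b) (conjc a) *m cv2 (s z k) (r z k)).

(* Main.v *)
(** If [(u, v)] solves the transfer recursion then [W u = z v] and [V v = u],
    so [V W u = z u] and [W V v = z v].  Both
    matrices being symmetric, [delta_k |-> R(z, k)] turns [U = V W] into
    multiplication by [z], and [delta_k |-> P(z, k)] does the same for
    the transpose [W V], whose spectral measure is the complex conjugate of
    that of [U]; the two halves are the same statement with [V] and [W]
    exchanged.
    Call [rep f F] the smallest linear relation between vectors [f] of l^2 and
    functions [F] on the circle that relates [delta_(k0-1)], [delta_k0] to the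
    constants [e_0], [e_1] and is stable under [(E A f, 1_A F)],
    [(U f, z F)] and [(U^-1 f, z^-1 F)].  By induction it satisfies
    [(f, E A g) = \int_A F^* dOmega G].  The recursion puts every
    [(delta_k, R_k)] into the relation, which gives orthonormality.  For
    completeness, an L^2 function is truncated, then approximated uniformly by
    a step function; a step function is the image of a vector of l^2, and it
    is enough to cut off that vector. *)
Require Import Defs.
From HB Require Import structures.
From mathcomp Require Import all_boot all_order all_algebra.
From mathcomp Require Import complex.
From mathcomp Require Import ring lra zify.
From mathcomp Require Import all_classical all_reals all_analysis measurable_realfun.
Import Order.TTheory GRing.Theory Num.Theory numFieldNormedType.Exports.
Local Open Scope classical_set_scope.
Local Open Scope ring_scope.
Set Implicit Arguments.
Unset Strict Implicit.
Unset Printing Implicit Defensive.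

(** The recursion has order one only for the pair of sequences, so no induction on [delta_k] alone
    can close: each [delta_k] is carried together with its image under the outer factor of the
    operator (V for VW, W for WV). That image is represented by the other member of the pair, and by
    z times it in the transposed case. The coefficient matrices in P and R are the change of basis
    of solutions that makes the function at [k0] the constant e_1 and its partner the image of
    [delta_k0]. The factor 1/2 comes from a + b = 2 and a - b = 2 alpha. Two obstacles shape the
    rest. The spectral hypothesis speaks only of the diagonal forms (f, U f), so mixed products are
    reached by polarization. The density of the matrix measure is an arbitrary choice, positive only
    almost everywhere, so it is exchanged for a version that is positive with trace one at every
    point, hence bounded; after that all estimates are pointwise. A relation generated from below
    needs neither a quotient by null functions nor a proof that the represented vector depends only
    on the function. *)

Local Notation Re := (@complex.Re _).
Local Notation Im := (@complex.Im _).

(** * Real and imaginary parts, and convergence of complex sequences *)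

Section ComplexParts.
Context {R : realType}.
Implicit Types (x y z : R[i]) (a : R) (u v : nat -> R[i]).

Lemma cplx_eq x y : Re x = Re y -> Im x = Im y -> x = y.
Proof. by case: x y => a b [c d] /= -> ->. Qed.

Lemma ReD x y : Re (x + y) = Re x + Re y. Proof. by case: x y => ? ? []. Qed.
Lemma ImD x y : Im (x + y) = Im x + Im y. Proof. by case: x y => ? ? []. Qed.
Lemma ReN x : Re (- x) = - Re x. Proof. by case: x. Qed.
Lemma ImN x : Im (- x) = - Im x. Proof. by case: x. Qed.
Lemma ReM x y : Re (x * y) = Re x * Re y - Im x * Im y.
Proof. by case: x y => ? ? []. Qed.
Lemma ImM x y : Im (x * y) = Re x * Im y + Im x * Re y.
Proof. by case: x y => ? ? []. Qed.
Lemma ReC x : Re (conjc x) = Re x. Proof. by case: x. Qed.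
Lemma ImC x : Im (conjc x) = - Im x. Proof. by case: x. Qed.
Lemma Re0 : Re (0 : R[i]) = 0. Proof. by []. Qed.
Lemma Im0 : Im (0 : R[i]) = 0. Proof. by []. Qed.
Lemma Re1 : Re (1 : R[i]) = 1. Proof. by []. Qed.
Lemma Im1 : Im (1 : R[i]) = 0. Proof. by []. Qed.

Definition reimE := (ReD, ImD, ReN, ImN, ReM, ImM, ReC, ImC, Re0, Im0, Re1, Im1).

Lemma Re_sum (I : Type) (r : seq I) (P : pred I) (F : I -> R[i]) :
  Re (\sum_(i <- r | P i) F i) = \sum_(i <- r | P i) Re (F i).
Proof. exact: (big_morph _ ReD Re0). Qed.

Lemma Im_sum (I : Type) (r : seq I) (P : pred I) (F : I -> R[i]) :
  Im (\sum_(i <- r | P i) F i) = \sum_(i <- r | P i) Im (F i).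
Proof. exact: (big_morph _ ImD Im0). Qed.

Definition normc2 x : R := Re x ^+ 2 + Im x ^+ 2.

Lemma normc2E x : ComplexField.Normc.normc x ^+ 2 = normc2 x.
Proof. by case: x => a b; rewrite sqr_sqrtr// addr_ge0// sqr_ge0. Qed.

Lemma normc2_ge0 x : 0 <= normc2 x.
Proof. by rewrite addr_ge0 ?sqr_ge0. Qed.

Lemma normc2M x y : normc2 (x * y) = normc2 x * normc2 y.
Proof. by rewrite /normc2 !reimE; ring. Qed.

Lemma normc2D x y : normc2 (x + y) <= 2 * normc2 x + 2 * normc2 y.
Proof.
rewrite /normc2 !reimE -subr_ge0.
have -> : forall p q r s : R,
  2 * (p ^+ 2 + q ^+ 2) + 2 * (r ^+ 2 + s ^+ 2) - ((p + r) ^+ 2 + (q + s) ^+ 2)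
  = (p - r) ^+ 2 + (q - s) ^+ 2 by move=> p q r s; ring.
by rewrite addr_ge0 ?sqr_ge0.
Qed.

Lemma conjc_mulr x : conjc x * x = (normc2 x)%:C%C.
Proof. by case: x => a b; apply: cplx_eq; rewrite /normc2 !reimE /=; ring. Qed.

Lemma normr_le_ReIm x : `|x| <= (`|Re x| + `|Im x|)%:C%C.
Proof.
rewrite {1}(complexE x) (le_trans (ler_normD _ _))// normrM.
have -> : `|'i%C : R[i]| = 1 by rewrite normc_def /= expr0n expr1n add0r sqrtr1.
have H a : `|a%:C%C : R[i]| = `|a|%:C%C.
  by rewrite normc_def /= expr0n addr0 sqrtr_sqr.
by rewrite mul1r !H -rmorphD /= lexx.
Qed.

Lemma normr_Re_le x : `|Re x|%:C%C <= `|x|. Proof. exact: normc_ge_Re. Qed.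

Lemma normr_Im_le x : `|Im x|%:C%C <= `|x|.
Proof.
have := normc_ge_Re (x * 'i%C); rewrite ReiNIm normrN normrM.
have -> : `|'i%C : R[i]| = 1 by rewrite normc_def /= expr0n expr1n add0r sqrtr1.
by rewrite mulr1.
Qed.

Lemma cvgcP u x : (u @ \oo --> (x : R[i]^o)) <->
  ((fun n => Re (u n)) @ \oo --> Re x) /\ ((fun n => Im (u n)) @ \oo --> Im x).
Proof.
split=> [h0|[hr0 hi0]].
  have h := proj1 (@cvgrPdist_lt _ R[i]^o _ _ eventually_filter _ _) h0.
  split; apply: (proj2 (@cvgrPdist_lt _ R _ _ eventually_filter _ _)) => e e0.
  + have e0' : 0 < (e%:C%C : R[i]) by rewrite ltcR.
    have := h _ e0'; apply: filterS => n hn.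
    by rewrite -ltcR (le_lt_trans _ hn)//= -ReN -ReD normr_Re_le.
  + have e0' : 0 < (e%:C%C : R[i]) by rewrite ltcR.
    have := h _ e0'; apply: filterS => n hn.
    by rewrite -ltcR (le_lt_trans _ hn)//= -ImN -ImD normr_Im_le.
have hr := proj1 (@cvgrPdist_lt _ R _ _ eventually_filter _ _) hr0.
have hi := proj1 (@cvgrPdist_lt _ R _ _ eventually_filter _ _) hi0.
- apply: (proj2 (@cvgrPdist_lt _ R[i]^o _ _ eventually_filter _ _)) => e e0.
  (* The radii of balls in [R[i]^o] are positive complex numbers, and a positive complex number is
     real. *)
  have [a a0 ->] : exists2 a : R, 0 < a & e = a%:C%C.
    move: e0; rewrite ltcE /= => /andP[/eqP he h]; exists (Re e) => //.
    exact: cplx_eq.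
  have a2 : 0 < a / 2 by rewrite divr_gt0.
  near=> n.
  rewrite (le_lt_trans (normr_le_ReIm _))// ltcR !reimE (splitr a) ltrD//.
  + by near: n; exact: hr.
  + by near: n; exact: hi.
Unshelve. all: by end_near. Qed.

Lemma cvgc_unique u x y :
  u @ \oo --> (x : R[i]^o) -> u @ \oo --> (y : R[i]^o) -> x = y.
Proof.
by move=> ux uy; rewrite -(cvg_lim (@norm_hausdorff _ R[i]^o) ux)
  -(cvg_lim (@norm_hausdorff _ R[i]^o) uy).
Qed.

Lemma cvgc_lim u x : u @ \oo --> (x : R[i]^o) -> limn (u : nat -> R[i]^o) = x.
Proof. by move=> ux; apply: (cvg_lim (@norm_hausdorff _ R[i]^o) ux). Qed.

Lemma cvgcD u v x y : u @ \oo --> (x : R[i]^o) -> v @ \oo --> (y : R[i]^o) ->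
  (fun n => u n + v n) @ \oo --> (x + y : R[i]^o).
Proof.
move=> /cvgcP[ur ui] /cvgcP[vr vi]; apply/cvgcP; split.
  by rewrite ReD; under eq_fun do rewrite ReD; apply: cvgD.
by rewrite ImD; under eq_fun do rewrite ImD; apply: cvgD.
Qed.

Lemma cvgcM u x c : u @ \oo --> (x : R[i]^o) ->
  (fun n => c * u n) @ \oo --> (c * x : R[i]^o).
Proof.
move=> /cvgcP[ur ui]; apply/cvgcP; split.
  by rewrite ReM; under eq_fun do rewrite ReM; apply: cvgB; apply: cvgMl_tmp.
by rewrite ImM; under eq_fun do rewrite ImM; apply: cvgD; apply: cvgMl_tmp.
Qed.

Lemma cvgc_conj u x : u @ \oo --> (x : R[i]^o) ->
  (fun n => conjc (u n)) @ \oo --> (conjc x : R[i]^o).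
Proof.
move=> /cvgcP[hr hi]; apply/cvgcP; split.
  by rewrite ReC; under eq_fun do rewrite ReC.
by rewrite ImC; under eq_fun do rewrite ImC; apply: cvgN.
Qed.

End ComplexParts.

(** * The inner product of l^2(Z) *)

Section SquareSummable.
Context {R : realType}.
Implicit Types (f g h : int -> R[i]) (c : R[i]) (n : nat) (k : int).

Definition sumZ (V : zmodType) (h : int -> V) n : V :=
  \sum_(i < n.*2.+1) h (i%:Z - n%:Z).

Definition ballZ n : seq int := [seq i%:Z - n%:Z | i <- iota 0 n.*2.+1].

Lemma sumZE (V : zmodType) (h : int -> V) n : sumZ h n = \sum_(k <- ballZ n) h k.
Proof.
by rewrite /sumZ /ballZ big_map -(big_mkord xpredT (fun i => h (i%:Z - n%:Z))).
Qed.

Lemma ballZ_uniq n : uniq (ballZ n).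
Proof. by rewrite map_inj_uniq ?iota_uniq// => i j /addIr []. Qed.

Lemma mem_ballZ n k : (k \in ballZ n) = (`|k|%N <= n)%N.
Proof.
apply/mapP/idP => [[j]|kn]; first by rewrite mem_iota => ? ->; lia.
by exists (absz (k + n%:Z)); [rewrite mem_iota; lia|lia].
Qed.

Lemma sumZS (V : zmodType) (h : int -> V) n :
  sumZ h n.+1 = h (- n.+1%:Z) + sumZ h n + h n.+1%:Z.
Proof.
rewrite /sumZ doubleS big_ord_recl big_ord_recr /= addrA; congr (_ + _ + _).
- by congr h; lia.
- by apply: eq_bigr => i _; congr h; rewrite /bump /=; lia.
- by congr h; rewrite /bump /=; lia.
Qed.

Lemma sumZ_nd (h : int -> R) : (forall k, 0 <= h k) ->
  nondecreasing_seq (sumZ h).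
Proof.
move=> h0; apply/nondecreasing_seqP => n; rewrite sumZS.
by rewrite addrAC ler_wpDl// addr_ge0.
Qed.

(** Every finite set of indices lies in the interval of radius the largest absolute value in it, so
    the supremum over finite sets is already reached by the symmetric partial sums. *)
Lemma sqnormE f :
  sqnorm f = ereal_sup (range (fun n => (sumZ (normc2 \o f) n)%:E)).
Proof.
have a0 k : (0 <= (ComplexField.Normc.normc (f k) ^+ 2)%:E)%E.
  by rewrite lee_fin normc2E normc2_ge0.
have E n : (sumZ (normc2 \o f) n)%:E =
    (\sum_(k \in [set` ballZ n]) (ComplexField.Normc.normc (f k) ^+ 2)%:E)%E.
  rewrite -fsbig_seq ?ballZ_uniq// sumZE -sumEFin.
  by apply: eq_bigr => k _; rewrite normc2E.
apply/le_anti/andP; split.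
- apply: ge_ereal_sup => _ [F [finF _] <-].
  have [s Fs] := (finite_seqP F).1 finF.
  pose n := (\max_(k <- s) `|k|)%N.
  apply: (@le_trans _ _ (sumZ (normc2 \o f) n)%:E); last first.
    by apply: ereal_sup_ubound; exists n.
  rewrite E; apply: lee_fsum_nneg_subset => //=.
  + move=> k; rewrite inE => kF; rewrite inE /= mem_ballZ.
      apply: (@leq_bigmax_seq _ s xpredT (fun k => `|k|%N)) => //.
    by move: kF; rewrite Fs.
- apply: ge_ereal_sup => _ [n _ <-]; apply: ereal_sup_ubound.
  exists [set` ballZ n]; last by rewrite E.
  by split=> //; apply/finite_seqP; exists (ballZ n).
Qed.

Lemma l2P f : l2 f <-> exists M : R, forall n, sumZ (normc2 \o f) n <= M.
Proof.
rewrite /l2 sqnormE; split=> [fin|[M hM]].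
- have := ereal_sup_ubound; move: fin; set S := ereal_sup _ => fin ub.
  exists (fine S) => n; rewrite -lee_fin fineK; first by apply: ub; exists n.
  rewrite ge0_fin_numE//; apply: (@le_trans _ _ (sumZ (normc2 \o f) 0)%:E).
    by rewrite lee_fin; apply: sumr_ge0 => i _; apply: normc2_ge0.
  by apply: ub; exists 0%N.
- apply: (@le_lt_trans _ _ M%:E); last by rewrite ltry.
  by apply: ge_ereal_sup => _ [n _ <-]; rewrite lee_fin.
Qed.

Lemma l2_le f g (C : R) : (forall k, normc2 (g k) <= C * normc2 (f k)) ->
  0 <= C -> l2 f -> l2 g.
Proof.
move=> gf C0 /l2P[M hM]; apply/l2P; exists (C * M) => n.
apply: (@le_trans _ _ (C * sumZ (normc2 \o f) n)); last exact: ler_wpM2l.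
by rewrite /sumZ mulr_sumr; apply: ler_sum => i _; apply: gf.
Qed.

Lemma l2D f g : l2 f -> l2 g -> l2 (fun k => f k + g k).
Proof.
move=> /l2P[M hM] /l2P[N hN]; apply/l2P; exists (2 * M + 2 * N) => n.
apply: (@le_trans _ _ (2 * sumZ (normc2 \o f) n + 2 * sumZ (normc2 \o g) n)).
  rewrite /sumZ !mulr_sumr -big_split /=; apply: ler_sum => i _.
  exact: normc2D.
by rewrite lerD// ler_wpM2l.
Qed.

Lemma l2Z c f : l2 f -> l2 (fun k => c * f k).
Proof.
by apply: (l2_le (C := normc2 c)) => [k|]; rewrite ?normc2M ?normc2_ge0.
Qed.

Lemma l2_lin c f g : l2 f -> l2 g -> l2 (fun k => c * f k + g k).
Proof. by move=> hf hg; apply: l2D => //; apply: l2Z. Qed.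

Lemma l2_sum (I : Type) (s : seq I) (c : I -> R[i]) (f : I -> int -> R[i]) :
  (forall i, l2 (f i)) -> l2 (fun k => \sum_(i <- s) c i * f i k).
Proof.
move=> hf; elim: s => [|i s IH].
  apply/l2P; exists 0 => n; rewrite /sumZ big1// => j _ /=.
  by rewrite big_nil /normc2 !reimE expr0n addr0.
by under eq_fun do rewrite big_cons; apply: l2_lin.
Qed.

Lemma l2_delta k : l2 (delta R k).
Proof.
apply/l2P; exists 1 => n; rewrite sumZE.
have [kn|kn] := boolP (k \in ballZ n).
- rewrite (bigD1_seq k) ?ballZ_uniq//= big1 => [|j jk]; last first.
    by rewrite /delta (negbTE jk) /normc2 !reimE expr0n addr0.
  by rewrite /delta eqxx /normc2 !reimE expr1n expr0n !addr0.
- rewrite big_seq big1 => [|j jn]; first exact: ler01.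
  have /negbTE e : j != k by apply: contraNneq kn => <-.
  by rewrite /= /delta e /normc2 !reimE expr0n addr0.
Qed.

Lemma sumZ_normc2_cvg f : l2 f -> cvgn (sumZ (normc2 \o f)).
Proof.
move=> /l2P[M hM]; apply: nondecreasing_is_cvgn.
  by apply: sumZ_nd => k; apply: normc2_ge0.
by exists M => _ [n _ <-].
Qed.

(** Polarization, 4 Re(conj(f) g) = |f + g|^2 - |f - g|^2, reduces the series to two series with
    nonnegative terms and bounded partial sums. *)
Lemma cvg_ReIm_dot f g : l2 f -> l2 g ->
  cvgn (sumZ (fun k => Re (conjc (f k) * g k))).
Proof.
move=> hf hg.
have hD := sumZ_normc2_cvg (l2D hf hg).
have hB := sumZ_normc2_cvg (l2_lin (-1) hf hg).
have -> : sumZ (fun k => Re (conjc (f k) * g k)) =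
  (fun n => 4^-1 * (sumZ (normc2 \o (fun k => (f k + g k))) n -
              sumZ (normc2 \o (fun k => (-1 * f k + g k))) n)).
  apply/funext => n; rewrite /sumZ -sumrB mulr_sumr; apply: eq_bigr => i _.
  by rewrite /= /normc2 !reimE; field.
apply/cvg_ex; eexists; apply: cvgMl_tmp; apply: cvgB; [exact: hD|exact: hB].
Qed.

Lemma dotp_cvg f g : l2 f -> l2 g ->
  sumZ (fun k => conjc (f k) * g k) @ \oo --> (dotp f g : R[i]^o).
Proof.
move=> hf hg.
have hR := cvg_ReIm_dot hf hg; have hI := cvg_ReIm_dot (l2Z 'i%C hf) hg.
(* The imaginary part of conj(f) g is the real part of conj(i f) g. *)
set l := Complex (limn (sumZ (fun k => Re (conjc (f k) * g k))))
  (limn (sumZ (fun k => Re (conjc ('i%C * f k) * g k)))).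
have hl : sumZ (fun k => conjc (f k) * g k) @ \oo --> (l : R[i]^o).
  apply/cvgcP; split.
  - have -> : (fun n => Re (sumZ (fun k => conjc (f k) * g k) n)) =
      sumZ (fun k => Re (conjc (f k) * g k)).
      by apply/funext => n; rewrite /sumZ Re_sum.
    exact: hR.
  - have -> : (fun n => Im (sumZ (fun k => conjc (f k) * g k) n)) =
      sumZ (fun k => Re (conjc ('i%C * f k) * g k)).
      apply/funext => n; rewrite /sumZ Im_sum; apply: eq_bigr => i _.
      by rewrite !reimE /=; ring.
    exact: hI.
by rewrite /dotp (cvgc_lim hl).
Qed.

Lemma dotpE f g l :
  sumZ (fun k => conjc (f k) * g k) @ \oo --> (l : R[i]^o) -> dotp f g = l.
Proof. by move=> hl; rewrite /dotp (cvgc_lim hl). Qed.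

Lemma dotp_near f g l :
  (\forall n \near \oo, sumZ (fun k => conjc (f k) * g k) n = l) -> dotp f g = l.
Proof.
move=> h; apply: dotpE; apply/cvgcP.
split; apply: cvg_near_cst; by apply: filterS h => n ->.
Qed.

Lemma dotp_linr f c g h : l2 f -> l2 g -> l2 h ->
  dotp f (fun k => c * g k + h k) = c * dotp f g + dotp f h.
Proof.
move=> hf hg hh; apply: dotpE.
have -> : sumZ (fun k => conjc (f k) * (c * g k + h k)) =
  (fun n => c * sumZ (fun k => conjc (f k) * g k) n +
            sumZ (fun k => conjc (f k) * h k) n).
  apply/funext => n; rewrite /sumZ mulr_sumr -big_split /=.
  by apply: eq_bigr => i _; ring.
by apply: cvgcD; [apply: cvgcM|]; apply: dotp_cvg.
Qed.

Lemma dotpC f g : l2 f -> l2 g -> dotp g f = conjc (dotp f g).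
Proof.
move=> hf hg; apply: dotpE.
have -> : sumZ (fun k => conjc (g k) * f k) =
  (fun n => conjc (sumZ (fun k => conjc (f k) * g k) n)).
  apply/funext => n; rewrite /sumZ rmorph_sum; apply: eq_bigr => i _.
  by rewrite rmorphM /= conjcK mulrC.
by apply: cvgc_conj; apply: dotp_cvg.
Qed.

Lemma dotp_linl f c g h : l2 f -> l2 g -> l2 h ->
  dotp (fun k => c * g k + h k) f = conjc c * dotp g f + dotp h f.
Proof.
move=> hf hg hh; have hgh := l2_lin c hg hh.
by rewrite dotpC// dotp_linr// rmorphD rmorphM /= -!dotpC.
Qed.

Definition nrm2 f : R := Re (dotp f f).

Lemma nrm2_cvg f : l2 f -> sumZ (normc2 \o f) @ \oo --> nrm2 f.
Proof.
move=> hf; have /cvgcP[+ _] := dotp_cvg hf hf.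
have -> // : (fun n => Re (sumZ (fun k => conjc (f k) * f k) n)) =
  sumZ (normc2 \o f).
by apply/funext => n; rewrite /sumZ Re_sum; apply: eq_bigr => i _;
  rewrite conjc_mulr.
Qed.

Lemma nrm2_ge0 f : l2 f -> 0 <= nrm2 f.
Proof.
move=> /nrm2_cvg hf; rewrite -(cvg_lim _ hf)//; apply: limr_ge.
  by apply/cvg_ex; exists (nrm2 f).
by near=> n; apply: sumr_ge0 => i _; apply: normc2_ge0.
Unshelve. all: by end_near. Qed.

Lemma dotpff f : l2 f -> dotp f f = (nrm2 f)%:C%C.
Proof.
move=> hf; apply: cplx_eq => //=.
by have := dotpC hf hf => /(congr1 (@complex.Im R)); rewrite ImC; lra.
Qed.

Lemma sqnorm_nrm2 f : l2 f -> sqnorm f = (nrm2 f)%:E.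
Proof.
move=> hf; rewrite sqnormE; have h := nrm2_cvg hf.
have nd : nondecreasing_seq (fun n => (sumZ (normc2 \o f) n)%:E).
  by move=> m n mn; rewrite lee_fin sumZ_nd// => k; apply: normc2_ge0.
have := ereal_nondecreasing_cvgn nd => /cvg_lim <- //.
by apply/cvg_lim => //; apply: cvg_EFin => //; exact: nearW.
Qed.

Lemma nrm2_eq0 f : l2 f -> nrm2 f = 0 -> f = fun=> 0.
Proof.
move=> hf f0; have := nrm2_cvg hf; rewrite f0 => h; apply/funext => k.
have nd : nondecreasing_seq (sumZ (normc2 \o f)).
  by apply: sumZ_nd => j; apply: normc2_ge0.
have := nondecreasing_cvgn_le nd (cvgP _ h) `|k|%N.
rewrite (cvg_lim _ h)// sumZE (bigD1_seq k) ?ballZ_uniq ?mem_ballZ//= => H.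
have : normc2 (f k) <= 0.
  by apply: le_trans H; rewrite lerDl sumr_ge0// => j _; apply: normc2_ge0.
rewrite /normc2; case: (f k) => a b /=.
move=> H'; have := sqr_ge0 a; have := sqr_ge0 b => b0 a0.
have /eqP : a ^+ 2 = 0 by lra.
have /eqP : b ^+ 2 = 0 by lra.
by rewrite !sqrf_eq0 => /eqP -> /eqP ->.
Qed.

Lemma nrm2_lin c f g : l2 f -> l2 g -> nrm2 (fun k => c * f k + g k) =
  normc2 c * nrm2 f + 2 * Re (conjc c * dotp f g) + nrm2 g.
Proof.
move=> hf hg; have hfg := l2_lin c hf hg.
rewrite /nrm2 dotp_linr// !dotp_linl// (dotpC hf hg) !reimE.
by rewrite (dotpff hf) /normc2 /=; ring.
Qed.

(** Nonnegativity of the squared norms of t f + g and -t f + g, divided by t. With t left free it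
    does the work of the Cauchy-Schwarz inequality without square roots. *)
Lemma Re_dotp_le f g (t : R) : 0 < t -> l2 f -> l2 g ->
  2 * `|Re (dotp f g)| <= t * nrm2 f + t^-1 * nrm2 g.
Proof.
move=> t0 hf hg.
have t1 : t * t^-1 = 1 by rewrite divff// gt_eqF.
have tv : 0 < t^-1 by rewrite invr_gt0.
have := nrm2_ge0 (l2_lin t%:C%C hf hg); have := nrm2_ge0 (l2_lin (- t)%:C%C hf hg).
rewrite !nrm2_lin// /normc2 !reimE /=.
set a := nrm2 f; set b := nrm2 g; set x := Re _ => h1 h2.
have -> : t * a + t^-1 * b = t^-1 * (t ^+ 2 * a + b) by field; rewrite gt_eqF.
have -> : 2 * `|x| = t^-1 * (2 * t * `|x|) by field; rewrite gt_eqF.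
rewrite ler_pM2l//; case: (ger0P x) => _; lra.
Qed.

Lemma nrm2D f g : l2 f -> l2 g ->
  nrm2 (fun k => f k + g k) <= 2 * nrm2 f + 2 * nrm2 g.
Proof.
move=> hf hg; have := nrm2_lin 1 hf hg.
have -> : (fun k => 1 * f k + g k) = (fun k => f k + g k).
  by apply/funext => k; rewrite mul1r.
have := Re_dotp_le ltr01 hf hg; rewrite invr1 !mul1r rmorph1 mul1r /normc2 !reimE.
move=> h ->; have := ler_norm (Re (dotp f g)); lra.
Qed.

Lemma dotp_deltal k f : dotp (delta R k) f = f k.
Proof.
apply: dotp_near; near=> n.
have kn : k \in ballZ n by rewrite mem_ballZ; near: n; exists `|k|%N.
rewrite sumZE (bigD1_seq k) ?ballZ_uniq//= big1 => [|j jk].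
  by rewrite /delta eqxx rmorph1 mul1r addr0.
by rewrite /delta (negbTE jk) rmorph0 mul0r.
Unshelve. all: by end_near. Qed.

Lemma dotp_suml (I : Type) (s : seq I) (c : I -> R[i]) (f : I -> int -> R[i]) g :
  (forall i, l2 (f i)) -> l2 g ->
  dotp (fun k => \sum_(i <- s) c i * f i k) g =
  \sum_(i <- s) conjc (c i) * dotp (f i) g.
Proof.
move=> hf hg; elim: s => [|i s IH].
  rewrite big_nil; apply: dotp_near; apply: nearW => n.
  by rewrite /sumZ big1// => j _; rewrite big_nil rmorph0 mul0r.
rewrite big_cons -IH; under eq_fun do rewrite big_cons.
by rewrite dotp_linl//; apply: l2_sum.
Qed.

Definition truncZ n f : int -> R[i] :=
  fun k => \sum_(j <- ballZ n) f j * delta R j k.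

Lemma l2_truncZ n f : l2 (truncZ n f).
Proof. by apply: (@l2_sum _ _ f (delta R)) => j; apply: l2_delta. Qed.

Lemma truncZE n f k : truncZ n f k = if k \in ballZ n then f k else 0.
Proof.
rewrite /truncZ; case: ifPn => kn.
  rewrite (bigD1_seq k) ?ballZ_uniq//= big1 => [|j jk].
    by rewrite /delta eqxx mulr1 addr0.
  by rewrite /delta eq_sym (negbTE jk) mulr0.
rewrite big_seq big1// => j jn; rewrite /delta.
have /negbTE -> : k != j by apply: contraNneq kn => ->.
by rewrite mulr0.
Qed.

(** The truncation has the same product with f as with itself, namely the partial sum of |f|^2, so
    the squared norm of the remainder is exactly the tail. *)
Lemma nrm2_truncZ_cvg f : l2 f ->
  (fun n => nrm2 (fun k => (-1) * truncZ n f k + f k)) @ \oo --> (0 : R).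
Proof.
move=> hf; have h := nrm2_cvg hf.
have E n : nrm2 (fun k => (-1) * truncZ n f k + f k) =
  nrm2 f - sumZ (normc2 \o f) n.
  rewrite nrm2_lin//; last exact: l2_truncZ.
  have d g : l2 g -> dotp (truncZ n f) g = \sum_(j <- ballZ n) conjc (f j) * g j.
    move=> hg; rewrite (@dotp_suml _ _ f (delta R))//; last exact: l2_delta.
    by apply: eq_bigr => j _; rewrite dotp_deltal.
  rewrite {1}/nrm2 !d//; last exact: l2_truncZ.
  have -> : \sum_(j <- ballZ n) conjc (f j) * truncZ n f j =
    \sum_(j <- ballZ n) conjc (f j) * f j.
    by apply: eq_big_seq => j jn; rewrite truncZE jn.
  have -> : \sum_(j <- ballZ n) conjc (f j) * f j = (sumZ (normc2 \o f) n)%:C%C.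
    by rewrite sumZE rmorph_sum; apply: eq_bigr => j _; rewrite conjc_mulr.
  by rewrite /normc2 !reimE /=; ring.
under eq_fun do rewrite E.
by rewrite -(subrr (nrm2 f)); apply: cvgB => //; apply: cvg_cst.
Qed.

End SquareSummable.

(** * Borel measurability on the complex plane *)

Section PlaneMeasurability.
Context {R : realType}.

Lemma open_plane_measurable (O : set (plane R)) :
  @open R[i]^o O -> measurable O.
Proof. by move=> oO; apply: sub_sigma_algebra. Qed.

(** Balls of [R[i]^o] have complex radii. Here and in [open_planeP] openness is restated with real
    radii and the sum of the two coordinate distances, which suits linear arithmetic. *)
Lemma open_plane_norm (O : set R[i]) :
  (forall z, O z -> exists2 e : R, 0 < e &
    forall y, `|Re z - Re y| + `|Im z - Im y| < e -> O y) ->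
  @open R[i]^o O.
Proof.
move=> h; rewrite openE => z /h[e e0 eO].
apply/(@nbhs_ballP _ R[i]^o); exists (e / 2)%:C%C.
  by rewrite /= ltcR divr_gt0.
move=> y; rewrite -ball_normE /= => zy; apply: eO.
have -> : e = e / 2 + e / 2 by rewrite -splitr.
rewrite -!ReN -!ReD -!ImN -!ImD ltrD// -ltcR (le_lt_trans _ zy)//.
  exact: normr_Re_le.
exact: normr_Im_le.
Qed.

Lemma open_planeP (O : set R[i]) z : @open R[i]^o O -> O z ->
  exists2 e : R, 0 < e &
    forall y, `|Re z - Re y| + `|Im z - Im y| < e -> O y.
Proof.
rewrite openE => /[apply] /(@nbhs_ballP _ R[i]^o)[e /= e0 eO].
exists (Re e); first by move: e0; rewrite ltcE => /andP[].
move=> y zy; apply: eO; rewrite -ball_normE /=.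
apply: (le_lt_trans (normr_le_ReIm _)); rewrite !reimE.
by move: e0; rewrite !ltcE /= => /andP[-> _].
Qed.

Lemma measurable_Re D : measurable_fun D (Re : plane R -> R).
Proof.
move=> mD; apply: (measurability _ (RGenOInfty.measurableE R)) => //.
move=> /= _ [_ [x ->] <-]; apply: measurableI => //.
apply: open_plane_measurable; apply: open_plane_norm => z /=.
rewrite in_itv/= andbT => xz; exists (Re z - x); rewrite ?subr_gt0// => y.
rewrite in_itv/= andbT => h; have := ler_norm (Re z - Re y).
by have := normr_ge0 (Im z - Im y); lra.
Qed.

Lemma measurable_Im D : measurable_fun D (Im : plane R -> R).
Proof.
move=> mD; apply: (measurability _ (RGenOInfty.measurableE R)) => //.
move=> /= _ [_ [x ->] <-]; apply: measurableI => //.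
apply: open_plane_measurable; apply: open_plane_norm => z /=.
rewrite in_itv/= andbT => xz; exists (Im z - x); rewrite ?subr_gt0// => y.
rewrite in_itv/= andbT => h; have := ler_norm (Im z - Im y).
by have := normr_ge0 (Re z - Re y); lra.
Qed.

Lemma measurable_unit_circle : measurable (unit_circle R).
Proof.
have mf : measurable_fun setT (fun z : plane R => Re z ^+ 2 + Im z ^+ 2).
  by apply: measurable_funD; apply: measurable_funX;
    [exact: measurable_Re|exact: measurable_Im].
have -> : unit_circle R =
    setT `&` (fun z : plane R => Re z ^+ 2 + Im z ^+ 2) @^-1` [set 1].
  rewrite setTI; apply/seteqP; split=> z; rewrite /unit_circle /=.
    move=> z1; have := add_Re2_Im2 z; rewrite z1 expr1n => /(congr1 (@complex.Re R)).
    by [].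
  by move=> z1; rewrite normc_def z1 sqrtr1.
by apply: mf => //; exact: measurable_set1.
Qed.

Definition cmeasurable d (T : measurableType d) (D : set T) (f : T -> R[i]) :=
  measurable_fun D (fun x => Re (f x)) /\ measurable_fun D (fun x => Im (f x)).

(** For the converse, an open set is the countable union of the rational squares that it contains,
    and the preimage of a square is an intersection of preimages under the two coordinates. *)
Lemma measurable_fun_plane d (T : measurableType d) (D : set T)
    (f : T -> plane R) : measurable_fun D f <-> cmeasurable D f.
Proof.
split=> [mf|[mr mi]].
  by split; apply: (measurableT_comp _ mf); [exact: measurable_Re|exact: measurable_Im].
move=> mD; apply: (measurability (@open R[i]^o : set (set (plane R))) erefl) => //.
move=> /= _ [U oU <-].
pose Q (p q : rat) (n : nat) : set (plane R) :=
  [set z | `|Re z - ratr p| < n.+1%:R^-1 /\ `|Im z - ratr q| < n.+1%:R^-1].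
(* Squares that are not contained in U contribute the empty set, so the three unions run over full
   countable types. *)
have -> : D `&` f @^-1` U = \bigcup_p \bigcup_q \bigcup_n
    (if `[< Q p q n `<=` U >] then D `&` f @^-1` Q p q n else set0).
  apply/seteqP; split=> x; last first.
    by move=> [p _ [q _ [n _]]]; case: asboolP => // QU [Dx /QU].
  move=> [Dx Ufx]; have [e e0 eU] := open_planeP oU Ufx.
  (* Two points of a square are less than twice its half-side apart in each coordinate; the sum over
     both coordinates is below four half-sides, hence the bound e / 4. *)
  have [n hn] : exists n : nat, n.+1%:R^-1 < e / 4.
    have e4 : 0 < e / 4 by rewrite divr_gt0.
    by have [n _ hn] := near_infty_natSinv_lt (PosNum e4); exists n; apply: hn => /=.
  have n0 : 0 < (n.+1%:R^-1 : R) by rewrite invr_gt0.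
  have itv (a : R) : a - n.+1%:R^-1 < a + n.+1%:R^-1.
    by rewrite ltrD2l; apply: lt_trans n0; rewrite oppr_lt0.
  have [p] := rat_in_itvoo (itv (Re (f x))).
  rewrite in_itv/= => /andP[p1 p2].
  have [q] := rat_in_itvoo (itv (Im (f x))).
  rewrite in_itv/= => /andP[q1 q2].
  exists p => //; exists q => //; exists n => //.
  rewrite asboolT; last first.
    move=> y [/=]; rewrite distrC => yp; rewrite distrC => yq; apply: eU.
    have := ler_distD (ratr p) (Re (f x)) (Re y).
    have := ler_distD (ratr q) (Im (f x)) (Im y).
    have hp : `|Re (f x) - ratr p| < n.+1%:R^-1 by rewrite distrC ltr_distl p1.
    have hq : `|Im (f x) - ratr q| < n.+1%:R^-1 by rewrite distrC ltr_distl q1.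
    move: hn hp hq yp yq.
    set v := n.+1%:R^-1; lra.
  by split=> //; split; rewrite distrC ltr_distl ?p1 ?q1.
apply: bigcupT_measurable_rat => p; apply: bigcupT_measurable_rat => q.
apply: bigcupT_measurable => n; case: asboolP => // _.
have -> : D `&` f @^-1` Q p q n =
  (D `&` (fun x => Re (f x)) @^-1` ball (ratr p : R) n.+1%:R^-1) `&`
  (D `&` (fun x => Im (f x)) @^-1` ball (ratr q : R) n.+1%:R^-1).
  apply/seteqP; split=> x; rewrite -!ball_normE /= (distrC (ratr p)) (distrC (ratr q)).
    by move=> [Dx [h1 h2]].
  by move=> [[Dx h1] [_ h2]].
by apply: measurableI; [apply: mr|apply: mi] => //; exact: measurable_ball.
Qed.

Section CMeasurable.
Context d (T : measurableType d) (D : set T).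
Implicit Types f g : T -> R[i].

Lemma cmeasurableD f g : cmeasurable D f -> cmeasurable D g ->
  cmeasurable D (fun x => f x + g x).
Proof.
move=> [fr fi] [gr gi]; split.
  by under eq_fun do rewrite ReD; apply: measurable_funD.
by under eq_fun do rewrite ImD; apply: measurable_funD.
Qed.

Lemma cmeasurableM f g : cmeasurable D f -> cmeasurable D g ->
  cmeasurable D (fun x => f x * g x).
Proof.
move=> [fr fi] [gr gi]; split.
  by under eq_fun do rewrite ReM; apply: measurable_funB; apply: measurable_funM.
by under eq_fun do rewrite ImM; apply: measurable_funD; apply: measurable_funM.
Qed.

Lemma cmeasurable_conj f : cmeasurable D f -> cmeasurable D (fun x => conjc (f x)).
Proof.
move=> [fr fi]; split; first by under eq_fun do rewrite ReC.
by under eq_fun do rewrite ImC; apply: measurableT_comp.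
Qed.

Lemma cmeasurable_cst c : cmeasurable D (fun=> c).
Proof. by split; exact: measurable_cst. Qed.

Lemma cmeasurable_sum (I : Type) (s : seq I) (f : I -> T -> R[i]) :
  (forall i, cmeasurable D (f i)) -> cmeasurable D (fun x => \sum_(i <- s) f i x).
Proof.
move=> mf; elim: s => [|i s IH].
  by under eq_fun do rewrite big_nil; exact: cmeasurable_cst.
by under eq_fun do rewrite big_cons; apply: cmeasurableD.
Qed.

Definition cindic (A : set T) (x : T) : R[i] := (\1_A x : R)%:C%C.

Lemma cmeasurable_cindic A : measurable A -> cmeasurable D (cindic A).
Proof. by move=> mA; split; [exact: measurable_indic|exact: measurable_cst]. Qed.

Lemma cmeasurableS (A : set T) f : measurable D -> A `<=` D ->
  cmeasurable D f -> cmeasurable A f.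
Proof. by move=> mD AD [fr fi]; split; apply: measurable_funS; eauto. Qed.

Lemma eq_cmeasurable f g : {in D, f =1 g} -> cmeasurable D f -> cmeasurable D g.
Proof.
by move=> fg [fr fi]; split; [move: fr|move: fi]; apply: eq_measurable_fun => x xD;
  rewrite fg.
Qed.

End CMeasurable.

Lemma cmeasurable_id D : cmeasurable D (fun z : plane R => (z : R[i])).
Proof. by split; [exact: measurable_Re|exact: measurable_Im]. Qed.

End PlaneMeasurability.

(** * Measures and densities from real-valued set functions *)

Section MeasureOfReal.
Context d (T : measurableType d) (R : realType) (m : set T -> R).
Hypothesis m0 : m set0 = 0.
Hypothesis m_ge0 : forall A, measurable A -> 0 <= m A.
Hypothesis m_sigma : forall F : nat -> set T,
  (forall n, measurable (F n)) -> trivIset setT F ->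
  (fun N => \sum_(n < N) m (F n)) @ \oo --> m (\bigcup_n F n).

(* The library asks for nonnegativity on all sets, measurable or not. *)
Let mext (A : set T) : \bar R := if `[< measurable A >] then (m A)%:E else 0%E.

Let mextE A : measurable A -> mext A = (m A)%:E.
Proof. by move=> mA; rewrite /mext asboolT. Qed.

Let mext0 : mext set0 = 0%E.
Proof. by rewrite mextE// m0. Qed.

Let mext_ge0 A : (0 <= mext A)%E.
Proof. by rewrite /mext; case: asboolP => // mA; rewrite lee_fin m_ge0. Qed.

Let mext_sigma : semi_sigma_additive mext.
Proof.
move=> F mF tF mUF; rewrite mextE//.
have -> : (fun n => \sum_(0 <= i < n) mext (F i))%E =
    EFin \o (fun N => \sum_(n < N) m (F n)).
  apply/funext => n; rewrite big_mkord /= -sumEFin.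
  by apply: eq_bigr => i _; rewrite mextE.
by apply: cvg_EFin; [exact: nearW|exact: m_sigma].
Qed.

HB.instance Definition _ := isMeasure.Build d T R mext mext0 mext_ge0 mext_sigma.

Let mext_fin : fin_num_fun mext.
Proof. by move=> A mA; rewrite mextE. Qed.

HB.instance Definition _ := Measure_isFinite.Build d T R mext mext_fin.

(** The set functions (f, E(.) f) and the trace of Omega are bare functions; this supplies a bundled
    measure that agrees with them on measurable sets, to which integration theory applies. *)
Lemma ex_finite_measure : exists mu : {finite_measure set T -> \bar R},
  forall A, measurable A -> mu A = (m A)%:E.
Proof. by exists mext => A mA; rewrite -mextE. Qed.

End MeasureOfReal.

Section ChargeOfReal.
Context d (T : measurableType d) (R : realType) (m : set T -> R).
Hypothesis m0 : m set0 = 0.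
Hypothesis m_sigma : forall F : nat -> set T,
  (forall n, measurable (F n)) -> trivIset setT F ->
  (fun N => \sum_(n < N) m (F n)) @ \oo --> m (\bigcup_n F n).

Let cext (A : set T) : \bar R := (m A)%:E.

Let cext0 : cext set0 = 0%E.
Proof. by rewrite /cext m0. Qed.

Let cext_fin A : measurable A -> cext A \is a fin_num.
Proof. by []. Qed.

Let cext_sigma : semi_sigma_additive cext.
Proof.
move=> F mF tF mUF.
have -> : (fun n => \sum_(0 <= i < n) cext (F i))%E =
    EFin \o (fun N => \sum_(n < N) m (F n)).
  by apply/funext => n; rewrite big_mkord /= -sumEFin.
by apply: cvg_EFin; [exact: nearW|exact: m_sigma].
Qed.

HB.instance Definition _ := isCharge.Build d T R cext cext0 cext_fin cext_sigma.

(** The Radon-Nikodym theorem for a signed set function. The derivative is finite at every point, so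
    passing to its real value loses nothing. *)
Lemma ex_real_density (mu : {finite_measure set T -> \bar R}) :
  (forall A, measurable A -> mu A = 0%E -> m A = 0) ->
  exists h : T -> R, mu.-integrable setT (EFin \o h) /\
    forall A, measurable A -> (m A)%:E = (\int[mu]_(x in A) (h x)%:E)%E.
Proof.
move=> dom; have numu : cext `<< mu.
  by apply/null_content_dominatesP => A mA muA; rewrite /cext dom.
pose h := fun x => fine (Radon_Nikodym cext mu x).
have hE x : (h x)%:E = Radon_Nikodym cext mu x.
  by rewrite fineK//; exact: Radon_Nikodym_fin_num.
exists h; split.
  by rewrite (_ : EFin \o h = Radon_Nikodym cext mu); [exact: Radon_Nikodym_integrable|
    apply/funext => x; exact: hE].
move=> A mA; under eq_integral do rewrite hE.
exact: (@Radon_Nikodym_integral _ _ _ cext mu A).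
Qed.

End ChargeOfReal.

(** * Integrals of complex functions *)

Section EqMeasureIntegral.
Context d (T : measurableType d) (R : realType).
Variables m1 m2 : set T -> \bar R.
Hypothesis m12 : forall A, measurable A -> m1 A = m2 A.

Import HBNNSimple.

(** The integral is a supremum of integrals of simple functions, and these involve the set function
    only on level sets, which are measurable. *)
Lemma eq_setfun_integral (D : set T) (f : T -> \bar R) :
  (\int[m1]_(x in D) f x = \int[m2]_(x in D) f x)%E.
Proof.
have E (h : {nnsfun T >-> R}) : sintegral m1 h = sintegral m2 h.
  by rewrite /sintegral; apply: eq_fsbigr => r _; rewrite m12.
rewrite /integral; congr (ereal_sup _ - ereal_sup _)%E; apply/seteqP; split;
  by move=> _ [h hf <-]; exists h.
Qed.

Lemma eq_setfun_integrable (D : set T) (f : T -> \bar R) :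
  m1.-integrable D f <-> m2.-integrable D f.
Proof.
by split=> /integrableP[mf fi]; apply/integrableP; split=> //; move: fi;
  rewrite eq_setfun_integral.
Qed.

End EqMeasureIntegral.

Section ComplexIntegral.
Context {R : realType}.
Implicit Types (D A : set (plane R)) (f g : plane R -> R[i]).

Definition cbounded D f :=
  exists M : R, forall z, D z -> `|Re (f z)| <= M /\ `|Im (f z)| <= M.

Lemma cbounded_cst D c : cbounded D (fun=> c).
Proof.
exists (`|Re c| + `|Im c|) => z _; split.
  by rewrite lerDl.
by rewrite lerDr.
Qed.

Lemma cboundedD D f g : cbounded D f -> cbounded D g ->
  cbounded D (fun z => f z + g z).
Proof.
move=> [M hM] [N hN]; exists (M + N) => z Dz; rewrite !reimE.
have [? ?] := hM z Dz; have [? ?] := hN z Dz.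
by split; apply: (le_trans (ler_normD _ _)); rewrite lerD.
Qed.

Lemma cboundedM D f g : cbounded D f -> cbounded D g ->
  cbounded D (fun z => f z * g z).
Proof.
move=> [M hM] [N hN]; exists (M * N + M * N) => z Dz; rewrite !reimE.
have [? ?] := hM z Dz; have [? ?] := hN z Dz.
split.
  by rewrite (le_trans (ler_normB _ _))// !normrM lerD// ler_pM.
by rewrite (le_trans (ler_normD _ _))// !normrM lerD// ler_pM.
Qed.

Lemma cbounded_conj D f : cbounded D f -> cbounded D (fun z => conjc (f z)).
Proof.
by move=> [M hM]; exists M => z Dz; rewrite !reimE normrN; apply: hM.
Qed.

Lemma cbounded_sum D (I : Type) (s : seq I) (f : I -> plane R -> R[i]) :
  (forall i, cbounded D (f i)) -> cbounded D (fun z => \sum_(i <- s) f i z).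
Proof.
move=> hf; elim: s => [|i s IH].
  by under eq_fun do rewrite big_nil; exact: cbounded_cst.
by under eq_fun do rewrite big_cons; apply: cboundedD.
Qed.

Lemma cbounded_cindic D A : cbounded D (cindic A).
Proof.
exists 1 => z _; rewrite /cindic /= normr0; split=> //.
by rewrite indicE; case: (_ \in _); rewrite ?normr1 ?normr0.
Qed.

Lemma cboundedS D A f : A `<=` D -> cbounded D f -> cbounded A f.
Proof. by move=> AD [M hM]; exists M => z Az; apply/hM/AD. Qed.

Lemma eq_cbounded D f g : (forall z, D z -> f z = g z) -> cbounded D f -> cbounded D g.
Proof. by move=> fg [M hM]; exists M => z Dz; rewrite -fg//; exact: hM. Qed.

Section FixedMeasure.
Variable mu : {finite_measure set (plane R) -> \bar R}.

Lemma eq_cintegral D f g : (forall z, D z -> f z = g z) ->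
  cintegral mu D f = cintegral mu D g.
Proof.
by move=> fg; rewrite /cintegral; congr (Complex (fine _) (fine _));
  apply: eq_integral => z /set_mem Dz; rewrite fg.
Qed.

Lemma mu_fin D : measurable D -> (mu D < +oo)%E.
Proof. by move=> mD; rewrite ltey_eq fin_num_measure. Qed.

Lemma bounded_cintegrable D f : measurable D -> cmeasurable D f ->
  cbounded D f -> cintegrable mu D f.
Proof.
move=> mD [mr mi] [M hM]; split.
  apply: (@measurable_bounded_integrable _ _ _ mu (fun z => Re (f z))) => //.
    exact: mu_fin.
  exists M; split; first exact: num_real.
  by move=> N MN z Dz /=; apply: le_trans (ltW MN); have [] := hM z Dz.
apply: (@measurable_bounded_integrable _ _ _ mu (fun z => Im (f z))) => //.
  exact: mu_fin.
exists M; split; first exact: num_real.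
by move=> N MN z Dz /=; apply: le_trans (ltW MN); have [] := hM z Dz.
Qed.

Lemma cintegrableD D f g : measurable D -> cintegrable mu D f ->
  cintegrable mu D g -> cintegrable mu D (fun z => f z + g z).
Proof.
move=> mD [fr fi] [gr gi]; split.
  under eq_fun do rewrite ReD EFinD; exact: integrableD.
under eq_fun do rewrite ImD EFinD; exact: integrableD.
Qed.

Lemma cintegrableZ D c f : measurable D -> cintegrable mu D f ->
  cintegrable mu D (fun z => c * f z).
Proof.
move=> mD [fr fi]; split.
  under eq_fun do rewrite ReM EFinB !EFinM; apply: integrableB => //;
    exact: integrableZl.
under eq_fun do rewrite ImM EFinD !EFinM; apply: integrableD => //;
  exact: integrableZl.
Qed.

Lemma cintegrableS D A f : measurable D -> measurable A -> A `<=` D ->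
  cintegrable mu D f -> cintegrable mu A f.
Proof.
by move=> mD mA AD [fr fi]; split; [move: fr|move: fi]; apply: integrableS.
Qed.

Lemma Re_cintegral D f : Re (cintegral mu D f) = Rintegral mu D (fun z => Re (f z)).
Proof. by []. Qed.

Lemma Im_cintegral D f : Im (cintegral mu D f) = Rintegral mu D (fun z => Im (f z)).
Proof. by []. Qed.

Lemma cintegralD D f g : measurable D -> cintegrable mu D f ->
  cintegrable mu D g ->
  cintegral mu D (fun z => f z + g z) = cintegral mu D f + cintegral mu D g.
Proof.
move=> mD [fr fi] [gr gi].
apply: cplx_eq; rewrite !reimE !(Re_cintegral, Im_cintegral) -RintegralD//;
  by apply: eq_Rintegral => z _; rewrite !reimE.
Qed.

Lemma cintegralZ D c f : measurable D -> cintegrable mu D f ->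
  cintegral mu D (fun z => c * f z) = c * cintegral mu D f.
Proof.
move=> mD [fr fi].
have H (a : R) (h : plane R -> R) :
    mu.-integrable D (EFin \o h) -> mu.-integrable D (EFin \o (fun z => a * h z)).
  by move=> hi; exact: (integrableZl mD a hi).
apply: cplx_eq; rewrite !reimE !(Re_cintegral, Im_cintegral) -!RintegralZl//.
  by rewrite -RintegralB//; [|exact: H..]; apply: eq_Rintegral => z _; rewrite !reimE.
by rewrite -RintegralD//; [|exact: H..]; apply: eq_Rintegral => z _; rewrite !reimE.
Qed.

Lemma cintegral_conj D f : measurable D -> cintegrable mu D f ->
  cintegral mu D (fun z => conjc (f z)) = conjc (cintegral mu D f).
Proof.
move=> mD [fr fi]; apply: cplx_eq; rewrite !reimE !(Re_cintegral, Im_cintegral).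
  by apply: eq_Rintegral => z _; rewrite !reimE.
rewrite -mulN1r -RintegralZl//; apply: eq_Rintegral => z _.
by rewrite !reimE mulN1r.
Qed.

Lemma cintegral0 D : cintegral mu D (fun=> 0) = 0.
Proof.
by apply: cplx_eq; rewrite !(Re_cintegral, Im_cintegral) /Rintegral integral0.
Qed.

Lemma cintegrable_sum D (I : Type) (s : seq I) (c : I -> R[i])
    (f : I -> plane R -> R[i]) : measurable D ->
  (forall i, cintegrable mu D (f i)) ->
  cintegrable mu D (fun z => \sum_(i <- s) c i * f i z).
Proof.
move=> mD hf; elim: s => [|i s IH].
  under eq_fun do rewrite big_nil; apply: bounded_cintegrable => //.
  exact: cbounded_cst.
by under eq_fun do rewrite big_cons; apply: cintegrableD => //; apply: cintegrableZ.
Qed.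

Lemma cintegral_sum D (I : Type) (s : seq I) (c : I -> R[i])
    (f : I -> plane R -> R[i]) : measurable D ->
  (forall i, cintegrable mu D (f i)) ->
  cintegral mu D (fun z => \sum_(i <- s) c i * f i z) =
  \sum_(i <- s) c i * cintegral mu D (f i).
Proof.
move=> mD hf; elim: s => [|i s IH].
  by under eq_fun do rewrite big_nil; rewrite cintegral0 big_nil.
under eq_fun do rewrite big_cons.
rewrite cintegralD ?IH ?cintegralZ ?big_cons//; first exact: cintegrableZ.
exact: cintegrable_sum.
Qed.

Lemma cintegral_cindic D A f :
  cintegral mu D (fun z => cindic A z * f z) = cintegral mu (D `&` A) f.
Proof.
have H (h : plane R -> R) :
    Rintegral mu D (fun z => \1_A z * h z) = Rintegral mu (D `&` A) h.
  rewrite Rintegral_mkcondr; apply: eq_Rintegral => z _.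
  by rewrite indicE patchE; case: ifPn => _; rewrite ?mul1r ?mul0r.
by apply: cplx_eq; rewrite !(Re_cintegral, Im_cintegral) -H;
  apply: eq_Rintegral => z _; rewrite !reimE /= mul0r ?subr0 ?addr0.
Qed.

Lemma cintegral_bound D f (e : R) : measurable D -> cmeasurable D f ->
  (forall z, D z -> `|Re (f z)| <= e /\ `|Im (f z)| <= e) ->
  `|Re (cintegral mu D f)| <= e * fine (mu D) /\
  `|Im (cintegral mu D f)| <= e * fine (mu D).
Proof.
move=> mD mf hf; have [fr fi] : cintegrable mu D f.
  by apply: bounded_cintegrable => //; exists e.
have H (h : plane R -> R) : mu.-integrable D (EFin \o h) ->
    (forall z, D z -> `|h z| <= e) -> `|Rintegral mu D h| <= e * fine (mu D).
  move=> hi he; rewrite -Rintegral_cst//; apply: le_trans.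
    exact: le_normr_Rintegral.
  apply: le_Rintegral => //; first exact: integrable_norm.
  exact: finite_measure_integrable_cst.
rewrite Re_cintegral Im_cintegral; split.
  by apply: (H (fun z => Re (f z)) fr) => z Dz; have [] := hf z Dz.
by apply: (H (fun z => Im (f z)) fi) => z Dz; have [] := hf z Dz.
Qed.

Lemma ae_eq_cintegral D N f g : measurable D -> measurable N -> mu N = 0%E ->
  cmeasurable D f -> cmeasurable D g -> (forall z, D z -> ~ N z -> f z = g z) ->
  cintegral mu D f = cintegral mu D g.
Proof.
move=> mD mN N0 [fr fi] [gr gi] fg.
rewrite /cintegral; congr (Complex (fine _) (fine _)); apply: ae_eq_integral => //.
- exact/measurable_EFinP.
- exact/measurable_EFinP.
- exists N; split=> // z /= /not_implyP[Dz h]; apply: contrapT => Nz.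
  by apply: h; rewrite fg.
- exact/measurable_EFinP.
- exact/measurable_EFinP.
- exists N; split=> // z /= /not_implyP[Dz h]; apply: contrapT => Nz.
  by apply: h; rewrite fg.
Qed.

Lemma ae_eq_cintegrable D N f g : measurable D -> measurable N -> mu N = 0%E ->
  cmeasurable D f -> cmeasurable D g -> (forall z, D z -> ~ N z -> f z = g z) ->
  cintegrable mu D f -> cintegrable mu D g.
Proof.
move=> mD mN N0 [fr fi] [gr gi] fg.
have H (u v : plane R -> R) : measurable_fun D u -> measurable_fun D v ->
    (forall z, D z -> ~ N z -> u z = v z) ->
    mu.-integrable D (EFin \o u) -> mu.-integrable D (EFin \o v).
  move=> mu' mv uv /integrableP[_ ui]; apply/integrableP; split.
    exact/measurable_EFinP.
  rewrite (ae_eq_integral (fun z => `|(EFin \o u) z|%E))//.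
  - by apply: measurableT_comp => //; exact/measurable_EFinP.
  - by apply: measurableT_comp => //; exact/measurable_EFinP.
  - exists N; split=> // z /= /not_implyP[Dz h]; apply: contrapT => Nz.
    by apply: h; rewrite uv.
move=> [hr hi]; split.
  by apply: (H _ _ fr gr _ hr) => z Dz Nz; rewrite fg.
by apply: (H _ _ fi gi _ hi) => z Dz Nz; rewrite fg.
Qed.

End FixedMeasure.

Lemma eq_setfun_cintegral (m1 m2 : set (plane R) -> \bar R) D f :
  (forall A, measurable A -> m1 A = m2 A) -> cintegral m1 D f = cintegral m2 D f.
Proof.
by move=> m12; rewrite /cintegral; congr (Complex (fine _) (fine _));
  apply: eq_setfun_integral.
Qed.

Lemma eq_setfun_cintegrable (m1 m2 : set (plane R) -> \bar R) D f :
  (forall A, measurable A -> m1 A = m2 A) ->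
  cintegrable m1 D f <-> cintegrable m2 D f.
Proof.
by move=> m12; rewrite /cintegrable !(eq_setfun_integrable m12).
Qed.

End ComplexIntegral.

(** * Uniform approximation of bounded functions by step functions *)

Section SimpleApproximation.
Context d (T : measurableType d) (R : realType) (D : set T).
Hypothesis mD : measurable D.

(** The sum is e times the minimum of n and the integer part of u / e. Either it is within e of u,
    or all n steps have been climbed. *)
Lemma steps_approx (e u : R) n : 0 < e -> 0 <= u ->
  let s := \sum_(i < n) (if i.+1%:R * e <= u then e else 0) in
  [/\ s <= u, s <= n%:R * e & u < s + e \/ s = n%:R * e].
Proof.
move=> e0 u0; elim: n => [|n [h1 h2 h3]] /=.
  by rewrite big_ord0 mul0r; split=> //; right.
rewrite big_ord_recr /= -natr1; move: h1 h2 h3; set s := \sum_(i < n) _.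
rewrite !mulrDl !mul1r => h1 h2 h3; case: ifPn => h.
  by case: h3 => h3; split; lra.
rewrite addr0; move: h; rewrite -ltNge => h.
by case: h3 => h3; split; (try by lra); left; lra.
Qed.

Lemma real_simple_approx (u : T -> R) (M e : R) : 0 < e ->
  measurable_fun D u -> (forall x, D x -> `|u x| <= M) ->
  exists n, exists A : nat -> set T, exists c : nat -> R,
    (forall i, measurable (A i)) /\
    forall x, D x -> `|u x - \sum_(i < n) c i * \1_(A i) x| <= e.
Proof.
move=> e0 mu uM.
(* After the shift by M the values lie in [0, 2M]; with n e > 2M the steps cannot all be climbed,
   which excludes the second alternative of [steps_approx]. *)
have [n Mn] : exists n : nat, 2 * M < n%:R * e.
  exists (Num.truncn (2 * M / e)).+1.
  by rewrite -ltr_pdivrMr//; exact: truncnS_gt.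
(* The set with index 0 is D itself with coefficient -M and undoes the shift; the others are
   superlevel sets of u + M, each worth one step e. *)
exists n.+1, (fun i => if i is i'.+1 then D `&` [set x | i%:R * e <= u x + M] else D),
  (fun i => if i is i'.+1 then e else - M); split.
  case=> [|i] //.
  have -> : [set x | i.+1%:R * e <= u x + M] =
    (fun x => u x + M) @^-1` `[i.+1%:R * e, +oo[.
    by apply/seteqP; split=> x /=; rewrite in_itv/= andbT.
  by apply: measurable_funD => //; exact: measurable_cst.
move=> x Dx; rewrite big_ord_recl /= indicE mem_set// mulr1.
have /(steps_approx n e0)[] : 0 <= u x + M by have := uM x Dx; rewrite ler_norml; lra.
have -> : \sum_(i < n) (if i.+1%:R * e <= u x + M then e else 0) =
  \sum_(i < n) e * \1_(D `&` [set y | (bump 0 i)%:R * e <= u y + M]) x.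
  apply: eq_bigr => i _; rewrite /bump /= add1n indicE.
  case: ifPn => h; first by rewrite mem_set ?mulr1.
  by rewrite memNset ?mulr0// => -[_ /= h']; rewrite h' in h.
move: (uM x Dx); set s := \sum_(i < n) _; rewrite !ler_norml => /andP[? ?] ? ? [?|?].
  by apply/andP; split; lra.
by apply/andP; split; lra.
Qed.

End SimpleApproximation.

(** * Projection-valued measures *)

Lemma complex_simple_approx d (T : measurableType d) (R : realType) (D : set T)
    (phi : T -> R[i]) (M e : R) : measurable D -> 0 < e -> cmeasurable D phi ->
  (forall x, D x -> `|Re (phi x)| <= M /\ `|Im (phi x)| <= M) ->
  exists n, exists A : nat -> set T, exists c : nat -> R[i],
    (forall i, measurable (A i)) /\ forall x, D x ->
      `|Re (phi x - \sum_(i < n) c i * cindic (A i) x)| <= e /\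
      `|Im (phi x - \sum_(i < n) c i * cindic (A i) x)| <= e.
Proof.
move=> mD e0 [mr mi] hM.
have [n [A [c [mA hA]]]] := real_simple_approx mD e0 mr (fun x Dx => proj1 (hM x Dx)).
have [m [B [b [mB hB]]]] := real_simple_approx mD e0 mi (fun x Dx => proj2 (hM x Dx)).
(* The two real approximations are concatenated: the first n coefficients are real, the last m
   purely imaginary. *)
exists (n + m)%N, (fun i => if (i < n)%N then A i else B (i - n)%N),
  (fun i => if (i < n)%N then (c i)%:C%C else Complex 0 (b (i - n)%N)); split.
  by move=> i; case: ifP.
move=> x Dx; rewrite big_split_ord /=.
have lt_false (i : 'I_m) : (n + i < n)%N = false by rewrite ltnNge leq_addr.
under eq_bigr do rewrite ltn_ord.
under [X in _ - (_ + X)]eq_bigr do rewrite lt_false addKn.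
rewrite !reimE !Re_sum !Im_sum.
have -> : \sum_(i < n) Re ((c i)%:C%C * cindic (A i) x) = \sum_(i < n) c i * \1_(A i) x.
  by apply: eq_bigr => i _; rewrite !reimE /=; ring.
have -> : \sum_(i < m) Re (Complex 0 (b i) * cindic (B i) x) = 0.
  by rewrite big1// => i _; rewrite !reimE /=; ring.
have -> : \sum_(i < n) Im ((c i)%:C%C * cindic (A i) x) = 0.
  by rewrite big1// => i _; rewrite !reimE /=; ring.
have -> : \sum_(i < m) Im (Complex 0 (b i) * cindic (B i) x) = \sum_(i < m) b i * \1_(B i) x.
  by apply: eq_bigr => i _; rewrite !reimE /=; ring.
by rewrite addr0 add0r; split; [exact: hA|exact: hB].
Qed.

Section ProjectionValuedMeasure.
Context {R : realType}.
Variable E : set (plane R) -> (int -> R[i]) -> (int -> R[i]).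
Hypothesis hE : projection_valued_measure E.
Implicit Types (f g : int -> R[i]) (A B : set (plane R)).
Local Notation circle := (unit_circle R).
Local Notation mcircle := (@measurable_unit_circle R).

Lemma dotp_pvm A B f g : measurable A -> measurable B -> l2 f -> l2 g ->
  dotp (E A f) (E B g) = dotp f (E (A `&` B) g).
Proof.
move=> mA mB hf hg.
by rewrite (pvm_selfadjoint hE)// ?(pvm_setI hE)//; exact: (pvm_l2 hE).
Qed.

Lemma pvm_circleI A f : measurable A -> l2 f -> E (circle `&` A) f = E A f.
Proof.
move=> mA hf; rewrite (pvm_setI hE)//; last exact: mcircle.
by rewrite (pvm_circle hE)//; exact: (pvm_l2 hE).
Qed.

Lemma pvm_nrm2 A f : measurable A -> l2 f -> nrm2 (E A f) = Re (dotp f (E A f)).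
Proof. by move=> mA hf; rewrite /nrm2 dotp_pvm// setIid. Qed.

Lemma pvm_ge0 A f : measurable A -> l2 f -> 0 <= Re (dotp f (E A f)).
Proof.
by move=> mA hf; rewrite -pvm_nrm2// nrm2_ge0//; exact: (pvm_l2 hE).
Qed.

Lemma pvm_dotp_real A f : measurable A -> l2 f ->
  dotp f (E A f) = (Re (dotp f (E A f)))%:C%C.
Proof.
move=> mA hf; rewrite -pvm_nrm2//.
by rewrite -dotpff; [rewrite dotp_pvm// setIid|exact: (pvm_l2 hE)].
Qed.

Lemma dotp_sumr (I : Type) (s : seq I) f (h : I -> int -> R[i]) :
  l2 f -> (forall i, l2 (h i)) ->
  dotp f (fun k => \sum_(i <- s) h i k) = \sum_(i <- s) dotp f (h i).
Proof.
move=> hf hh.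
have hs : l2 (fun k => \sum_(i <- s) h i k).
  have := l2_sum s (fun=> 1) hh.
  by under eq_fun do under eq_bigr do rewrite mul1r.
have := dotp_suml s (fun=> 1) hh hf.
have -> : (fun k => \sum_(i <- s) 1 * h i k) = fun k => \sum_(i <- s) h i k.
  by apply/funext => k; apply: eq_bigr => i _; rewrite mul1r.
rewrite dotpC// => /(congr1 (@conjc R)); rewrite conjcK => ->.
by rewrite rmorph_sum; apply: eq_bigr => i _; rewrite conjc1 mul1r (dotpC _ hf).
Qed.

(** The axiom gives convergence of the remainder in norm; here it is turned into convergence of
    matrix elements, the form in which scalar measures are built. *)
Lemma pvm_sigma (F : nat -> set (plane R)) f g : (forall n, measurable (F n)) ->
  trivIset setT F -> l2 f -> l2 g ->
  (fun N => \sum_(n < N) dotp g (E (F n) f)) @ \oo -->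
    (dotp g (E (\bigcup_n F n) f) : R[i]^o).
Proof.
move=> mF tF hf hg; have mU : measurable (\bigcup_n F n) by exact: bigcupT_measurable.
have hEf A : measurable A -> l2 (E A f) by move=> mA; exact: (pvm_l2 hE).
pose r N := fun k => E (\bigcup_n F n) f k - \sum_(n < N) E (F n) f k.
have hs N : l2 (fun k => \sum_(n < N) E (F n) f k).
  have := l2_sum (index_enum 'I_N) (fun=> 1) (fun n : 'I_N => hEf _ (mF n)).
  by under eq_fun do under eq_bigr do rewrite mul1r.
have rE N : r N = fun k => (-1) * (\sum_(n < N) E (F n) f k) + E (\bigcup_n F n) f k.
  by apply/funext => k; rewrite /r; ring.
have hr N : l2 (r N) by rewrite rE; apply: l2_lin => //; exact: hEf.
have r0 : (fun N => nrm2 (r N)) @ \oo --> (0 : R).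
  have := pvm_sigma_additive hE mF tF hf.
  have -> : (fun N => sqnorm (r N)) = EFin \o (fun N => nrm2 (r N)).
    by apply/funext => N; rewrite /= -sqnorm_nrm2.
  by move/fine_cvgP => [_].
have dE N : dotp g (r N) =
    dotp g (E (\bigcup_n F n) f) - \sum_(n < N) dotp g (E (F n) f).
  rewrite rE dotp_linr//; last exact: hEf.
  rewrite (dotp_sumr _ hg (fun n : 'I_N => hEf _ (mF n))).
  by rewrite mulN1r addrC.
have key h : l2 h -> (fun N => Re (dotp h (r N))) @ \oo --> (0 : R).
  move=> hh; apply/cvgrPdist_le => e e0.
  have n0 := nrm2_ge0 hh.
  (* This weight makes the first term of [Re_dotp_le] at most e; the second is at most e once the
     squared norm of the remainder is below t e. *)
  pose t := e / (nrm2 h + 1).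
  have n1 : nrm2 h + 1 != 0 by apply: lt0r_neq0; lra.
  have t0 : 0 < t by rewrite divr_gt0//; lra.
  have th : t * nrm2 h <= e.
    by rewrite /t mulrAC ler_pdivrMr ?ler_pM2l//; lra.
  have te : 0 < t * e by rewrite mulr_gt0.
  near=> N; rewrite sub0r normrN.
  have := Re_dotp_le t0 hh (hr N).
  have : nrm2 (r N) <= t * e.
    have : `|0 - nrm2 (r N)| < t * e.
      by near: N; move/cvgrPdist_lt: r0; apply.
    by rewrite sub0r normrN; have := ler_norm (nrm2 (r N)); lra.
  by rewrite -ler_pdivrMl//; lra.
have c0 : (fun N => dotp g (r N)) @ \oo --> (0 : R[i]^o).
  apply/cvgcP; split; first exact: key.
  have := key _ (l2Z 'i%C hg).
  have H N : Re (dotp (fun k => 'i%C * g k) (r N)) = Im (dotp g (r N)).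
    have := dotp_linl 'i%C (hr N) hg (l2Z 0 hg).
    have -> : (fun k => 'i%C * g k + 0 * g k) = (fun k => 'i%C * g k).
      by apply/funext => k; ring.
    move=> ->; rewrite -[X in _ + X]/(dotp (fun k => 0 * g k) (r N)).
    suff -> : dotp (fun k => 0 * g k) (r N) = 0 by rewrite !reimE /=; ring.
    apply: dotp_near; apply: nearW => n; rewrite /sumZ big1// => j _.
    by rewrite mul0r rmorph0 mul0r.
  under eq_fun do rewrite H.
  by [].
set l := dotp g (E (\bigcup_n F n) f).
have -> : (fun N => \sum_(n < N) dotp g (E (F n) f)) =
    (fun N => l + (-1) * dotp g (r N)).
  by apply/funext => N; rewrite dE /l; ring.
have := cvgcD (cvg_cst (l : R[i]^o)) (cvgcM (c := -1) c0).
by rewrite mulr0 addr0; apply.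
Unshelve. all: by end_near. Qed.

(** Additivity for the constant sequence of empty sets makes n times x converge; consecutive
    differences equal x and tend to 0, so x = 0. *)
Lemma pvm_set0 f : l2 f -> E set0 f = fun=> 0.
Proof.
move=> hf; have h0 : l2 (E set0 f) by exact: (pvm_l2 hE).
apply: nrm2_eq0 => //; rewrite pvm_nrm2//; set x := Re _.
have := pvm_sigma (F := fun=> set0) (fun=> measurable0) _ hf hf.
have tF : trivIset setT (fun _ : nat => set0 : set (plane R)).
  by apply/trivIsetP => i j _ _ _; rewrite set0I.
move=> /(_ tF) /cvgcP[+ _]; rewrite bigcup0// -/x => h.
have h1 := cvg_comp _ _ (cvg_addnr 1) h.
have : (fun n => Re (\sum_(i < n + 1) dotp f (E set0 f)) - 
   Re (\sum_(i < n) dotp f (E set0 f))) @ \oo --> x - x.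
  by apply: cvgB => //.
rewrite subrr.
have -> : (fun n => Re (\sum_(i < n + 1) dotp f (E set0 f)) -
   Re (\sum_(i < n) dotp f (E set0 f))) = fun=> x.
  by apply/funext => n; rewrite addn1 big_ord_recr /= ReD /x; ring.
by move=> /cvg_lim => /(_ _) <- //; rewrite lim_cst.
Qed.

Lemma pvm_sum (I : Type) (s : seq I) (c : I -> R[i]) (h : I -> int -> R[i]) A :
  measurable A -> (forall i, l2 (h i)) ->
  E A (fun k => \sum_(i <- s) c i * h i k) = fun k => \sum_(i <- s) c i * E A (h i) k.
Proof.
move=> mA h2; elim: s => [|i s IH].
  have e0 (g : I -> int -> R[i]) :
      (fun k : int => \sum_(i <- [::]) c i * g i k) = fun=> 0.
    by apply/funext => k; rewrite big_nil.
  have z2 : l2 (fun _ : int => 0 : R[i]) by rewrite -(e0 h); exact: l2_sum.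
  have := pvm_linear hE (-1) mA z2 z2; rewrite !e0.
  have -> : (fun _ : int => -1 * 0 + 0 : R[i]) = fun=> 0.
    by apply/funext => k; ring.
  by move=> ->; apply/funext => k; ring.
under eq_fun do rewrite big_cons.
rewrite (pvm_linear hE (c i) mA (h2 i) (l2_sum s c h2)) IH.
by apply/funext => k; rewrite big_cons.
Qed.

Lemma ex_pvm_measure f : l2 f ->
  exists mu : {finite_measure set (plane R) -> \bar R},
    forall A, measurable A -> mu A = (Re (dotp f (E A f)))%:E.
Proof.
move=> hf; apply: (@ex_finite_measure _ _ _ (fun A => Re (dotp f (E A f)))).
- rewrite pvm_set0//.
  by rewrite (@dotp_near _ _ _ 0)//; apply: nearW => n; rewrite /sumZ big1// => j _;
    rewrite mulr0.
- by move=> A mA; exact: pvm_ge0.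
- move=> F mF tF; have /cvgcP[+ _] := pvm_sigma mF tF hf hf.
  by under eq_fun do rewrite Re_sum.
Qed.

End ProjectionValuedMeasure.

(** * Operators given by bounded functions on the circle *)

Section Multiplier.
Context {R : realType}.
Variable E : set (plane R) -> (int -> R[i]) -> (int -> R[i]).
Hypothesis hE : projection_valued_measure E.
Implicit Types (f g : int -> R[i]) (A B : set (plane R)).
Local Notation circle := (unit_circle R).
Local Notation mcircle := (@measurable_unit_circle R).

(* T is the integral of phi against E, in the weak sense. *)
Definition multiplier (T : (int -> R[i]) -> (int -> R[i])) (phi : plane R -> R[i]) :=
  [/\ forall f, l2 f -> l2 (T f),
      forall c f g, l2 f -> l2 g ->
        T (fun k => c * f k + g k) = fun k => c * T f k + T g k,
      cmeasurable circle phi, cbounded circle phi &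
      forall f, l2 f -> dotp f (T f) =
        cintegral (fun A => (Re (dotp f (E A f)))%:E) circle phi].

(** Expanding the form at f + g controls the sum of (f, X g) and (g, X f), and expanding at i f + g
    controls their difference; half the total is (f, X g). The constant 3 is 2 from [nrm2D] at the
    combined vector plus 1 from the diagonal terms that are subtracted. *)
Lemma polarization_bound (X : (int -> R[i]) -> (int -> R[i])) (e : R) :
  0 <= e -> (forall f, l2 f -> l2 (X f)) ->
  (forall c f g, l2 f -> l2 g ->
     X (fun k => c * f k + g k) = fun k => c * X f k + X g k) ->
  (forall f, l2 f -> `|Re (dotp f (X f))| <= e * nrm2 f /\
                     `|Im (dotp f (X f))| <= e * nrm2 f) ->
  forall f g, l2 f -> l2 g ->
    `|Re (dotp f (X g))| <= 3 * e * (nrm2 f + nrm2 g) /\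
    `|Im (dotp f (X g))| <= 3 * e * (nrm2 f + nrm2 g).
Proof.
move=> e0 X2 Xlin Xe f g hf hg.
have pol c : dotp (fun k => c * f k + g k) (X (fun k => c * f k + g k)) =
    conjc c * c * dotp f (X f) + conjc c * dotp f (X g) + c * dotp g (X f)
    + dotp g (X g).
  have hF := l2_lin c hf hg.
  rewrite Xlin// (dotp_linr c hF (X2 _ hf) (X2 _ hg)).
  rewrite (dotp_linl c (X2 _ hf) hf hg) (dotp_linl c (X2 _ hg) hf hg); ring.
have n2 c : normc2 c = 1 -> nrm2 (fun k => c * f k + g k) <= 2 * (nrm2 f + nrm2 g).
  move=> c1; have := nrm2D (l2Z c hf) hg.
  have -> : nrm2 (fun k => c * f k) = nrm2 f.
    have -> : (fun k => c * f k) = (fun k => c * f k + 0 * f k).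
      by apply/funext => k; ring.
    rewrite (nrm2_lin c hf (l2Z 0 hf)).
    have -> : dotp f (fun k => 0 * f k) = 0.
      by apply: dotp_near; apply: nearW => n; rewrite /sumZ big1// => j _; ring.
    have -> : nrm2 (fun k => 0 * f k) = 0.
      rewrite /nrm2 (@dotp_near _ _ _ 0)//; apply: nearW => n.
      by rewrite /sumZ big1// => j _; ring.
    by rewrite c1 mulr0 Re0; ring.
  lra.
have [fr fi] := Xe f hf; have [gr gi] := Xe g hg.
have [ar ai] := Xe _ (l2_lin 1 hf hg); have [br bi] := Xe _ (l2_lin 'i%C hf hg).
have c1 : normc2 (1 : R[i]) = 1 by rewrite /normc2 !reimE; ring.
have ci : normc2 ('i%C : R[i]) = 1 by rewrite /normc2 /=; ring.
have na := ler_wpM2l e0 (n2 _ c1); have nb := ler_wpM2l e0 (n2 _ ci).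
move: fr fi gr gi ar ai br bi na nb; rewrite !pol.
move: (dotp f (X f)) (dotp f (X g)) (dotp g (X f)) (dotp g (X g)) => x y z w.
move: (nrm2 f) (nrm2 g) => p q; move: (nrm2 _) => r; move: (nrm2 _) => s.
move: x y z w => [x1 x2] [y1 y2] [z1 z2] [w1 w2]; rewrite !reimE /=.
move=> fr fi gr gi ar ai br bi na nb.
have na' : e * r <= 2 * (e * p + e * q) by rewrite -mulrDr mulrCA.
have nb' : e * s <= 2 * (e * p + e * q) by rewrite -mulrDr mulrCA.
have -> : 3 * e * (p + q) = 3 * (e * p + e * q) by ring.
move: fr fi gr gi ar ai br bi na' nb'; clear.
move: (e * p) (e * q) (e * r) (e * s) => P Q S U.
rewrite !ler_norml => /andP[? ?] /andP[? ?] /andP[? ?] /andP[? ?] /andP[? ?].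
move=> /andP[? ?] /andP[? ?] /andP[? ?] ? ?.
by split; apply/andP; split; lra.
Qed.

(** On the diagonal, T minus the step operator has as its form the integral of a function bounded by
    e against a measure of total mass [nrm2 f]. Polarization carries the bound to mixed products. *)
Lemma multiplier_approx T phi (e : R) : multiplier T phi -> 0 < e ->
  exists n, exists A : nat -> set (plane R), exists c : nat -> R[i],
  [/\ forall i, measurable (A i),
   forall z, circle z ->
      `|Re (phi z - \sum_(i < n) c i * cindic (A i) z)| <= e /\
      `|Im (phi z - \sum_(i < n) c i * cindic (A i) z)| <= e &
   forall f g, l2 f -> l2 g ->
      `|Re (dotp f (T g) - \sum_(i < n) c i * dotp f (E (A i) g))| <=
         3 * e * (nrm2 f + nrm2 g) /\
      `|Im (dotp f (T g) - \sum_(i < n) c i * dotp f (E (A i) g))| <=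
         3 * e * (nrm2 f + nrm2 g)].
Proof.
move=> [T2 Tlin mphi [M bphi] Tphi] e0.
have [n [A [c [mA hA]]]] := complex_simple_approx mcircle e0 mphi bphi.
exists n, A, c; split=> //.
have hEA i f : l2 f -> l2 (E (A i) f) by move=> hf; exact: (pvm_l2 hE).
pose S f := fun k => \sum_(i < n) (- c i) * E (A i) f k.
have S2 f : l2 f -> l2 (S f) by move=> hf; apply: l2_sum => i; exact: hEA.
pose X f := fun k => T f k + S f k.
have dX f g : l2 f -> l2 g ->
    dotp f (X g) = dotp f (T g) - \sum_(i < n) c i * dotp f (E (A i) g).
  move=> hf hg; rewrite /X.
  have -> : (fun k => T g k + S g k) = (fun k => 1 * T g k + S g k).
    by apply/funext => k; rewrite mul1r.
  rewrite (dotp_linr 1 hf (T2 _ hg) (S2 _ hg)) mul1r; congr (_ + _).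
  rewrite (dotpC (S2 _ hg) hf) /S.
  rewrite (dotp_suml _ (fun i : 'I_n => - c i) (fun i => hEA (nat_of_ord i) _ hg) hf).
  rewrite rmorph_sum -sumrN; apply: eq_bigr => i _ /=.
  rewrite rmorphM /= conjcK -dotpC//; last exact: hEA.
  by rewrite mulNr.
have X2 f : l2 f -> l2 (X f) by move=> hf; apply: l2D; [exact: T2|exact: S2].
have Xlin b f g : l2 f -> l2 g ->
    X (fun k => b * f k + g k) = fun k => b * X f k + X g k.
  move=> hf hg; apply/funext => k; rewrite /X /S Tlin//.
  have -> : \sum_(i < n) - c i * E (A i) (fun k => b * f k + g k) k =
     b * (\sum_(i < n) - c i * E (A i) f k) + \sum_(i < n) - c i * E (A i) g k.
    rewrite mulr_sumr -big_split /=; apply: eq_bigr => i _.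
    by rewrite (pvm_linear hE)//; ring.
  by ring.
move=> f g hf hg; rewrite -dX//; apply: polarization_bound => //; first exact: ltW.
move=> {hg}h hh; rewrite dX// Tphi//.
have [mu muE] := ex_pvm_measure hE hh.
have -> : cintegral (fun A => (Re (dotp h (E A h)))%:E) circle phi =
  cintegral mu circle phi by apply: eq_setfun_cintegral => B mB; rewrite muE.
have hi i : dotp h (E (A i) h) = cintegral mu circle (cindic (A i)).
  have -> : cintegral mu circle (cindic (A i)) =
      cintegral mu circle (fun z => cindic (A i) z * 1).
    by apply: eq_cintegral => z _; rewrite mulr1.
  rewrite cintegral_cindic pvm_dotp_real//.
  rewrite -(pvm_circleI hE (mA i) hh).
  apply: cplx_eq; rewrite !(Re_cintegral, Im_cintegral) Rintegral_cst//=;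
    try exact: measurableI mcircle _.
  - by rewrite mul1r muE//; exact: measurableI mcircle _.
  - by rewrite mul0r.
have mc i : cmeasurable circle (cindic (A i)) by exact: cmeasurable_cindic.
have ic i : cintegrable mu circle (cindic (A i)).
  by apply: bounded_cintegrable => //; [exact: mcircle|exact: cbounded_cindic].
have iphi : cintegrable mu circle phi.
  by apply: bounded_cintegrable => //; [exact: mcircle|exists M].
have -> : cintegral mu circle phi - \sum_(i < n) c i * dotp h (E (A i) h) =
    cintegral mu circle (fun z => phi z + (-1) * \sum_(i < n) c i * cindic (A i) z).
  under eq_bigr do rewrite hi.
  have isum := cintegrable_sum (index_enum 'I_n) (fun i : 'I_n => c i) mcircle
    (fun i : 'I_n => ic i).
  rewrite cintegralD ?cintegralZ ?cintegral_sum//; try exact: mcircle.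
    by rewrite mulN1r.
  by apply: cintegrableZ => //; exact: mcircle.
have mf : cmeasurable circle
    (fun z => phi z + (-1) * \sum_(i < n) c i * cindic (A i) z).
  apply: cmeasurableD => //; apply: cmeasurableM; first exact: cmeasurable_cst.
  by apply: cmeasurable_sum => i; apply: cmeasurableM => //; exact: cmeasurable_cst.
have := cintegral_bound mu (e := e) mcircle mf.
rewrite (muE _ mcircle) (pvm_circle hE)//; apply=> z cz.
by rewrite mulN1r; exact: hA.
Qed.

End Multiplier.

(** * The spectral representation *)

Section Forms.
Context {R : realType}.
Implicit Types (F G H : plane R -> 'cV[R[i]]_2) (w : plane R -> 'M[R[i]]_2).
Local Notation circle := (unit_circle R).
Local Notation mcircle := (@measurable_unit_circle R).

Definition mform w F G : plane R -> R[i] :=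
  fun z => ((map_mx (@conjc R) (F z))^T *m w z *m G z) 0 0.

Lemma mformE w F G z :
  mform w F G z = \sum_(l < 2) \sum_(l' < 2) conjc (F z l 0) * w z l l' * G z l' 0.
Proof.
rewrite /mform mxE exchange_big /=; apply: eq_bigr => l' _.
by rewrite mxE mulr_suml; apply: eq_bigr => l _; rewrite !mxE.
Qed.

Lemma mform_linr w F G H c z :
  mform w F (fun z => c z *: G z + H z) z = c z * mform w F G z + mform w F H z.
Proof.
rewrite !mformE mulr_sumr -big_split /=; apply: eq_bigr => l _.
by rewrite mulr_sumr -big_split /=; apply: eq_bigr => l' _; rewrite !mxE; ring.
Qed.

Lemma mformZr w F G c z : mform w F (fun z => c z *: G z) z = c z * mform w F G z.
Proof.
rewrite !mformE mulr_sumr /=; apply: eq_bigr => l _.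
by rewrite mulr_sumr /=; apply: eq_bigr => l' _; rewrite !mxE; ring.
Qed.

(** Bounded measurable entries: against a bounded density and a finite measure all forms of such
    functions are integrable. *)
Definition vgood F :=
  forall l : 'I_2, cmeasurable circle (fun z => F z l 0) /\
                   cbounded circle (fun z => F z l 0).

Lemma vgood_lin (c : plane R -> R[i]) F G : cmeasurable circle c ->
  cbounded circle c -> vgood F -> vgood G -> vgood (fun z => c z *: F z + G z).
Proof.
move=> mc bc hF hG l; have [mF bF] := hF l; have [mG bG] := hG l.
have -> : (fun z => (c z *: F z + G z) l 0) = (fun z => c z * F z l 0 + G z l 0).
  by apply/funext => z; rewrite !mxE.
by split; [apply: cmeasurableD => //; exact: cmeasurableM
          |apply: cboundedD => //; exact: cboundedM].
Qed.

Lemma vgoodZ (c : plane R -> R[i]) F : cmeasurable circle c ->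
  cbounded circle c -> vgood F -> vgood (fun z => c z *: F z).
Proof.
move=> mc bc hF l; have [mF bF] := hF l.
have -> : (fun z => (c z *: F z) l 0) = (fun z => c z * F z l 0).
  by apply/funext => z; rewrite !mxE.
by split; [exact: cmeasurableM|exact: cboundedM].
Qed.

Lemma eq_vgood F G : (forall z, circle z -> F z = G z) -> vgood F -> vgood G.
Proof.
move=> FG hF l; have [mF bF] := hF l; split.
  by apply: eq_cmeasurable mF => z /set_mem cz; rewrite FG.
by apply: eq_cbounded bF => z cz; rewrite FG.
Qed.

Lemma vgood_cst (v : 'cV[R[i]]_2) : vgood (fun=> v).
Proof. by move=> l; split; [exact: cmeasurable_cst|exact: cbounded_cst]. Qed.

Lemma cmeasurable_mform w F G :
  (forall l l', cmeasurable circle (fun z => w z l l')) ->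
  (forall l, cmeasurable circle (fun z => F z l 0)) ->
  (forall l, cmeasurable circle (fun z => G z l 0)) ->
  cmeasurable circle (mform w F G).
Proof.
move=> mw hF hG; rewrite (_ : mform w F G = fun z =>
    \sum_(l < 2) \sum_(l' < 2) conjc (F z l 0) * w z l l' * G z l' 0); last first.
  by apply/funext => z; rewrite mformE.
apply: cmeasurable_sum => l; apply: cmeasurable_sum => l'.
by apply: cmeasurableM => //; apply: cmeasurableM => //; exact: cmeasurable_conj.
Qed.

Lemma cbounded_mform w F G :
  (forall l l', cbounded circle (fun z => w z l l')) ->
  (forall l, cbounded circle (fun z => F z l 0)) ->
  (forall l, cbounded circle (fun z => G z l 0)) ->
  cbounded circle (mform w F G).
Proof.
move=> mw hF hG; rewrite (_ : mform w F G = fun z =>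
    \sum_(l < 2) \sum_(l' < 2) conjc (F z l 0) * w z l l' * G z l' 0); last first.
  by apply/funext => z; rewrite mformE.
apply: cbounded_sum => l; apply: cbounded_sum => l'.
by apply: cboundedM => //; apply: cboundedM => //; exact: cbounded_conj.
Qed.

End Forms.

Section Representation.
Context {R : realType}.
Variable E : set (plane R) -> (int -> R[i]) -> (int -> R[i]).
Hypothesis hE : projection_valued_measure E.
Variable d : 'I_2 -> int -> R[i].
Hypothesis d_l2 : forall l, l2 (d l).
Local Notation circle := (unit_circle R).
Local Notation mcircle := (@measurable_unit_circle R).

(* The graph of the spectral representation F |-> F_0(U) d_0 + F_1(U) d_1,
   generated from below: rep f F means that f is represented by F. *)
Inductive rep : (int -> R[i]) -> (plane R -> 'cV[R[i]]_2) -> Prop :=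
| rep_base l : rep (d l) (fun=> delta_mx l 0)
| rep_lin c f F g G : rep f F -> rep g G ->
    rep (fun k => c * f k + g k) (fun z => c *: F z + G z)
| rep_E A f F : measurable A -> rep f F ->
    rep (E A f) (fun z => cindic A z *: F z)
| rep_multiplier T phi f F : multiplier E T phi -> rep f F ->
    rep (T f) (fun z => phi z *: F z)
| rep_ext f F G : rep f F -> (forall z, circle z -> F z = G z) -> rep f G.

Lemma rep_good f F : rep f F -> l2 f /\ vgood F.
Proof.
elim=> {f F} [l|c f F g G _ [f2 hF] _ [g2 hG]|A f F mA _ [f2 hF]|
  T phi f F [T2 _ mphi bphi _] _ [f2 hF]|f F G _ [f2 hF] FG].
- by split=> //; exact: vgood_cst.
- split; first exact: l2_lin.
  by apply: vgood_lin => //; exact: cbounded_cst.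
- split; first exact: (pvm_l2 hE).
  by apply: vgoodZ => //; [exact: cmeasurable_cindic|exact: cbounded_cindic].
- by split; [exact: T2|exact: vgoodZ].
- by split=> //; exact: eq_vgood FG hF.
Qed.

Variable mu : {finite_measure set (plane R) -> \bar R}.
Variable w : plane R -> 'M[R[i]]_2.
Hypothesis w_meas : forall l l', cmeasurable circle (fun z => w z l l').
Hypothesis w_bnd : forall l l', cbounded circle (fun z => w z l l').
Hypothesis w_herm : forall z l l', circle z -> w z l' l = conjc (w z l l').
Hypothesis w_dens : forall A l l', measurable A ->
  dotp (d l) (E A (d l')) = cintegral mu (circle `&` A) (fun z => w z l l').

(** The isometry is stated with every measurable A rather than for the whole circle alone, which is
    what lets an induction pass through [rep_E] and [rep_multiplier]. *)
Definition rel f F g G := forall A, measurable A ->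
  dotp f (E A g) = cintegral mu (circle `&` A) (mform w F G).

Lemma mform_integrable F G A : vgood F -> vgood G -> measurable A ->
  cintegrable mu (circle `&` A) (mform w F G).
Proof.
move=> hF hG mA; apply: (@cintegrableS _ _ circle) => //.
- exact: mcircle.
- exact: measurableI mcircle mA.
- apply: bounded_cintegrable; first exact: mcircle.
    by apply: cmeasurable_mform => // l; [have [] := hF l|have [] := hG l].
  by apply: cbounded_mform => // l; [have [] := hF l|have [] := hG l].
Qed.

Lemma rel_sym f F g G : l2 f -> l2 g -> vgood F -> vgood G ->
  rel f F g G -> rel g G f F.
Proof.
move=> f2 g2 hF hG fg A mA.
rewrite -(pvm_selfadjoint hE)// dotpC//; last exact: (pvm_l2 hE).
rewrite fg// -cintegral_conj//; [|exact: measurableI mcircle mA|exact: mform_integrable].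
apply: eq_cintegral => z [cz _]; rewrite !mformE exchange_big rmorph_sum /=.
apply: eq_bigr => l _; rewrite rmorph_sum; apply: eq_bigr => l' _.
by rewrite /= !rmorphM /= conjcK -w_herm//; ring.
Qed.

(** For a step function in place of phi the identity is additivity over sets. Both sides then differ
    from their step versions by at most a fixed multiple of the precision e. *)
Lemma rel_multiplier f F g G T phi : multiplier E T phi -> l2 f -> l2 g ->
  vgood F -> vgood G -> rel f F g G -> rel f F (T g) (fun z => phi z *: G z).
Proof.
move=> hT f2 g2 hF hG fg B mB; have [T2 _ mphi bphi _] := hT.
have EB2 : l2 (E B f) by exact: (pvm_l2 hE).
have mcB : measurable (circle `&` B) by exact: measurableI mcircle mB.
rewrite -(pvm_selfadjoint hE)//; last exact: T2.
have mh : cmeasurable circle (mform w F G).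
  by apply: cmeasurable_mform => // l; [have [] := hF l|have [] := hG l].
have bh : cbounded circle (mform w F G).
  by apply: cbounded_mform => // l; [have [] := hF l|have [] := hG l].
have [M hM] := bh.
set I := cintegral _ _ _.
(* The first summand is the bound of [multiplier_approx] per unit of e. The second bounds the
   integral of the error times the form; M occurs twice because each part of a complex product has
   two terms. *)
pose K := 3 * (nrm2 (E B f) + nrm2 g) + (M + M) * fine (mu (circle `&` B)).
have K0 : 0 <= K.
  have M0 : 0 <= M.
    have c1 : circle (1 : R[i]) by rewrite /unit_circle /= normr1.
    by have [+ _] := hM _ c1; apply: le_trans.
  rewrite addr_ge0//.
    by rewrite mulr_ge0// addr_ge0// nrm2_ge0.
  by rewrite mulr_ge0 ?fine_ge0// addr_ge0.
have key e : 0 < e -> `|Re (dotp (E B f) (T g) - I)| <= K * e /\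
                      `|Im (dotp (E B f) (T g) - I)| <= K * e.
  move=> e0; have [n [A [c [mA hA hd]]]] := multiplier_approx hE hT e0.
  have [h1 h2] := hd _ _ EB2 g2.
  have mS : cmeasurable circle (fun z => \sum_(i < n) c i * cindic (A i) z).
    by apply: cmeasurable_sum => i; apply: cmeasurableM;
      [exact: cmeasurable_cst|exact: cmeasurable_cindic].
  have bS : cbounded circle (fun z => \sum_(i < n) c i * cindic (A i) z).
    by apply: cbounded_sum => i; apply: cboundedM;
      [exact: cbounded_cst|exact: cbounded_cindic].
  have sE : \sum_(i < n) c i * dotp (E B f) (E (A i) g) =
      cintegral mu (circle `&` B)
        (fun z => \sum_(i < n) c i * (cindic (A i) z * mform w F G z)).
    rewrite cintegral_sum//; last first.
      move=> i; apply: bounded_cintegrable => //.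
        apply: (@cmeasurableS _ _ _ circle) => //; first exact: mcircle.
        by apply: cmeasurableM => //; exact: cmeasurable_cindic.
      apply: (@cboundedS _ circle) => //.
      by apply: cboundedM => //; exact: cbounded_cindic.
    apply: eq_bigr => i _; rewrite cintegral_cindic dotp_pvm//.
    by rewrite fg; [rewrite setIA|exact: measurableI].
  have mD : cmeasurable circle
      (fun z => phi z - \sum_(i < n) c i * cindic (A i) z).
    under eq_fun do rewrite -mulN1r.
    by apply: cmeasurableD => //; apply: cmeasurableM => //; exact: cmeasurable_cst.
  have IE : I - \sum_(i < n) c i * dotp (E B f) (E (A i) g) =
      cintegral mu (circle `&` B)
      (fun z => (phi z - \sum_(i < n) c i * cindic (A i) z) * mform w F G z).
    have bphiG : vgood (fun z => phi z *: G z) by exact: vgoodZ.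
    rewrite sE -mulN1r -cintegralZ//; last first.
      apply: bounded_cintegrable => //.
        apply: (@cmeasurableS _ _ _ circle) => //; first exact: mcircle.
        under eq_fun do under eq_bigr do rewrite mulrA.
        by under eq_fun do rewrite -mulr_suml; exact: cmeasurableM.
      apply: (@cboundedS _ circle) => //.
      under eq_fun do under eq_bigr do rewrite mulrA.
      by under eq_fun do rewrite -mulr_suml; exact: cboundedM.
    rewrite -cintegralD//.
    - apply: eq_cintegral => z _; rewrite mformZr mulrBl mulN1r; congr (_ - _).
      by rewrite mulr_suml; apply: eq_bigr => i _; rewrite mulrA.
    - exact: mform_integrable.
    - apply: cintegrableZ => //; apply: bounded_cintegrable => //.
        apply: (@cmeasurableS _ _ _ circle) => //; first exact: mcircle.
        under eq_fun do under eq_bigr do rewrite mulrA.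
        by under eq_fun do rewrite -mulr_suml; exact: cmeasurableM.
      apply: (@cboundedS _ circle) => //.
      under eq_fun do under eq_bigr do rewrite mulrA.
      by under eq_fun do rewrite -mulr_suml; exact: cboundedM.
  have := cintegral_bound mu (e := (M + M) * e) mcB
    (cmeasurableS mcircle (@subIsetl _ _ _) (cmeasurableM mD mh)).
  rewrite -IE; set S := \sum_(i < n) _ in h1 h2 *.
  case=> [z [cz _]|r1 r2].
    have [a1 a2] := hA z cz; have [b1 b2] := hM z cz.
    rewrite (ReM (phi z - _)) (ImM (phi z - _)) mulrDl (mulrC M e); split.
      by rewrite (le_trans (ler_normB _ _))// !normrM lerD// ler_pM.
    by rewrite (le_trans (ler_normD _ _))// !normrM lerD// ler_pM.
  have KE : K * e = 3 * e * (nrm2 (E B f) + nrm2 g) +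
      (M + M) * e * fine (mu (circle `&` B)) by rewrite /K; ring.
  have -> : dotp (E B f) (T g) - I = (dotp (E B f) (T g) - S) - (I - S) by ring.
  rewrite KE (ReD _ (- (I - S))) (ImD _ (- (I - S))) ReN ImN.
  by split; rewrite (le_trans (ler_normB _ _))// lerD.
have lim0 (x : R) : (forall e, 0 < e -> `|x| <= K * e) -> x = 0.
  move=> hx; apply/eqP; rewrite -normr_le0; apply/ler_addgt0Pr => e e0.
  have K1 : 0 < K + 1 by lra.
  have := hx (e / (K + 1)) (divr_gt0 e0 K1); rewrite add0r => h; apply: le_trans h _.
  by rewrite mulrCA ler_piMr ?(ltW e0)// ler_pdivrMr//; lra.
apply/eqP; rewrite -subr_eq0; apply/eqP; apply: cplx_eq.
  by apply: lim0 => e /key[].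
by apply: lim0 => e /key[].
Qed.

(** Induction on the second argument only, from its values on the two generators. Using it once with
    a generator as f, flipping by [rel_sym], and using it again replaces a double induction. *)
Lemma rel_rep f F g G : l2 f -> vgood F ->
  (forall l, rel f F (d l) (fun=> delta_mx l 0)) -> rep g G -> rel f F g G.
Proof.
move=> f2 hF base.
elim=> {g G} [//|c g G h H rG hg rH hh|A g G mA rG hg|
  T phi g G hT rG hg|g G H rG hg GH] B mB.
- have [[g2 gG] [h2 gH]] := (rep_good rG, rep_good rH).
  have mcB : measurable (circle `&` B) by exact: measurableI mcircle mB.
  rewrite (pvm_linear hE)// dotp_linr//; [|exact: (pvm_l2 hE)..].
  rewrite hg// hh// -cintegralZ//; last exact: mform_integrable.
  rewrite -cintegralD//; [|apply: cintegrableZ => //|]; [|exact: mform_integrable..].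
  by apply: eq_cintegral => z _; rewrite (mform_linr _ _ _ _ (fun=> c)).
- have [g2 gG] := rep_good rG.
  rewrite -(pvm_setI hE)// hg; last exact: measurableI.
  rewrite setIA -cintegral_cindic; apply: eq_cintegral => z _.
  by rewrite mformZr.
- have [g2 gG] := rep_good rG.
  exact: rel_multiplier.
- rewrite hg//; apply: eq_cintegral => z [cz _].
  by rewrite !mformE; apply: eq_bigr => l _; apply: eq_bigr => l' _; rewrite GH.
Qed.

Lemma mform_delta l l' z :
  mform w (fun=> delta_mx l 0) (fun=> delta_mx l' 0) z = w z l l'.
Proof.
have e1 i : (delta_mx i 0 : 'cV[R[i]]_2) i 0 = 1 by rewrite mxE !eqxx.
have e0 i j : j != i -> (delta_mx i 0 : 'cV[R[i]]_2) j 0 = 0.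
  by move=> ij; rewrite mxE (negbTE ij).
rewrite mformE (bigD1 l)//= (bigD1 l')//= !big1 => [|i il|j jl].
- by rewrite !e1 conjc1 !addr0 mul1r mulr1.
- by rewrite big1// => j _; rewrite e0// conjc0 !mul0r.
- by rewrite (e0 l')// mulr0.
Qed.

Lemma rep_rel f F g G : rep f F -> rep g G -> rel f F g G.
Proof.
move=> rF rG; have [[f2 hF] [g2 hG]] := (rep_good rF, rep_good rG).
have bl l l' : rel (d l) (fun=> delta_mx l 0) (d l') (fun=> delta_mx l' 0).
  by move=> A mA; rewrite w_dens//; apply: eq_cintegral => z _; rewrite mform_delta.
apply: rel_rep => // l; apply: rel_sym => //; first exact: vgood_cst.
by apply: rel_rep => //; exact: vgood_cst.
Qed.

End Representation.

(** * The density of the matrix measure *)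

Lemma sum_ord2 (V : zmodType) (F : 'I_2 -> V) : \sum_(l < 2) F l = F 0 + F 1.
Proof. by rewrite big_ord_recl big_ord1; congr (_ + F _); apply: val_inj. Qed.

(** Continuity with explicit constants: if the value at x is -D < 0, then K bounds the slope of
    chords from x of length at most 1, and a rational within D / (K + D) to the right of x still
    gives a negative value. *)
Lemma quadratic_ge0_rat (R : realType) (a b c : R) :
  (forall q : rat, 0 <= a * ratr q ^+ 2 + b * ratr q + c) ->
  forall x, 0 <= a * x ^+ 2 + b * x + c.
Proof.
move=> h x; rewrite leNgt; apply/negP => px.
pose D := - (a * x ^+ 2 + b * x + c).
pose K := `|a| * (2 * `|x| + 1) + `|b| + 1.
have D0 : 0 < D by rewrite oppr_gt0.
have K0 : 0 < K.
  by rewrite ltr_wpDl// addr_ge0// mulr_ge0// addr_ge0// mulr_ge0.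
have KD : 0 < K + D by rewrite addr_gt0.
have e0 : 0 < D / (K + D) by rewrite divr_gt0.
have [q] := @rat_in_itvoo R x (x + D / (K + D)) (ltr_pwDr e0 (lexx x)).
rewrite in_itv/= => /andP[xq qx]; have := h q; move: (ratr q : R) xq qx => y xy yx.
rewrite leNgt => /negP; apply.
have e1 : D / (K + D) <= 1 by rewrite ler_pdivrMr//; lra.
have eK : (D / (K + D)) * K < D.
  have DD := mulr_gt0 D0 D0.
  by rewrite mulrAC ltr_pdivrMr//; move: D K DD {D0 K0 KD e0 yx e1} => D K; lra.
have -> : a * y ^+ 2 + b * y + c = (y - x) * (a * (y + x) + b) - D.
  by rewrite /D; ring.
rewrite subr_lt0; apply: le_lt_trans eK.
have yx0 : 0 <= y - x by lra.
apply: (@le_trans _ _ ((y - x) * K)); last by rewrite ler_wpM2r; lra.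
apply: ler_wpM2l => //; apply: le_trans (ler_norm _) _.
apply: (le_trans (ler_normD _ _)); rewrite /K normrM.
have yx1 : `|y + x| <= 2 * `|x| + 1.
  have -> : y + x = 2 * x + (y - x) by ring.
  rewrite (le_trans (ler_normD _ _))// normrM (ger0_norm yx0) ger0_norm//; lra.
have := ler_wpM2l (normr_ge0 a) yx1; lra.
Qed.

(** * Positive semidefinite matrices of order two *)

Section PositiveMatrices.
Context {R : realType}.
Implicit Types (W : 'M[R[i]]_2) (v : 'cV[R[i]]_2).

Definition qform W v : R[i] :=
  \sum_(l < 2) \sum_(l' < 2) conjc (v l 0) * W l l' * v l' 0.

(** In the order of [R[i]] the inequality also says that the form is real, so a matrix with this
    property is Hermitian. *)
Definition psd W := forall v, 0 <= qform W v.

Definition cvec (x y s t : R) : 'cV[R[i]]_2 := cv2 (Complex x y) (Complex s t).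

Lemma cvec_eta v : exists x y s t, v = cvec x y s t.
Proof.
exists (Re (v 0 0)), (Im (v 0 0)), (Re (v 1 0)), (Im (v 1 0)).
apply/colP => i; rewrite !mxE; have [->|i0] := eqVneq i 0; first exact: cplx_eq.
have -> : i = 1 by apply: val_inj; case: i i0 => [[|[|]]].
exact: cplx_eq.
Qed.

Lemma forall_ord2 (P : 'I_2 -> Prop) : P 0 -> P 1 -> forall l, P l.
Proof.
move=> P0 P1 l; have [->//|l0] := eqVneq l 0.
by have -> : l = 1 by apply: val_inj; case: l l0 => [[|[|]]].
Qed.

Lemma Re_qform W x y s t : Re (qform W (cvec x y s t)) =
  Re (W 0 0) * (x ^+ 2 + y ^+ 2) + Re (W 1 1) * (s ^+ 2 + t ^+ 2)
  + (Re (W 0 1) + Re (W 1 0)) * (x * s + y * t)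
  + (Im (W 1 0) - Im (W 0 1)) * (x * t - y * s).
Proof.
rewrite /qform !sum_ord2 !mxE /=.
move: (W 0 0) (W 0 1) (W 1 0) (W 1 1) => [a1 a2] [b1 b2] [c1 c2] [e1 e2] /=.
by ring.
Qed.

Lemma Im_qform W x y s t : Im (qform W (cvec x y s t)) =
  Im (W 0 0) * (x ^+ 2 + y ^+ 2) + Im (W 1 1) * (s ^+ 2 + t ^+ 2)
  + (Im (W 0 1) + Im (W 1 0)) * (x * s + y * t)
  + (Re (W 0 1) - Re (W 1 0)) * (x * t - y * s).
Proof.
rewrite /qform !sum_ord2 !mxE /=.
move: (W 0 0) (W 0 1) (W 1 0) (W 1 1) => [a1 a2] [b1 b2] [c1 c2] [e1 e2] /=.
by ring.
Qed.

(** The test vectors are e_0, e_1, e_0 + e_1 and e_0 + i e_1: the first two make the diagonal real,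
    the others give the imaginary and the real part of the off-diagonal relation. *)
Lemma herm_of_qform W :
  Im (qform W (cvec 1 0 0 0)) = 0 -> Im (qform W (cvec 0 0 1 0)) = 0 ->
  Im (qform W (cvec 1 0 1 0)) = 0 -> Im (qform W (cvec 1 0 0 1)) = 0 ->
  forall l l', W l' l = conjc (W l l').
Proof.
rewrite !Im_qform => ? ? ? ?.
apply: forall_ord2; apply: forall_ord2; apply: cplx_eq; rewrite ?ReC ?ImC; lra.
Qed.

Lemma psd_Re W v : psd W -> 0 <= Re (qform W v).
Proof. by move=> /(_ v); rewrite lecE => /andP[]. Qed.

Lemma psd_Im W v : psd W -> Im (qform W v) = 0.
Proof. by move=> /(_ v); rewrite lecE => /andP[/eqP]. Qed.

Lemma psd_herm W : psd W -> forall l l', W l' l = conjc (W l l').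
Proof. by move=> h; apply: herm_of_qform; apply: psd_Im. Qed.

(** Positivity almost everywhere can be obtained for countably many vectors at once only; this
    extends it from rational coordinates to all. *)
Lemma psd_of_rat W :
  (forall p0 q0 p1 q1 : rat,
     0 <= qform W (cvec (ratr p0) (ratr q0) (ratr p1) (ratr q1))) -> psd W.
Proof.
move=> h.
have im0 p0 q0 p1 q1 : Im (qform W (cvec (ratr p0) (ratr q0) (ratr p1) (ratr q1))) = 0.
  by have := h p0 q0 p1 q1; rewrite lecE => /andP[/eqP].
have hre p0 q0 p1 q1 : 0 <= Re (qform W (cvec (ratr p0) (ratr q0) (ratr p1) (ratr q1))).
  by have := h p0 q0 p1 q1; rewrite lecE => /andP[].
have r0 : ratr 0 = 0 :> R by rewrite rmorph0.
have r1 : ratr 1 = 1 :> R by rewrite rmorph1.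
have herm : forall l l', W l' l = conjc (W l l').
  apply: herm_of_qform.
  - by have := im0 1 0 0 0; rewrite r0 r1.
  - by have := im0 0 0 1 0; rewrite r0 r1.
  - by have := im0 1 0 1 0; rewrite r0 r1.
  - by have := im0 1 0 0 1; rewrite r0 r1.
have e1 : Im (W 0 0) = 0 by have := congr1 Im (herm 0 0); rewrite ImC; lra.
have e2 : Im (W 1 1) = 0 by have := congr1 Im (herm 1 1); rewrite ImC; lra.
have ire v : Im (qform W v) = 0.
  have [x [y [s [t ->]]]] := cvec_eta v.
  by rewrite Im_qform e1 e2 (herm 0 1) ReC ImC; ring.
suff hall x y s t : 0 <= Re (qform W (cvec x y s t)).
  by move=> v; have [x [y [s [t ->]]]] := cvec_eta v; rewrite lecE hall andbT ire.
have [a [e [b [c QE]]]] : exists a e b c, forall x y s t,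
    Re (qform W (cvec x y s t)) = a * (x ^+ 2 + y ^+ 2) + e * (s ^+ 2 + t ^+ 2)
      + b * (x * s + y * t) + c * (x * t - y * s).
  by do 4! eexists; move=> *; rewrite Re_qform.
pose Q x y s t : R := a * (x ^+ 2 + y ^+ 2) + e * (s ^+ 2 + t ^+ 2)
  + b * (x * s + y * t) + c * (x * t - y * s).
have H p0 q0 p1 q1 : 0 <= Q (ratr p0) (ratr q0) (ratr p1) (ratr q1).
  by rewrite /Q -QE.
rewrite QE.
(* In each single real coordinate the form is a quadratic polynomial, so the four coordinates are
   freed from rationality one at a time. *)
have extend (A B C : R) (P : R -> R) : (forall u, P u = A * u ^+ 2 + B * u + C) ->
    (forall q : rat, 0 <= P (ratr q)) -> forall u, 0 <= P u.
  by move=> PE h' u; rewrite PE; apply: quadratic_ge0_rat => q; rewrite -PE.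
apply: (extend e (b * y + c * x) (a * (x ^+ 2 + y ^+ 2) + e * s ^+ 2 + b * (x * s)
  - c * (y * s)) (Q x y s)) => [u|q1]; first by rewrite /Q; ring.
set t' := ratr q1.
apply: (extend e (b * x - c * y) (a * (x ^+ 2 + y ^+ 2) + e * t' ^+ 2 + b * (y * t')
  + c * (x * t')) (fun s => Q x y s t')) => [u|p1]; first by rewrite /Q; ring.
set s' := ratr p1.
apply: (extend a (b * t' - c * s') (a * x ^+ 2 + e * (s' ^+ 2 + t' ^+ 2) + b * (x * s')
  + c * (x * t')) (fun y => Q x y s' t')) => [u|q0]; first by rewrite /Q; ring.
set y' := ratr q0.
apply: (extend a (b * s' + c * t') (a * y' ^+ 2 + e * (s' ^+ 2 + t' ^+ 2) + b * (y' * t')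
  - c * (y' * s')) (fun x => Q x y' s' t')) => [u|p0]; first by rewrite /Q; ring.
exact: H.
Qed.

(** The diagonal entries are nonnegative with sum 1, and positivity at e_0 + c e_1 for c = 1, -1, i,
    -i bounds twice each part of the off-diagonal entry by the trace. *)
Lemma psd_bound W : psd W -> Re (W 0 0) + Re (W 1 1) = 1 ->
  forall l l', `|Re (W l l')| <= 1 /\ `|Im (W l l')| <= 1.
Proof.
move=> h tr1; have herm := psd_herm h.
have P x y s t := psd_Re (cvec x y s t) h.
have := P 1 0 0 0; have := P 0 0 1 0; have := P 1 0 1 0; have := P 1 0 (-1) 0.
have := P 1 0 0 1; have := P 1 0 0 (-1); rewrite !Re_qform => {P}.
have e0 : Im (W 0 0) = 0 by have := congr1 Im (herm 0 0); rewrite ImC; lra.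
have e1 : Im (W 1 1) = 0 by have := congr1 Im (herm 1 1); rewrite ImC; lra.
have hr : Re (W 1 0) = Re (W 0 1) by rewrite (herm 0 1) ReC.
have hi : Im (W 1 0) = - Im (W 0 1) by rewrite (herm 0 1) ImC.
move=> a1 a2 a3 a4 a5 a6.
apply: forall_ord2; apply: forall_ord2; rewrite ?e0 ?e1 ?normr0 !ler_norml;
  split => //; try (apply/andP; split); lra.
Qed.

End PositiveMatrices.

(** On the set where h < 0 the integral of |h| is minus that of h, hence at most 0; so h vanishes
    almost everywhere on a set where it is negative. *)
Lemma ae_ge0 d (T : measurableType d) (R : realType)
    (mu : {measure set T -> \bar R}) (D : set T) (h : T -> R) : measurable D ->
  mu.-integrable D (EFin \o h) ->
  (forall A, measurable A -> A `<=` D -> 0 <= Rintegral mu A h) ->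
  {ae mu, forall x, D x -> 0 <= h x}.
Proof.
move=> mD hi hpos; have mh : measurable_fun D h.
  by apply/measurable_EFinP; exact: measurable_int hi.
pose N := D `&` h @^-1` `]-oo, 0[.
have mN : measurable N by exact: mh.
have ND : N `<=` D by exact: subIsetl.
have hiN : mu.-integrable N (EFin \o h) by exact: integrableS hi.
have i0 : (\int[mu]_(x in N) `|(h x)%:E| = 0)%E.
  have fin : (\int[mu]_(x in N) `|(h x)%:E|)%E \is a fin_num.
    by apply: integrable_fin_num => //; exact: integrable_abse.
  rewrite -(fineK fin); congr EFin; apply/le_anti/andP; split; last first.
    by apply: fine_ge0; apply: integral_ge0.
  have -> : fine (\int[mu]_(x in N) `|(h x)%:E|)%E = Rintegral mu N (fun x => -1 * h x).
    congr fine; apply: eq_integral => x /set_mem[_ /=]; rewrite in_itv/= => hx.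
    by rewrite ler0_norm ?mulN1r// ltW.
  by rewrite RintegralZl// mulN1r oppr_le0; exact: hpos.
have mhN : measurable_fun N (EFin \o h) by exact: measurable_int hiN.
have := (ae_eq_integral_abs mu mN mhN).1 i0.
apply: filterS => x /= Nh0 Dx; rewrite leNgt; apply/negP => hx.
have Nx : N x by split=> //=; rewrite in_itv.
by have /= [h0] := Nh0 Nx; move: hx; rewrite h0 ltxx.
Qed.

(** * The trace measure and a density that is positive everywhere *)

Section Density.
Context {R : realType}.
Variable E : set (plane R) -> (int -> R[i]) -> (int -> R[i]).
Hypothesis hE : projection_valued_measure E.
Variable d : 'I_2 -> int -> R[i].
Hypothesis d_l2 : forall l, l2 (d l).
Variable S : set (plane R) -> 'M[R[i]]_2.
Hypothesis SE : forall A l l', measurable A -> S A l l' = dotp (d l) (E A (d l')).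
Local Notation circle := (unit_circle R).
Local Notation mcircle := (@measurable_unit_circle R).

Lemma dotp_l2_0r (f g : int -> R[i]) : (g = fun=> 0) -> dotp f g = 0.
Proof.
move=> ->; apply: dotp_near; apply: nearW => n.
by rewrite /sumZ big1// => j _; rewrite mulr0.
Qed.

Lemma ex_trace_measure : exists mu : {finite_measure set (plane R) -> \bar R},
  forall A, measurable A -> trace_measure S A = mu A.
Proof.
have trE A : measurable A -> Re (\tr (S A)) = \sum_l Re (dotp (d l) (E A (d l))).
  by move=> mA; rewrite /mxtrace Re_sum; apply: eq_bigr => l _; rewrite SE.
have [|A mA|F mF tF|mu muE] :=
    @ex_finite_measure _ _ _ (fun A : set (plane R) => Re (\tr (S A))).
- by rewrite trE// big1// => l _; rewrite dotp_l2_0r// pvm_set0.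
- by rewrite trE//; apply: sumr_ge0 => l _; exact: pvm_ge0.
- rewrite trE; last exact: bigcupT_measurable.
  have -> : (fun N => \sum_(n < N) Re (\tr (S (F n)))) =
      (fun N => \sum_l Re (\sum_(n < N) dotp (d l) (E (F n) (d l)))).
    apply/funext => N; under [RHS]eq_bigr do rewrite Re_sum.
    by rewrite exchange_big; apply: eq_bigr => n _; rewrite trE.
  rewrite !sum_ord2; under eq_fun do rewrite sum_ord2.
  have cv l := (cvgcP _ _).1 (pvm_sigma hE mF tF (d_l2 l) (d_l2 l)).
  by apply: cvgD; [exact: (cv 0).1|exact: (cv 1).1].
- by exists mu => A mA; rewrite muE.
Qed.

Section WithTraceMeasure.
Variable mu : {finite_measure set (plane R) -> \bar R}.
Hypothesis muE : forall A, measurable A -> trace_measure S A = mu A.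

(** A null set for the trace annihilates both squared norms of [E A (d l)], so these vectors vanish
    and with them every entry: the domination that Radon-Nikodym asks for. *)
Lemma trace_null A l l' : measurable A -> mu A = 0%E -> dotp (d l) (E A (d l')) = 0.
Proof.
move=> mA; rewrite -muE// /trace_measure => -[].
rewrite /mxtrace Re_sum sum_ord2 !SE// => h.
have p l0 : 0 <= Re (dotp (d l0) (E A (d l0))) by exact: pvm_ge0.
have z l0 : Re (dotp (d l0) (E A (d l0))) = 0.
  by move: l0; apply: forall_ord2; have := p 0; have := p 1; lra.
rewrite dotp_l2_0r//; apply: nrm2_eq0; first exact: (pvm_l2 hE).
by rewrite (pvm_nrm2 hE).
Qed.

(** One real Radon-Nikodym derivative for each part of each entry. Existence is what gives meaning
    to [density], a choice with the default value 0. *)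
Lemma ex_density : exists w, is_density S w.
Proof.
have hex (p : 'I_2 * 'I_2) : exists h : (plane R -> R) * (plane R -> R),
    [/\ mu.-integrable setT (EFin \o h.1), mu.-integrable setT (EFin \o h.2) &
     forall A, measurable A ->
      (Re (dotp (d p.1) (E A (d p.2))))%:E = (\int[mu]_(x in A) (h.1 x)%:E)%E /\
      (Im (dotp (d p.1) (E A (d p.2))))%:E = (\int[mu]_(x in A) (h.2 x)%:E)%E].
  have z0 : dotp (d p.1) (E set0 (d p.2)) = 0 by rewrite dotp_l2_0r// pvm_set0.
  have z1 : Re (dotp (d p.1) (E set0 (d p.2))) = 0 by rewrite z0.
  have s1 (F : nat -> set (plane R)) : (forall n, measurable (F n)) ->
      trivIset setT F ->
      (fun N => \sum_(n < N) Re (dotp (d p.1) (E (F n) (d p.2)))) @ \oo -->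
      Re (dotp (d p.1) (E (\bigcup_n F n) (d p.2))).
    move=> mF tF; have [+ _] := (cvgcP _ _).1 (pvm_sigma hE mF tF (d_l2 p.2) (d_l2 p.1)).
    by under eq_fun do rewrite Re_sum.
  have d1 A : measurable A -> mu A = 0%E -> Re (dotp (d p.1) (E A (d p.2))) = 0.
    by move=> mA mA0; rewrite trace_null.
  have [h1 [i1 e1]] := ex_real_density z1 s1 d1.
  have z2 : Im (dotp (d p.1) (E set0 (d p.2))) = 0 by rewrite z0.
  have s2 (F : nat -> set (plane R)) : (forall n, measurable (F n)) ->
      trivIset setT F ->
      (fun N => \sum_(n < N) Im (dotp (d p.1) (E (F n) (d p.2)))) @ \oo -->
      Im (dotp (d p.1) (E (\bigcup_n F n) (d p.2))).
    move=> mF tF; have [_] := (cvgcP _ _).1 (pvm_sigma hE mF tF (d_l2 p.2) (d_l2 p.1)).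
    by under eq_fun do rewrite Im_sum.
  have d2 A : measurable A -> mu A = 0%E -> Im (dotp (d p.1) (E A (d p.2))) = 0.
    by move=> mA mA0; rewrite trace_null.
  have [h2 [i2 e2]] := ex_real_density z2 s2 d2.
  by exists (h1, h2); split=> // A mA; split; [exact: e1|exact: e2].
have [h hP] := choice hex.
exists (fun z => \matrix_(l, l') Complex ((h (l, l')).1 z) ((h (l, l')).2 z)).
move=> l l'; have [i1 i2 hA] := hP (l, l'); split.
  apply/(eq_setfun_cintegrable _ _ muE); split.
    under eq_fun do rewrite mxE /=.
    by apply: integrableS i1 => //; exact: mcircle.
  under eq_fun do rewrite mxE /=.
  by apply: integrableS i2 => //; exact: mcircle.
move=> A mA _; rewrite (eq_setfun_cintegral _ _ muE) SE//.
have [/= r1 r2] := hA A mA.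
apply: cplx_eq; rewrite !(Re_cintegral, Im_cintegral) /Rintegral.
  by under eq_integral do rewrite mxE /=; rewrite -r1.
by under eq_integral do rewrite mxE /=; rewrite -r2.
Qed.

Let W := density S.

Lemma density_integrable A l l' : measurable A -> A `<=` circle ->
  cintegrable mu A (fun z => W z l l').
Proof.
move=> mA AD; have [i1 _] := xgetPex (fun=> 0) ex_density l l'.
apply: (cintegrableS mcircle mA AD); exact/(eq_setfun_cintegrable _ _ muE).
Qed.

Lemma density_dotp A l l' : measurable A -> A `<=` circle ->
  dotp (d l) (E A (d l')) = cintegral mu A (fun z => W z l l').
Proof.
move=> mA AD; have [_ i1] := xgetPex (fun=> 0) ex_density l l'.
by rewrite -SE// i1//; apply: eq_setfun_cintegral.
Qed.

Lemma density_measurable l l' : cmeasurable circle (fun z => W z l l').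
Proof.
have [i1 i2] := density_integrable l l' mcircle (@subset_refl _ _).
by split; apply/measurable_EFinP; apply: measurable_int; [exact: i1|exact: i2].
Qed.

(** The integral of v* W v over A is (f, E(A) f) for the vector f = v_0 d_0 + v_1 d_1, hence
    nonnegative. *)
Lemma qform_integral (v : 'cV[R[i]]_2) A : measurable A -> A `<=` circle ->
  cintegrable mu A (fun z => qform (W z) v) /\
  0 <= cintegral mu A (fun z => qform (W z) v).
Proof.
move=> mA AD.
pose c (p : 'I_2 * 'I_2) := conjc (v p.1 0) * v p.2 0.
have QE : (fun z => qform (W z) v) =
    (fun z => \sum_p c p * W z p.1 p.2).
  apply/funext => z; rewrite /qform pair_big /=.
  by apply: eq_bigr => p _; rewrite /c; ring.
have iW (p : 'I_2 * 'I_2) := density_integrable p.1 p.2 mA AD.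
rewrite QE; split; first exact: cintegrable_sum.
rewrite cintegral_sum//.
pose f k := \sum_l v l 0 * d l k.
have f2 : l2 f by exact: l2_sum.
suff -> : \sum_p c p * cintegral mu A (fun z => W z p.1 p.2) = dotp f (E A f).
  by rewrite pvm_dotp_real// ler0c; exact: pvm_ge0.
have dl0 l : l2 (E A (d l)) by exact: (pvm_l2 hE).
have -> : E A f = fun k => \sum_l v l 0 * E A (d l) k.
  exact: pvm_sum.
have dsum := l2_sum (index_enum 'I_2) (fun l => v l 0) dl0.
rewrite (dotp_suml _ (fun l => v l 0) d_l2 dsum).
rewrite -(pair_big predT predT (fun l l' => c (l, l') * cintegral mu A (fun z => W z l l'))).
apply: eq_bigr => l _ /=.
rewrite (dotpC dsum (d_l2 l)) (dotp_suml _ (fun l => v l 0) dl0 (d_l2 l)).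
rewrite rmorph_sum mulr_sumr; apply: eq_bigr => l' _.
rewrite rmorphM /= conjcK -dotpC// -density_dotp// /c /=.
by rewrite mulrA.
Qed.

Lemma density_trace A : measurable A -> A `<=` circle ->
  Rintegral mu A (fun z => Re (W z 0 0) + Re (W z 1 1)) = fine (mu A).
Proof.
move=> mA AD; have [i0 _] := density_integrable 0 0 mA AD.
have [i1 _] := density_integrable 1 1 mA AD.
rewrite RintegralD// -!Re_cintegral -!density_dotp// -muE//.
by rewrite /trace_measure /mxtrace /= Re_sum sum_ord2 !SE.
Qed.

Lemma ae_density :
  {ae mu, forall z, circle z -> psd (W z) /\ Re (W z 0 0) + Re (W z 1 1) = 1}.
Proof.
have mW l l' := density_measurable l l'.
have h1 : {ae mu, forall z, circle z -> Re (W z 0 0) + Re (W z 1 1) = 1}.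
  have [i0 _] := density_integrable 0 0 mcircle (@subset_refl _ _).
  have [i1 _] := density_integrable 1 1 mcircle (@subset_refl _ _).
  have itr : mu.-integrable circle (fun z => (Re (W z 0 0) + Re (W z 1 1))%:E).
    by under eq_fun do rewrite EFinD; exact: (integrableD mcircle i0 i1).
  have cond A : A `<=` circle -> measurable A ->
      (\int[mu]_(z in A) (Re (W z 0 0) + Re (W z 1 1))%:E = \int[mu]_(z in A) cst 1 z)%E.
    move=> AD mA; have := density_trace mA AD.
    have iA : mu.-integrable A (fun z => (Re (W z 0 0) + Re (W z 1 1))%:E).
      by apply: integrableS itr => //; exact: mcircle.
    rewrite /Rintegral integral_cst// mul1e => h.
    rewrite -[RHS]fineK ?fin_num_measure// -h fineK//.
    exact: integrable_fin_num.
  have := integral_ae_eq mcircle itr (measurable_cst 1%E) cond.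
  by apply: filterS => z hz cz; have [] := hz cz.
have h2 (p : rat * rat * rat * rat) : {ae mu, forall z, circle z ->
    0 <= qform (W z) (cvec (ratr p.1.1.1) (ratr p.1.1.2) (ratr p.1.2) (ratr p.2))}.
  set v := cvec _ _ _ _.
  have [[ir ii] _] := qform_integral v mcircle (@subset_refl _ _).
  have re0 : {ae mu, forall z, circle z -> 0 <= Re (qform (W z) v)}.
    apply: (ae_ge0 mcircle ir) => A mA AD.
    by have [_] := qform_integral v mA AD; rewrite lecE => /andP[].
  have im0 : {ae mu, forall z, circle z -> 0 <= Im (qform (W z) v)}.
    apply: (ae_ge0 mcircle ii) => A mA AD.
    by have [_] := qform_integral v mA AD; rewrite lecE Im_cintegral => /andP[/eqP -> _].
  (* The imaginary part and its opposite are both nonnegative almost everywhere, so the form is real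
     there. *)
  have im1 : {ae mu, forall z, circle z -> 0 <= - 1 * Im (qform (W z) v)}.
    apply: (ae_ge0 mcircle) => [|A mA AD]; first exact: (integrableZl mcircle (-1) ii).
    have [[_ iA]] := qform_integral v mA AD; rewrite lecE Im_cintegral => /andP[/eqP + _].
    by rewrite RintegralZl// => ->; rewrite mulr0.
  apply: (filterS3 _ _ re0 im0 im1) => z a1 a2 a3 cz; rewrite lecE (a1 cz) andbT.
  by have := a2 cz; have := a3 cz => /= h3 h4; apply/eqP; lra.
(* The rational vectors are enumerated by natural numbers, so that countably many null sets are
   merged into one. *)
have h3 : {ae mu, forall z, forall n, circle z -> forall p, unpickle n = Some p ->
    0 <= qform (W z) (cvec (ratr p.1.1.1) (ratr p.1.1.2) (ratr p.1.2) (ratr p.2))}.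
  apply: ae_foralln => n; case E1: (unpickle n) => [p|].
    by apply: (filterS _ (h2 p)) => z hz cz q [<-]; exact: hz.
  exact: aeW.
apply: (filterS2 _ _ h1 h3) => z a1 a3 cz; split; last exact: a1.
apply: psd_of_rat => p0 q0 p1 q1.
by apply: (a3 (pickle (p0, q0, p1, q1)) cz (p0, q0, p1, q1)); rewrite pickleK.
Qed.

Lemma ex_psd_density : exists (w : plane R -> 'M[R[i]]_2) (N : set (plane R)),
  [/\ measurable N, mu N = 0%E, forall z, circle z -> ~ N z -> W z = w z,
      forall z, psd (w z) &
      [/\ forall l l', cmeasurable circle (fun z => w z l l'),
          forall l l', cbounded circle (fun z => w z l l') &
          forall A l l', measurable A ->
            dotp (d l) (E A (d l')) = cintegral mu (circle `&` A) (fun z => w z l l')]].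
Proof.
have [N [mN N0 sN]] := ae_density.
have good z : circle z -> ~ N z -> psd (W z) /\ Re (W z 0 0) + Re (W z 1 1) = 1.
  by move=> cz Nz; apply: contrapT => h; apply: Nz; apply: sN => /= h'; apply: h; exact: h'.
pose D := circle `\` N.
have mD : measurable D by apply: measurableD => //; exact: mcircle.
(* Off the good set the value is half the identity, again positive with trace one, so that
   [psd_bound] holds at every point. *)
pose w z : 'M[R[i]]_2 := if `[< D z >] then W z else (2^-1)%:M.
have wD z : D z -> w z = W z by rewrite /w => Dz; rewrite asboolT.
have wND z : ~ D z -> w z = (2^-1)%:M by rewrite /w => Dz; rewrite asboolF.
have hRe (n : nat) : Re (n.+1%:R^-1 : R[i]) = n.+1%:R^-1 /\ Im (n.+1%:R^-1 : R[i]) = 0.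
  have -> : (n.+1%:R^-1 : R[i]) = (n.+1%:R^-1 : R)%:C%C by rewrite fmorphV rmorph_nat.
  by [].
have [half1 half2] := hRe 1%N.
pose H : 'M[R[i]]_2 := (2^-1)%:M.
have H00 : H 0 0 = 2^-1 by rewrite mxE eqxx.
have H11 : H 1 1 = 2^-1 by rewrite mxE eqxx.
have H01 : H 0 1 = 0 by rewrite mxE.
have H10 : H 1 0 = 0 by rewrite mxE.
have psd_half : psd H.
  move=> v; have [x [y [s [t ->]]]] := cvec_eta v.
  rewrite lecE Re_qform Im_qform H00 H11 H01 H10 half1 half2 Re0 Im0.
  rewrite !subr0 !addr0 !mul0r !addr0 eqxx /=.
  by rewrite addr_ge0//; apply: mulr_ge0; rewrite ?invr_ge0 ?addr_ge0 ?sqr_ge0.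
have psdw z : psd (w z) /\ Re (w z 0 0) + Re (w z 1 1) = 1.
  have [Dz|Dz] := pselect (D z); first by rewrite wD//; case: Dz; exact: good.
  by rewrite wND//; split=> //; rewrite -/H H00 H11 half1; lra.
have mw l l' : cmeasurable circle (fun z => w z l l').
  have mind : cmeasurable circle (cindic D) := @cmeasurable_cindic R _ _ circle D mD.
  have -> : (fun z => w z l l') = (fun z => cindic D z * W z l l' +
      (1 + (-1) * cindic D z) * ((2^-1)%:M : 'M[R[i]]_2) l l').
    apply/funext => z; rewrite /cindic indicE; have [Dz|Dz] := pselect (D z).
      by rewrite wD// mem_set//= rmorph1; ring.
    by rewrite wND// memNset//= rmorph0; ring.
  apply: cmeasurableD.
    by apply: cmeasurableM => //; exact: density_measurable.
  apply: cmeasurableM; last exact: cmeasurable_cst.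
  apply: cmeasurableD; first exact: cmeasurable_cst.
  by apply: cmeasurableM => //; exact: cmeasurable_cst.
exists w, N; split=> //.
- by move=> z cz Nz; rewrite wD.
- by move=> z; have [] := psdw z.
split=> // [l l'|A l l' mA].
  by exists 1 => z _; apply: psd_bound; have [] := psdw z.
have mcA : measurable (circle `&` A) by exact: measurableI mcircle mA.
rewrite -(pvm_circleI hE mA (d_l2 l')) density_dotp//.
apply: (ae_eq_cintegral mcA mN N0).
- by apply: cmeasurableS mcircle _ (density_measurable l l'); exact: subIsetl.
- by apply: cmeasurableS mcircle _ (mw l l'); exact: subIsetl.
- by move=> z [cz _] Nz; rewrite wD.
Qed.

End WithTraceMeasure.

End Density.

(** * Completeness *)

Section Completeness.
Context {R : realType}.
Local Notation circle := (unit_circle R).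
Local Notation mcircle := (@measurable_unit_circle R).

Lemma mform_qform (w : plane R -> 'M[R[i]]_2) F z :
  mform w F F z = qform (w z) (F z).
Proof. by rewrite mformE. Qed.

(** Parallelogram identity: the right side minus the left is the form at u - v. *)
Lemma qform_le2 (W : 'M[R[i]]_2) (u v : 'cV[R[i]]_2) : psd W ->
  Re (qform W (u + v)) <= 2 * Re (qform W u) + 2 * Re (qform W v).
Proof.
move=> hW; have := psd_Re (u - v) hW.
have -> : Re (qform W (u - v)) =
    2 * Re (qform W u) + 2 * Re (qform W v) - Re (qform W (u + v)).
  have [x [y [s [t ->]]]] := cvec_eta u; have [x' [y' [s' [t' ->]]]] := cvec_eta v.
  have -> : cvec x y s t - cvec x' y' s' t' = cvec (x - x') (y - y') (s - s') (t - t').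
    by apply/colP => i; rewrite !mxE; case: ifP.
  have -> : cvec x y s t + cvec x' y' s' t' = cvec (x + x') (y + y') (s + s') (t + t').
    by apply/colP => i; rewrite !mxE; case: ifP.
  by rewrite !Re_qform; ring.
by rewrite subr_ge0.
Qed.

(** Splitting v into its two coordinate vectors by [qform_le2] removes the off-diagonal entries;
    each part contributes at most 2 M e^2, doubled and added this is 8 M e^2. *)
Lemma qform_le_diag (W : 'M[R[i]]_2) (M e : R) (v : 'cV[R[i]]_2) : psd W ->
  (forall l, Re (W l l) <= M) ->
  (forall l : 'I_2, `|Re (v l 0)| <= e /\ `|Im (v l 0)| <= e) ->
  Re (qform W v) <= 8 * M * e ^+ 2.
Proof.
move=> hW WM ve; have [x [y [s [t vE]]]] := cvec_eta v.
have -> : v = cvec x y 0 0 + cvec 0 0 s t.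
  by rewrite vE; apply/colP => i; rewrite !mxE; case: ifP => _;
    apply: cplx_eq; rewrite /= ?addr0 ?add0r.
apply: (le_trans (qform_le2 _ _ hW)); rewrite !Re_qform.
have [+ +] := ve 0; have [+ +] := ve 1; rewrite vE !mxE /= => hs ht hx hy.
have e0 : 0 <= e by apply: le_trans hx.
have sq u : `|u| <= e -> u ^+ 2 <= e ^+ 2.
  by move=> ue; rewrite -real_normK ?num_real// lerXn2r// nnegrE.
have M0 := WM 0; have M1 := WM 1.
have W0 : 0 <= Re (W 0 0).
  by have := psd_Re (cvec 1 0 0 0) hW; rewrite Re_qform; lra.
have W1 : 0 <= Re (W 1 1).
  by have := psd_Re (cvec 0 0 1 0) hW; rewrite Re_qform; lra.
have p0 : Re (W 0 0) * (x ^+ 2 + y ^+ 2) <= M * (e ^+ 2 + e ^+ 2).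
  by apply: ler_pM => //; [rewrite addr_ge0// sqr_ge0|rewrite lerD// sq].
have p1 : Re (W 1 1) * (s ^+ 2 + t ^+ 2) <= M * (e ^+ 2 + e ^+ 2).
  by apply: ler_pM => //; [rewrite addr_ge0// sqr_ge0|rewrite lerD// sq].
by move: p0 p1; rewrite expr0n /= !(mulr0, mul0r, addr0, add0r, subr0); lra.
Qed.

Let le_energy_sum (a b c x y : R) : x <= 2 * a + 2 * y -> y <= 2 * b + 2 * c ->
  x <= 2 * a + (4 * b + 4 * c).
Proof. lra. Qed.

(** Splitting into three errors by two uses of the parallelogram bound costs the factors 2, 4 and 4;
    a sixteenth of the budget for each leaves 10/16 < 1. *)
Let lt_energy_sum (a b c x : R) : 0 < x -> a < x / 16 -> b <= x / 16 -> c < x / 16 ->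
  2 * a + (4 * b + 4 * c) < x.
Proof. lra. Qed.

Variable E : set (plane R) -> (int -> R[i]) -> (int -> R[i]).
Hypothesis hE : projection_valued_measure E.
Variable d : 'I_2 -> int -> R[i].
Hypothesis d_l2 : forall l, l2 (d l).

Lemma rep0 : rep E d (fun=> 0) (fun=> 0).
Proof.
have h := rep_lin (-1) (rep_base E d 0) (rep_base E d 0).
have -> : (fun=> 0) = (fun k => -1 * d 0 k + d 0 k).
  by apply/funext => k; ring.
by apply: rep_ext h _ => z _; rewrite scaleN1r addNr.
Qed.

Lemma repD f F g G : rep E d f F -> rep E d g G ->
  rep E d (fun k => f k + g k) (fun z => F z + G z).
Proof.
move=> hf hg; have h := rep_lin 1 hf hg.
have -> : (fun k => f k + g k) = (fun k => 1 * f k + g k).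
  by apply/funext => k; rewrite mul1r.
by apply: rep_ext h _ => z _; rewrite scale1r.
Qed.

Lemma repZ c f F : rep E d f F -> rep E d (fun k => c * f k) (fun z => c *: F z).
Proof.
move=> hf; have h := rep_lin c hf rep0.
have -> : (fun k => c * f k) = (fun k => c * f k + 0).
  by apply/funext => k; rewrite addr0.
by apply: rep_ext h _ => z _; rewrite addr0.
Qed.

Lemma rep_sum (I : Type) (s : seq I) (c : I -> R[i]) f F :
  (forall i, rep E d (f i) (F i)) ->
  rep E d (fun k => \sum_(i <- s) c i * f i k) (fun z => \sum_(i <- s) c i *: F i z).
Proof.
move=> h; elim: s => [|i s IH].
  have -> : (fun k => \sum_(i <- [::]) c i * f i k) = (fun=> 0).
    by apply/funext => k; rewrite big_nil.
  by apply: rep_ext rep0 _ => z _; rewrite big_nil.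
have -> : (fun k => \sum_(j <- i :: s) c j * f j k) =
    (fun k => c i * f i k + \sum_(j <- s) c j * f j k).
  by apply/funext => k; rewrite big_cons.
by apply: rep_ext (rep_lin (c i) (h i) IH) _ => z _; rewrite big_cons.
Qed.

(** Step functions are represented by explicit vectors: the sums of c E(A) d_l over the steps of
    both coordinates. *)
Lemma rep_simple (n : 'I_2 -> nat) (A : 'I_2 -> nat -> set (plane R))
    (c : 'I_2 -> nat -> R[i]) : (forall l i, measurable (A l i)) ->
  exists2 g, l2 g & exists2 G, rep E d g G &
    forall z l, G z l 0 = \sum_(i < n l) c l i * cindic (A l i) z.
Proof.
move=> mA.
have h l i := rep_E (mA l i) (rep_base E d l).
have hs l := rep_sum (index_enum 'I_(n l)) (fun i => c l (nat_of_ord i))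
  (fun i => h l (nat_of_ord i)).
have hh := repD (hs 0) (hs 1).
eexists; first exact: (rep_good hE d_l2 hh).1.
eexists; first exact: hh.
move=> z; apply: forall_ord2; rewrite /= mxE !summxE.
  rewrite [X in _ + X]big1 ?addr0 => [|i _]; last by rewrite !mxE /= !mulr0.
  by apply: eq_bigr => i _; rewrite !mxE eqxx /= mulr1.
rewrite big1 ?add0r => [|i _]; last by rewrite !mxE /= !mulr0.
by apply: eq_bigr => i _; rewrite !mxE eqxx /= mulr1.
Qed.

Variable S : set (plane R) -> 'M[R[i]]_2.
Hypothesis SE : forall A l l', measurable A -> S A l l' = dotp (d l) (E A (d l')).

Section WithDensity.
Variable mu : {finite_measure set (plane R) -> \bar R}.
Hypothesis muE : forall A, measurable A -> trace_measure S A = mu A.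
Variables (w : plane R -> 'M[R[i]]_2) (N : set (plane R)).
Hypothesis mN : measurable N.
Hypothesis N0 : mu N = 0%E.
Hypothesis wN : forall z, circle z -> ~ N z -> density S z = w z.
Hypothesis w_psd : forall z, psd (w z).
Hypothesis w_meas : forall l l', cmeasurable circle (fun z => w z l l').
Hypothesis w_bnd : forall l l', cbounded circle (fun z => w z l l').
Hypothesis w_dens : forall A l l', measurable A ->
  dotp (d l) (E A (d l')) = cintegral mu (circle `&` A) (fun z => w z l l').

Let vmeas (F : plane R -> 'cV[R[i]]_2) :=
  forall l : 'I_2, cmeasurable circle (fun z => F z l 0).

Lemma L2_integrandE F G z : circle z -> ~ N z ->
  L2_integrand S F G z = mform w F G z.
Proof. by move=> cz Nz; rewrite /L2_integrand wN. Qed.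

Lemma L2_integrand_measurable F G : vmeas F -> vmeas G ->
  cmeasurable circle (L2_integrand S F G).
Proof.
by move=> mF mG; apply: (cmeasurable_mform (w := density S)) => // l l';
  exact: (density_measurable hE d_l2 SE muE).
Qed.

Lemma L2_dotpE F G : vmeas F -> vmeas G ->
  L2_dotp S F G = cintegral mu circle (mform w F G).
Proof.
move=> mF mG; rewrite /L2_dotp (eq_setfun_cintegral _ _ muE).
apply: (ae_eq_cintegral mcircle mN N0).
- exact: L2_integrand_measurable.
- exact: cmeasurable_mform.
- exact: L2_integrandE.
Qed.

Lemma in_L2E F : vmeas F -> cintegrable mu circle (mform w F F) -> in_L2 S F.
Proof.
move=> mF iF; split; first by move=> l; apply/measurable_fun_plane.
apply/(eq_setfun_cintegrable _ _ muE); apply: (ae_eq_cintegrable mcircle mN N0) iF.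
- exact: cmeasurable_mform.
- exact: L2_integrand_measurable.
- by move=> z cz Nz; rewrite L2_integrandE.
Qed.

Lemma in_L2P F : in_L2 S F -> vmeas F /\ cintegrable mu circle (mform w F F).
Proof.
move=> [mF iF]; have mF' : vmeas F by move=> l; apply/measurable_fun_plane.
split=> //; move/(eq_setfun_cintegrable _ _ muE) : iF.
apply: (ae_eq_cintegrable mcircle mN N0).
- exact: L2_integrand_measurable.
- exact: cmeasurable_mform.
- by move=> z cz Nz; rewrite L2_integrandE.
Qed.

Let w_herm z l l' : circle z -> w z l' l = conjc (w z l l').
Proof. by move=> _; exact: psd_herm. Qed.

(** The relation is isometric: this is [rel] at the whole circle, where E is the identity. *)
Lemma rep_L2 f F g G : rep E d f F -> rep E d g G ->
  cintegral mu circle (mform w F G) = dotp f g.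
Proof.
move=> rF rG; have [_ hG] := rep_good hE d_l2 rG; have [g2 _] := rep_good hE d_l2 rG.
have h := rep_rel hE d_l2 w_meas w_bnd w_herm w_dens rF rG mcircle.
by rewrite -{1}(setIid circle) -h (pvm_circle hE).
Qed.

Let energy (F : plane R -> 'cV[R[i]]_2) z : R := Re (mform w F F z).

Let energy_ge0 F z : 0 <= energy F z.
Proof. by rewrite /energy mform_qform psd_Re. Qed.

Let energyD F G z : energy (fun z => F z + G z) z <= 2 * energy F z + 2 * energy G z.
Proof. by rewrite /energy !mform_qform qform_le2. Qed.

Let energy_meas F : vmeas F -> measurable_fun circle (energy F).
Proof. by move=> mF; have [] := cmeasurable_mform w_meas mF mF. Qed.

Let energy_int F : vgood F -> mu.-integrable circle (EFin \o energy F).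
Proof.
move=> gF; have [] // : cintegrable mu circle (mform w F F).
apply: bounded_cintegrable; first exact: mcircle.
  by apply: cmeasurable_mform => // l; have [] := gF l.
by apply: cbounded_mform => // l; have [] := gF l.
Qed.

(** F is cut off to the set where its entries are at most n. The energy of the rest is 0 there and
    the energy of F elsewhere, so dominated convergence applies with the energy of F as the bound;
    integrability of the entries of F is never called on. *)
Lemma truncation_energy F (e : R) : vmeas F -> cintegrable mu circle (mform w F F) ->
  0 < e -> exists2 G, vgood G &
    [/\ vmeas (fun z => F z - G z),
        mu.-integrable circle (EFin \o energy (fun z => F z - G z)) &
        Rintegral mu circle (energy (fun z => F z - G z)) < e].
Proof.
move=> mF [iF _] e0.
pose B (n : nat) : set (plane R) := [set z | circle z /\ forall l : 'I_2,
  `|Re (F z l 0)| <= n%:R /\ `|Im (F z l 0)| <= n%:R].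
have mB n : measurable (B n).
  have H (h : plane R -> R) : measurable_fun circle h ->
      measurable (circle `&` h @^-1` `[- n%:R, n%:R]) by move=> mh; exact: mh mcircle _ _.
  have -> : B n = (circle `&` (fun z => Re (F z 0 0)) @^-1` `[- n%:R, n%:R]) `&`
      (circle `&` (fun z => Im (F z 0 0)) @^-1` `[- n%:R, n%:R]) `&`
      ((circle `&` (fun z => Re (F z 1 0)) @^-1` `[- n%:R, n%:R]) `&`
       (circle `&` (fun z => Im (F z 1 0)) @^-1` `[- n%:R, n%:R])).
    apply/seteqP; split=> z; rewrite /B /= !in_itv /= -!ler_norml.
      by move=> [cz h]; have [? ?] := h 0; have [? ?] := h 1.
    by move=> [[[cz ?] [_ ?]] [[_ ?] [_ ?]]]; split=> //; apply: forall_ord2.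
  have [r0 i0] := mF 0; have [r1 i1] := mF 1.
  by apply: measurableI; apply: measurableI; apply: H.
pose G n z := cindic (B n) z *: F z.
have gG n : vgood (G n).
  move=> l; have [mFl bFl] : cmeasurable circle (fun z => cindic (B n) z * F z l 0) /\
      cbounded circle (fun z => cindic (B n) z * F z l 0).
    split; first by apply: cmeasurableM => //; exact: cmeasurable_cindic.
    exists n%:R => z cz; rewrite /cindic indicE; case: (boolP (z \in B n)) => hz.
      by rewrite rmorph1 mul1r; have [_ h] := set_mem hz; exact: h.
    by rewrite rmorph0 mul0r normr0.
  by rewrite (_ : (fun z => G n z l 0) = (fun z => cindic (B n) z * F z l 0))//;
    apply/funext => z; rewrite mxE.
have mFG n : vmeas (fun z => F z - G n z).
  move=> l; rewrite (_ : (fun z => (F z - G n z) l 0) =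
      (fun z => F z l 0 + (-1) * G n z l 0)); last first.
    by apply/funext => z; rewrite !mxE; ring.
  apply: cmeasurableD => //; apply: cmeasurableM; first exact: cmeasurable_cst.
  by have [] := gG n l.
have eE n z : energy (fun z => F z - G n z) z = if z \in B n then 0 else energy F z.
  rewrite /energy !mform_qform /G /cindic indicE; case: ifPn => hz.
    rewrite rmorph1 scale1r subrr.
    by have := Re_qform (w z) 0 0 0 0; rewrite (_ : cvec _ _ _ _ = 0)
      => [->|]; [ring|apply/colP => i; rewrite !mxE; case: ifP].
  by rewrite rmorph0 scale0r subr0.
have leF n z : energy (fun z => F z - G n z) z <= energy F z.
  by rewrite eE; case: ifP.
have int n : mu.-integrable circle (EFin \o energy (fun z => F z - G n z)).
  apply: (le_integrable mcircle _ _ iF).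
    by apply/measurable_EFinP; exact: energy_meas.
  by move=> z cz; rewrite /= lee_fin !(ger0_norm (energy_ge0 _ _)) leF.
have dm n : measurable_fun circle (fun z => (energy (fun z => F z - G n z) z)%:E).
  by apply/measurable_EFinP; exact: energy_meas.
have d0 : {ae mu, forall z, circle z ->
    (fun n => (energy (fun z => F z - G n z) z)%:E) @ \oo --> 0%E}.
  apply: aeW => z cz; apply: cvg_near_cst.
  have [m hm] : exists m : nat, z \in B m.
    pose x := `|Re (F z 0 0)| + `|Im (F z 0 0)| + (`|Re (F z 1 0)| + `|Im (F z 1 0)|).
    exists (Num.truncn x).+1; apply/mem_set; split=> //.
    have hx : x <= (Num.truncn x).+1%:R by apply/ltW/truncnS_gt.
    have := normr_ge0 (Re (F z 0 0)); have := normr_ge0 (Im (F z 0 0)).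
    have := normr_ge0 (Re (F z 1 0)); have := normr_ge0 (Im (F z 1 0)).
    by move: hx; rewrite /x => ? ? ? ? ?; apply: forall_ord2; split; lra.
  exists m => // n /= mn; rewrite eE mem_set//; split=> // l.
  have [_ h] := set_mem hm; have [h1 h2] := h l.
  have mnR : (m%:R : R) <= n%:R by rewrite ler_nat.
  by split; [exact: le_trans h1 mnR|exact: le_trans h2 mnR].
have db : {ae mu, forall z n, circle z ->
    (`|(energy (fun z => F z - G n z) z)%:E| <= (energy F z)%:E)%E}.
  by apply: aeW => z n cz; rewrite /= lee_fin (ger0_norm (energy_ge0 _ _)) leF.
have := dominated_convergence mcircle dm (measurable_cst 0%E) d0 iF db.
move=> [_ _]; rewrite integral0 => /fine_cvgP[_] /cvgrPdist_lt /(_ _ e0) [n _ hn].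
exists (G n) => //; split=> //.
have := hn n (leqnn n); rewrite /= sub0r normrN; apply: le_lt_trans.
exact: ler_norm.
Qed.

Lemma complete_of_rep (Q : int -> plane R -> 'cV[R[i]]_2) :
  (forall k, rep E d (delta R k) (Q k)) -> complete_orthonormal_system S Q.
Proof.
move=> hQ.
have gQ k : vgood (Q k) by have [] := rep_good hE d_l2 (hQ k).
have mQ k : vmeas (Q k) by move=> l; have [] := gQ k l.
split.
- move=> k; apply: in_L2E => //.
  apply: bounded_cintegrable;
    [exact: mcircle|exact: (cmeasurable_mform w_meas (mQ k) (mQ k))|].
  by apply: cbounded_mform => // l; have [] := gQ k l.
- by move=> k k'; rewrite L2_dotpE// (rep_L2 (hQ k) (hQ k')) dotp_deltal /delta.
move=> F /in_L2P[mF iF] e e0.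
have e2 : 0 < e ^+ 2 / 16 by rewrite divr_gt0// exprn_gt0.
have [F1 gF1 [mFF1 iFF1 FF1]] := truncation_energy mF iF e2.
have [M M0 hM] : exists2 M : R, 0 < M & forall z, circle z -> forall l, Re (w z l l) <= M.
  have [M0 h0] := w_bnd 0 0; have [M1 h1] := w_bnd 1 1.
  exists (`|M0| + `|M1| + 1); first by rewrite ltr_wpDl// addr_ge0.
  move=> z cz; have [a0 _] := h0 z cz; have [a1 _] := h1 z cz.
  have b0 := le_trans (ler_norm _) a0; have b1 := le_trans (ler_norm _) a1.
  have := ler_norm M0; have := ler_norm M1.
  have := normr_ge0 M0; have := normr_ge0 M1.
  by move=> ? ? ? ?; apply: forall_ord2; lra.
pose m := fine (mu circle).
have m0 : 0 <= m by rewrite fine_ge0.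
pose K := 8 * M * (m + 1) + 1.
have K1 : 1 <= K by rewrite /K lerDr !mulr_ge0 ?ltW//; lra.
have K0 : 0 < K by lra.
(* The bound 1 gives eta^2 <= eta, so the quadratic error of [qform_le_diag] integrates to at most
   eta K. *)
pose eta := Num.min 1 (e ^+ 2 / 16 / K).
have eta0 : 0 < eta by rewrite lt_min ltr01 divr_gt0.
have eta1 : eta <= 1 by rewrite ge_min lexx.
have etaK : eta * K <= e ^+ 2 / 16.
  by rewrite -ler_pdivlMr// ge_min lexx orbT.
have happ l : exists p : nat * (nat -> set (plane R)) * (nat -> R[i]),
    (forall i, measurable (p.1.2 i)) /\ forall z, circle z ->
      `|Re (F1 z l 0 - \sum_(i < p.1.1) p.2 i * cindic (p.1.2 i) z)| <= eta /\
      `|Im (F1 z l 0 - \sum_(i < p.1.1) p.2 i * cindic (p.1.2 i) z)| <= eta.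
  have [mFl [C hC]] := gF1 l.
  have [n [A [c [mA hA]]]] := complex_simple_approx mcircle eta0 mFl hC.
  by exists (n, A, c).
have [p hp] := choice happ.
have [g g2 [G rG GE]] := @rep_simple (fun l => (p l).1.1) (fun l => (p l).1.2)
  (fun l => (p l).2) (fun l i => (hp l).1 i).
have gG : vgood G by have [] := rep_good hE d_l2 rG.
have gB (F' G' : plane R -> 'cV[R[i]]_2) : vgood F' -> vgood G' ->
    vgood (fun z => F' z - G' z).
  move=> gF' gG'; apply: (@eq_vgood _ (fun z => -1 *: G' z + F' z)).
    by move=> z _; rewrite scaleN1r addrC.
  by apply: vgood_lin => //; exact: cbounded_cst.
have F1G : Rintegral mu circle (energy (fun z => F1 z - G z)) <= e ^+ 2 / 16.
  apply: (@le_trans _ _ (eta * (8 * M) * m)); last first.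
    apply: le_trans etaK; rewrite -mulrA ler_pM2l// /K.
    by have := mulr_ge0 (ltW M0) m0; lra.
  rewrite -Rintegral_cst; last exact: mcircle.
  apply: le_Rintegral; first exact: mcircle.
  - by apply: energy_int; exact: gB.
  - exact: finite_measure_integrable_cst mcircle.
  move=> z cz; rewrite /energy mform_qform.
  apply: (le_trans (qform_le_diag (e := eta) (w_psd z) (hM z cz) _)).
    by move=> l; rewrite !mxE GE; exact: (hp l).2.
  rewrite mulrC expr2 -mulrA ler_pM2l// ler_piMl// ?mulr_ge0//; exact: ltW.
have [n hn] : exists n, nrm2 (fun k => (-1) * truncZ n g k + g k) < e ^+ 2 / 16.
  have /cvgrPdist_lt /(_ _ e2) [n _ hn] := nrm2_truncZ_cvg g2.
  exists n; have := hn n (leqnn n); rewrite /= sub0r normrN; apply: le_lt_trans.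
  exact: ler_norm.
(* The coefficients are the coordinates of g: as [delta_k] is represented by Q_k, the truncation of
   g is represented by the corresponding finite sum. *)
exists (ballZ n), g.
have rT : rep E d (truncZ n g) (fun z => \sum_(k <- ballZ n) g k *: Q k z).
  exact: rep_sum.
set T := fun z => \sum_(k <- ballZ n) g k *: Q k z in rT *.
have gT : vgood T by have [] := rep_good hE d_l2 rT.
have rGT : rep E d (fun k => (-1) * truncZ n g k + g k) (fun z => G z - T z).
  by apply: rep_ext (rep_lin (-1) rT rG) _ => z _; rewrite scaleN1r addrC.
(* By the isometry this energy is the squared norm of the tail of g. *)
have GT : Rintegral mu circle (energy (fun z => G z - T z)) < e ^+ 2 / 16.
  by have := congr1 Re (rep_L2 rGT rGT); rewrite Re_cintegral => ->.
have mFT : vmeas (fun z => F z - T z).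
  move=> l; rewrite (_ : (fun z => (F z - T z) l 0) =
      (fun z => F z l 0 + (-1) * T z l 0)); last first.
    by apply/funext => z; rewrite !mxE; ring.
  apply: cmeasurableD => //; apply: cmeasurableM; first exact: cmeasurable_cst.
  by have [] := gT l.
rewrite /L2_norm L2_dotpE// Re_cintegral -[X in _ < X](@ger0_norm _ e) ?ltW//.
rewrite -sqrtr_sqr ltr_sqrt ?exprn_gt0//.
pose e1 := energy (fun z => F z - F1 z).
pose e3 := energy (fun z => F1 z - G z).
pose e4 := energy (fun z => G z - T z).
have bound z : energy (fun z => F z - T z) z <= 2 * e1 z + (4 * e3 z + 4 * e4 z).
  have -> : energy (fun z => F z - T z) z =
      energy (fun z => (F z - F1 z) + ((F1 z - G z) + (G z - T z))) z.
    by rewrite /energy !mform_qform !addrA !subrK.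
  exact: le_energy_sum (energyD (fun z => F z - F1 z) _ z)
    (energyD (fun z => F1 z - G z) (fun z => G z - T z) z).
have i3 : mu.-integrable circle (EFin \o e3) by apply: energy_int; exact: gB.
have i4 : mu.-integrable circle (EFin \o e4) by apply: energy_int; exact: gB.
have i1' : mu.-integrable circle (EFin \o (fun z => 2 * e1 z)).
  exact: (integrableZl mcircle 2 iFF1).
have i3' : mu.-integrable circle (EFin \o (fun z => 4 * e3 z)).
  exact: (integrableZl mcircle 4 i3).
have i4' : mu.-integrable circle (EFin \o (fun z => 4 * e4 z)).
  exact: (integrableZl mcircle 4 i4).
have i34 : mu.-integrable circle (EFin \o (fun z => 4 * e3 z + 4 * e4 z)).
  exact: (integrableD mcircle i3' i4').
have itot : mu.-integrable circle (EFin \o (fun z => 2 * e1 z + (4 * e3 z + 4 * e4 z))).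
  exact: (integrableD mcircle i1' i34).
have iFT : mu.-integrable circle (EFin \o energy (fun z => F z - T z)).
  apply: (le_integrable mcircle _ _ itot).
    by apply/measurable_EFinP; exact: energy_meas.
  move=> z cz; rewrite /= lee_fin (ger0_norm (energy_ge0 _ _)).
  exact: le_trans (bound z) (ler_norm _).
apply: (@le_lt_trans _ _ (Rintegral mu circle (fun z => 2 * e1 z + (4 * e3 z + 4 * e4 z)))).
  by apply: (le_Rintegral mcircle iFT itot) => z _; exact: bound.
rewrite (RintegralD mcircle i1' i34) (RintegralD mcircle i3' i4').
rewrite (RintegralZl 2 mcircle iFF1) (RintegralZl 4 mcircle i3) (RintegralZl 4 mcircle i4).
exact: lt_energy_sum (exprn_gt0 2 e0) FF1 F1G GT.
Qed.

End WithDensity.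

Lemma complete_orthonormal_of_rep (Q : int -> plane R -> 'cV[R[i]]_2) :
  (forall k, rep E d (delta R k) (Q k)) -> complete_orthonormal_system S Q.
Proof.
have [mu muE] := ex_trace_measure hE d_l2 SE.
have [w [N [mN N0 wN wpsd [mw bw dw]]]] := ex_psd_density hE d_l2 SE muE.
by move=> hQ; exact: (complete_of_rep muE mN N0 wN wpsd mw bw dw hQ).
Qed.

End Completeness.

(** * The factors of the CMV operator *)

Section Shift.
Context {R : realType}.
Implicit Types (f g : int -> R[i]).

Lemma ler_sum_uniq (I : eqType) (h : I -> R) (s t : seq I) : (forall i, 0 <= h i) ->
  uniq s -> uniq t -> {subset s <= t} -> \sum_(i <- s) h i <= \sum_(i <- t) h i.
Proof.
move=> h0 us ut st; rewrite [leRHS](bigID (mem s))/= -[X in _ <= X + _]big_filter.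
have -> : \sum_(i <- s) h i = \sum_(i <- [seq x <- t | x \in s]) h i.
  apply: perm_big; apply: uniq_perm => //; first exact: filter_uniq.
  by move=> i; rewrite mem_filter /=; case: (boolP (i \in s)) => // /st ->.
by rewrite lerDl sumr_ge0.
Qed.

(** A window of radius n shifted by c lies in the window of radius n + |c|. *)
Lemma l2_shift f c : l2 f -> l2 (fun k => f (k + c)).
Proof.
move=> /l2P[M hM]; apply/l2P; exists M => n.
apply: le_trans (hM (n + `|c|)%N); rewrite !sumZE.
rewrite -(big_map (fun k => k + c) xpredT (normc2 \o f)) ler_sum_uniq//.
- by move=> k; exact: normc2_ge0.
- by rewrite map_inj_uniq ?ballZ_uniq//; exact: addIr.
- exact: ballZ_uniq.
- by move=> k /mapP[j]; rewrite !mem_ballZ => jn ->; lia.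
Qed.

Lemma l2_mul f (c : int -> R[i]) : (forall k, normc2 (c k) <= 1) -> l2 f ->
  l2 (fun k => c k * f k).
Proof.
move=> c1; apply: (l2_le (C := 1)) => // k; rewrite normc2M.
by rewrite ler_wpM2r ?normc2_ge0.
Qed.

Lemma eq_dotp f g f' g' :
  (forall k, conjc (f k) * g k = conjc (f' k) * g' k) -> dotp f g = dotp f' g'.
Proof. by move=> h; rewrite /dotp; under eq_fun do under eq_bigr do rewrite h. Qed.

(** Consecutive symmetric partial sums differ by the two outermost terms, each at most their sum. *)
Lemma sumZ_term_cvg0 (b : int -> R) : (forall k, 0 <= b k) -> cvgn (sumZ b) ->
  (fun n : nat => b n.+1%:Z) @ \oo --> (0 : R) /\
  (fun n : nat => b (- n%:Z)) @ \oo --> (0 : R).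
Proof.
move=> b0 /cvg_ex[l hl].
have h : (fun n => b (- n.+1%:Z) + b n.+1%:Z) @ \oo --> (0 : R).
  have -> : (fun n => b (- n.+1%:Z) + b n.+1%:Z) =
      (fun n => sumZ b n.+1 - sumZ b n).
    by apply/funext => n; rewrite sumZS; ring.
  rewrite -(subrr l); apply: cvgB => //.
  by rewrite -cvg_shiftS in hl.
split.
- apply: squeeze_cvgr h; last exact: cvg_cst.
  by apply: nearW => n; rewrite b0 lerDr b0.
- rewrite -cvg_shiftS /=; apply: squeeze_cvgr h; last exact: cvg_cst.
  by apply: nearW => n; rewrite b0 lerDl b0.
Qed.

Lemma Re_le_normc2 (x y : R[i]) : `|Re (conjc x * y)| <= normc2 x + normc2 y.
Proof.
case: x y => a b [c e]; rewrite /normc2 !reimE /= ler_norml.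
have := sqr_ge0 (a + c); have := sqr_ge0 (a - c); have := sqr_ge0 (b + e).
have := sqr_ge0 (b - e); have := sqr_ge0 a; have := sqr_ge0 b.
have := sqr_ge0 c; have := sqr_ge0 e; rewrite !sqrrB !sqrrD => *.
by apply/andP; split; lra.
Qed.

Lemma Im_le_normc2 (x y : R[i]) : `|Im (conjc x * y)| <= normc2 x + normc2 y.
Proof.
have := Re_le_normc2 ('i%C * x) y.
have -> : normc2 ('i%C * x) = normc2 x by rewrite normc2M /normc2 /=; ring.
by have -> : Re (conjc ('i%C * x) * y) = Im (conjc x * y) by rewrite !reimE /=; ring.
Qed.

(** The symmetric window is not invariant under the shift; the discrepancy is one term at each end,
    dominated by terms of a convergent series. *)
Lemma dotp_shift f g : l2 f -> l2 g ->
  dotp (fun k => f (k - 1)) g = dotp f (fun k => g (k + 1)).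
Proof.
move=> hf hg; have hf1 := l2_shift (-1) hf; have hg1 := l2_shift 1 hg.
apply: (cvgc_unique (dotp_cvg hf1 hg)).
pose h k := conjc (f (k - 1)) * g k.
have -> : sumZ (fun k => conjc (f (k - 1)) * g k) =
  (fun n => sumZ (fun k => conjc (f k) * g (k + 1)) n +
     (h (- n%:Z) + (-1) * h n.+1%:Z)).
  apply/funext => n; rewrite -[LHS]/(sumZ h n).
  have -> : sumZ (fun k => conjc (f k) * g (k + 1)) n = sumZ (fun k => h (k + 1)) n.
    by rewrite /sumZ; apply: eq_bigr => i _; rewrite /h addrK.
  rewrite /sumZ big_ord_recl [in RHS]big_ord_recr /=.
  have -> : \sum_(i < n.*2) h ((bump 0 i)%:Z - n%:Z) = \sum_(i < n.*2) h (i%:Z - n%:Z + 1).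
    by apply: eq_bigr => i _; congr h; rewrite /bump /=; lia.
  have -> : (n.*2)%:Z - n%:Z + 1 = n.+1%:Z by lia.
  have -> : 0%N%:Z - n%:Z = - n%:Z by lia.
  by ring.
pose b k := normc2 (f (k - 1)) + normc2 (g k).
have b0 k : 0 <= b k by rewrite addr_ge0 ?normc2_ge0.
have cb : cvgn (sumZ b).
  have -> : sumZ b = (fun n => sumZ (normc2 \o (fun k => f (k - 1))) n + sumZ (normc2 \o g) n).
    by apply/funext => n; rewrite /sumZ -big_split.
  by apply: is_cvgD; exact: sumZ_normc2_cvg.
have [bp bm] := sumZ_term_cvg0 b0 cb.
have hlim (u : nat -> int) : (fun n => b (u n)) @ \oo --> (0 : R) ->
    (fun n => h (u n)) @ \oo --> (0 : R[i]^o).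
  move=> bu; have bn : (fun n => - b (u n)) @ \oo --> (0 : R).
    by rewrite -oppr0; exact: cvgN.
  apply/cvgcP; split; apply: (squeeze_cvgr _ bn bu); apply: nearW => n /=.
    by rewrite -ler_norml; exact: Re_le_normc2.
  by rewrite -ler_norml; exact: Im_le_normc2.
have := cvgcD (dotp_cvg hf hg1) (cvgcD (hlim _ bm) (cvgcM (c := -1) (hlim _ bp))).
by rewrite mulr0 !addr0; apply.
Qed.

End Shift.

(** * Block operators: boundedness, adjoint, unitarity *)

Section BlockOperator.
Context {R : realType}.
Variable alpha : int -> R[i].
Hypothesis alpha_disk : forall k : int, `|alpha k| < 1.
Implicit Types (f g : int -> R[i]) (b : bool) (j k : int).

Lemma normc2_alpha k : normc2 (alpha k) < 1.
Proof.
have h : `|alpha k| ^+ 2 < 1 by rewrite expr_lt1.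
by move: h; rewrite -add_Re2_Im2 ltcR.
Qed.

Lemma rho_sqr k : rho alpha k * rho alpha k = 1 - alpha k * conjc (alpha k).
Proof.
rewrite /rho normc2E -rmorphM -expr2 sqr_sqrtr; last first.
  by rewrite subr_ge0 ltW// normc2_alpha.
by rewrite rmorphB rmorph1 /= -conjc_mulr mulrC.
Qed.

Lemma rho_neq0 k : rho alpha k != 0.
Proof.
by rewrite /rho fmorph_eq0 sqrtr_eq0 -ltNge subr_gt0 normc2E normc2_alpha.
Qed.

Lemma rho_conj k : rho (fun k => conjc (alpha k)) k = rho alpha k.
Proof. by rewrite /rho !normc2E /normc2 ReC ImC sqrrN. Qed.

Lemma conjc_rho k : conjc (rho alpha k) = rho alpha k.
Proof. exact: conjc_real. Qed.

Lemma oddzS k : oddz (k + 1) = ~~ oddz k.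
Proof. by rewrite /oddz; lia. Qed.

Lemma oddzP k : oddz (k - 1) = ~~ oddz k.
Proof. by rewrite /oddz; lia. Qed.

Let diag b j := if oddz j == b then conjc (alpha j) else - alpha (j + 1).
Let off b j : R[i] := if oddz j == b then rho alpha j else 0.

(** One tridiagonal formula for both parities: of the two off-diagonal coefficients at j exactly the
    one for the block containing j is kept, which reduces most later facts to shifts and
    multiplications. *)
Lemma block_operatorE b f j : block_operator alpha b f j =
  diag b j * f j + (off b j * f (j - 1) + off b (j + 1) * f (j + 1)).
Proof.
rewrite /block_operator /diag /off oddzS.
case: ifPn => h; rewrite !mxE sum_ord2 !mxE /=.
  have -> : (~~ oddz j == b) = false by move: h; case: oddz b => [] [].
  by ring.
have -> : (~~ oddz j == b) = true by move: h; case: oddz b => [] [].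
by ring.
Qed.

Lemma normc2_diag b j : normc2 (diag b j) <= 1.
Proof.
rewrite /diag; case: ifP => _; apply: ltW; rewrite /normc2.
  by rewrite ReC ImC sqrrN; exact: normc2_alpha.
by rewrite ReN ImN !sqrrN; exact: normc2_alpha.
Qed.

Lemma normc2_off b j : normc2 (off b j) <= 1.
Proof.
rewrite /off; case: ifP => _; last by rewrite /normc2 Re0 Im0 expr0n addr0.
have /(congr1 (@complex.Re R)) := rho_sqr j.
rewrite -{1}conjc_rho conjc_mulr /= => ->; rewrite !reimE.
by have := normc2_ge0 (alpha j); rewrite /normc2; lra.
Qed.

Lemma block_operator_lin b c f g : block_operator alpha b (fun k => c * f k + g k) =
  fun k => c * block_operator alpha b f k + block_operator alpha b g k.
Proof. by apply/funext => j; rewrite !block_operatorE; ring. Qed.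

Lemma l2_block_operator b f : l2 f -> l2 (block_operator alpha b f).
Proof.
move=> hf; have -> : block_operator alpha b f = fun j =>
    diag b j * f j + (off b j * f (j - 1) + off b (j + 1) * f (j + 1)).
  by apply/funext => j; exact: block_operatorE.
apply: l2D; first exact: l2_mul (normc2_diag b) hf.
apply: l2D.
  by apply: (l2_mul (normc2_off b)); exact: l2_shift (-1) hf.
apply: (l2_mul (c := fun j => off b (j + 1))) => [k|]; first exact: normc2_off.
exact: l2_shift 1 hf.
Qed.

End BlockOperator.

Section BlockAdjoint.
Context {R : realType}.
Variable alpha : int -> R[i].
Hypothesis alpha_disk : forall k : int, `|alpha k| < 1.
Implicit Types (f g : int -> R[i]) (b : bool) (j k : int).
Local Notation alphaC := (fun k => conjc (alpha k)).

Lemma alphaC_disk k : `|alphaC k| < 1.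
Proof. by rewrite normcJ. Qed.

(** The blocks are symmetric, so taking adjoints only conjugates alpha. The two off-diagonal terms
    are exchanged by [dotp_shift]. *)
Lemma dotp_block_operator b f g : l2 f -> l2 g ->
  dotp (block_operator alpha b f) g = dotp f (block_operator alphaC b g).
Proof.
move=> hf hg.
pose D j := if oddz j == b then conjc (alpha j) else - alpha (j + 1).
pose e j : R[i] := if oddz j == b then rho alpha j else 0.
have De j : normc2 (D j) <= 1 by exact: normc2_diag.
have ee j : normc2 (e j) <= 1 by exact: normc2_off.
have eC j : conjc (e j) = e j by rewrite /e; case: ifP => _; rewrite ?conjc_rho ?conjc0.
have DCe j : normc2 (conjc (D j)) <= 1 by rewrite /normc2 ReC ImC sqrrN; exact: De.
have E1 : block_operator alpha b f =
    fun j => 1 * (D j * f j) + (1 * (e j * f (j - 1)) + e (j + 1) * f (j + 1)).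
  by apply/funext => j; rewrite !mul1r; exact: block_operatorE.
have E2 : block_operator alphaC b g = fun j =>
    1 * (conjc (D j) * g j) + (1 * (e j * g (j - 1)) + e (j + 1) * g (j + 1)).
  apply/funext => j; rewrite block_operatorE !mul1r /D /e !rho_conj; congr (_ * _ + _).
  by case: ifP => _; rewrite ?rmorphN.
have f1 := l2_shift (-1) hf; have g1 := l2_shift (-1) hg.
have ef := l2_mul ee hf; have eg := l2_mul ee hg.
have Df := l2_mul De hf; have Dg := l2_mul DCe hg.
have ef1 := l2_mul ee f1; have eg1 := l2_mul ee g1.
have ef2 := l2_shift 1 ef; have eg2 := l2_shift 1 eg.
rewrite E1 E2.
rewrite (dotp_linl 1 hg Df (l2_lin 1 ef1 ef2)) (dotp_linl 1 hg ef1 ef2).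
rewrite (dotp_linr 1 hf Dg (l2_lin 1 eg1 eg2)) (dotp_linr 1 hf eg1 eg2).
rewrite conjc1 !mul1r; congr (_ + _).
  by apply: eq_dotp => k; rewrite rmorphM /=; ring.
rewrite addrC; congr (_ + _).
  have := dotp_shift hg ef => h.
  rewrite (dotpC hg ef2) -h -(dotpC g1 ef).
  by apply: eq_dotp => k; rewrite rmorphM /= eC; ring.
rewrite -(dotp_shift hf eg).
by apply: eq_dotp => k; rewrite rmorphM /= eC; ring.
Qed.

(** Unitarity of each block, that is, rho^2 + |alpha|^2 = 1. *)
Lemma block_operatorK b f :
  block_operator alphaC b (block_operator alpha b f) = f.
Proof.
apply/funext => j; rewrite block_operatorE !block_operatorE !rho_conj.
have := rho_sqr alpha_disk j; have := rho_sqr alpha_disk (j + 1).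
rewrite !oddzS !oddzP subrK addrK.
move: (rho alpha j) (rho alpha (j + 1)) => r r' hr' hr.
case: (boolP (oddz j == b)) => h.
  have -> : (~~ oddz j == b) = false by move: h; case: oddz b => [] [].
  rewrite conjcK negbK h !(mul0r, addr0, add0r).
  transitivity ((r * r + alpha j * conjc (alpha j)) * f j); first by ring.
  by rewrite hr subrK mul1r.
have -> : (~~ oddz j == b) = true by move: h; case: oddz b => [] [].
rewrite negbK (negbTE h) !(mul0r, addr0, add0r).
transitivity ((r' * r' + alpha (j + 1) * conjc (alpha (j + 1))) * f j); first by ring.
by rewrite hr' subrK mul1r.
Qed.

Lemma block_operator_delta_r b k : oddz k == b ->
  block_operator alpha b (delta R k) =
  fun j => rho alpha k * delta R (k - 1) j + conjc (alpha k) * delta R k j.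
Proof.
move=> kb; apply/funext => j; rewrite block_operatorE /delta.
have [->|jk] := eqVneq j k.
  have -> : (k == k - 1) = false by lia.
  have -> : (k - 1 == k) = false by lia.
  have -> : (k + 1 == k) = false by lia.
  by rewrite ?eqxx kb /=; ring.
have [->|jk1] := eqVneq j (k - 1).
  have -> : (k - 1 - 1 == k) = false by lia.
  have nb : (~~ oddz k == b) = false by move: kb; case: oddz b => [] [].
  by rewrite subrK ?eqxx oddzP nb kb /=; ring.
have -> : (j + 1 == k) = false by lia.
case: (eqVneq (j - 1) k) => [jk2|_]; last by rewrite /=; ring.
have -> : (oddz j == b) = false.
  have -> : j = k + 1 by lia.
  by rewrite oddzS; move: kb; case: oddz b => [] [].
by rewrite /=; ring.
Qed.

Lemma block_operator_delta_l b k : oddz k == b ->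
  block_operator alpha b (delta R (k - 1)) =
  fun j => - alpha k * delta R (k - 1) j + rho alpha k * delta R k j.
Proof.
move=> kb; apply/funext => j; rewrite block_operatorE /delta.
have nb : (~~ oddz k == b) = false by move: kb; case: oddz b => [] [].
have [->|jk] := eqVneq j k.
  have -> : (k == k - 1) = false by lia.
  have -> : (k + 1 == k - 1) = false by lia.
  by rewrite ?eqxx kb /=; ring.
have [->|jk1] := eqVneq j (k - 1).
  have -> : (k - 1 - 1 == k - 1) = false by lia.
  have -> : (k - 1 + 1 == k - 1) = false by lia.
  by rewrite ?eqxx oddzP nb subrK kb /=; ring.
have -> : (j - 1 == k - 1) = false by lia.
case: (eqVneq (j + 1) (k - 1)) => [jk2|_]; last by rewrite /=; ring.
have -> : (oddz (j + 1) == b) = false by rewrite jk2 oddzP.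
by rewrite /=; ring.
Qed.

End BlockAdjoint.

(** * The recursion as a spectral representation *)

Section CMV.
Context {R : realType}.
Variable alpha : int -> R[i].
Hypothesis alpha_disk : forall k : int, `|alpha k| < 1.
Local Notation circle := (unit_circle R).
Local Notation mcircle := (@measurable_unit_circle R).
Local Notation alphaC := (fun k => conjc (alpha k)).
Local Notation X := (block_operator alpha).
Local Notation XC := (block_operator alphaC).
Local Notation rho := (rho alpha).
Implicit Types (b : bool) (k : int).

Let alphaCK : (fun k => conjc (alphaC k)) = alpha.
Proof. by apply/funext => k; rewrite conjcK. Qed.

Let l2X b f : l2 f -> l2 (X b f).
Proof. exact: l2_block_operator. Qed.

Let l2XC b f : l2 f -> l2 (XC b f).
Proof. by apply: l2_block_operator; exact: alphaC_disk. Qed.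

Let XKC b g : X b (XC b g) = g.
Proof.
by have := block_operatorK (alphaC_disk alpha_disk) b g; rewrite alphaCK.
Qed.

Lemma circle_neq0 (z : plane R) : circle z -> (z : R[i]) != 0.
Proof. by move=> z1; rewrite -normr_gt0 z1 ltr01. Qed.

Lemma circle_inv (z : plane R) : circle z -> (z : R[i])^-1 = conjc z.
Proof. by move=> z1; rewrite invc_norm z1 expr1n invr1 mul1r. Qed.

Lemma circle_bounded : cbounded circle (fun z : plane R => (z : R[i])).
Proof.
exists 1 => z z1; have hr := normr_Re_le (z : R[i]).
have hi := normr_Im_le (z : R[i]); rewrite z1 in hr hi.
by split; rewrite -lecR.
Qed.

Section Spectral.
Variable b : bool.
Variable E : set (plane R) -> (int -> R[i]) -> (int -> R[i]).
Hypothesis hE : spectral_measure (X b \o X (~~ b)) E.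

(** The parameter b treats both products at once: [false] gives VW and [true] gives WV. *)
Lemma multiplier_cmv : multiplier E (X b \o X (~~ b)) id.
Proof.
case: hE => _ hU; split=> //.
- by move=> f hf; do 2 apply: l2X.
- by move=> c f g _ _; rewrite /= !block_operator_lin.
- exact: cmeasurable_id.
- exact: circle_bounded.
Qed.

(** The operator is the adjoint, which is also the inverse; its diagonal form is the conjugate of
    that of U, and on the circle the conjugate of z is its inverse. *)
Lemma multiplier_cmvV : multiplier E (XC (~~ b) \o XC b) conjc.
Proof.
case: (hE) => hP hU; split=> //.
- by move=> f hf; do 2 apply: l2XC.
- by move=> c f g _ _; rewrite /= !block_operator_lin.
- by apply: cmeasurable_conj; exact: cmeasurable_id.
- by apply: cbounded_conj; exact: circle_bounded.
move=> f hf.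
have [mu muE] := ex_pvm_measure hP hf.
have eqm phi : cintegral (fun A => (Re (dotp f (E A f)))%:E) circle phi =
    cintegral mu circle phi by apply: eq_setfun_cintegral => B mB; rewrite muE.
rewrite eqm cintegral_conj//; last first.
- apply: bounded_cintegrable; [exact: mcircle|exact: cmeasurable_id|].
  exact: circle_bounded.
- exact: mcircle.
rewrite -eqm -hU// /=.
have h1 := dotp_block_operator alpha_disk (~~ b) hf (l2XC b hf).
have h2 := dotp_block_operator alpha_disk b (l2X (~~ b) hf) hf.
exact: etrans (esym h1) (etrans (esym h2) (dotpC hf (l2X b (l2X (~~ b) hf)))).
Qed.

Variable k0 : int.
Let d (l : 'I_2) : int -> R[i] := delta R (k0 - 1 + l%:Z).

Local Notation rep := (rep E d).
Local Notation dl := (delta R).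

Let scaleD c e (f g : int -> R[i]) F G H :
  rep f F -> rep g G -> (forall z, circle z -> c *: (e *: F z + G z) = H z) ->
  rep (fun j => c * (e * f j + g j)) H.
Proof. by move=> rf rg h; apply: rep_ext (repZ c (rep_lin e rf rg)) h. Qed.

Variables n u : int -> plane R -> 'cV[R[i]]_2.
Hypothesis transfer_match : forall k z, circle z -> oddz k == b ->
  n k z = (rho k)^-1 *: (conjc (alpha k) *: n (k - 1) z + u (k - 1) z) /\
  u k z = (rho k)^-1 *: (n (k - 1) z + alpha k *: u (k - 1) z).
Hypothesis transfer_other : forall k z, circle z -> oddz k == ~~ b ->
  n k z = (rho k)^-1 *: (alpha k *: n (k - 1) z + (z : R[i]) *: u (k - 1) z) /\
  u k z = (rho k)^-1 *: ((z : R[i])^-1 *: n (k - 1) z + conjc (alpha k) *: u (k - 1) z).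
Hypothesis u0 : forall z, circle z -> u k0 z = delta_mx 1 0.
Hypothesis n0 : forall z, circle z -> n k0 z =
  if oddz k0 == b then rho k0 *: delta_mx 0 0 + conjc (alpha k0) *: delta_mx 1 0
  else (z : R[i]) *: (rho k0 *: delta_mx 0 0 + alpha k0 *: delta_mx 1 0).

(* X b (delta k) and delta k are represented by n k and u k. *)
Let P k := rep (X b (dl k)) (n k) /\ rep (dl k) (u k).

Let parity k : oddz k == b \/ oddz k == ~~ b.
Proof. by case: (oddz k) b => [] []; [left|right|right|left]. Qed.

Let Xlin2 b' c e (f g : int -> R[i]) : X b' (fun j => c * f j + e * g j) =
  fun j => c * X b' f j + e * X b' g j.
Proof. by apply/funext => j; rewrite !block_operatorE; ring. Qed.

Let mulinv k (x y : R[i]) : rho k * x = y -> (rho k)^-1 * y = x.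
Proof. by move=> <-; rewrite mulKf// rho_neq0. Qed.

Let rr k := rho_sqr alpha_disk k.

Let T k : oddz k == ~~ b ->
  (X b \o X (~~ b)) (dl k) = fun j => rho k * X b (dl (k - 1)) j + conjc (alpha k) * X b (dl k) j.
Proof. by move=> kb; rewrite /= (block_operator_delta_r _ kb) Xlin2. Qed.

Let Tl k : oddz k == ~~ b ->
  (X b \o X (~~ b)) (dl (k - 1)) =
  fun j => - alpha k * X b (dl (k - 1)) j + rho k * X b (dl k) j.
Proof. by move=> kb; rewrite /= (block_operator_delta_l _ kb) Xlin2. Qed.

Let TV k : oddz k == ~~ b ->
  (XC (~~ b) \o XC b) (X b (dl k)) = fun j => rho k * dl (k - 1) j + alpha k * dl k j.
Proof.
move=> kb; rewrite /= block_operatorK// (block_operator_delta_r _ kb).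
by apply/funext => j; rewrite rho_conj conjcK.
Qed.

Let TVl k : oddz k == ~~ b ->
  (XC (~~ b) \o XC b) (X b (dl (k - 1))) =
  fun j => - conjc (alpha k) * dl (k - 1) j + rho k * dl k j.
Proof.
move=> kb; rewrite /= block_operatorK// (block_operator_delta_l _ kb).
by apply/funext => j; rewrite rho_conj.
Qed.

Let P_init : P k0.
Proof.
have r1 : rep (dl k0) (fun=> delta_mx 1 0).
  have := rep_base E d 1; rewrite /d (_ : k0 - 1 + _ = k0)//.
  by rewrite /=; lia.
have r0 : rep (dl (k0 - 1)) (fun=> delta_mx 0 0).
  by have := rep_base E d 0; rewrite /d (_ : k0 - 1 + _ = k0 - 1)//= addr0.
split; last by apply: rep_ext r1 _ => z cz; rewrite u0.
have [kb|kb] := parity k0.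
  rewrite (block_operator_delta_r _ kb).
  apply: rep_ext (repD (repZ (rho k0) r0) (repZ (conjc (alpha k0)) r1)) _ => z cz.
  by rewrite n0// kb.
have nkb : (oddz k0 == b) = false by move: kb; case: (oddz k0) b => [] [].
(* When [k0] lies in a block of the inner factor, [delta_k0] is that factor applied to its adjoint
   column, so [X b delta_k0] is U of a combination of the two generators. This is the origin of the
   factor z in [n0]. *)
have -> : X b (dl k0) = (X b \o X (~~ b))
    (fun j => rho k0 * dl (k0 - 1) j + alpha k0 * dl k0 j).
  by rewrite -(TV kb) /= block_operatorK// XKC.
apply: rep_ext (rep_multiplier multiplier_cmv
  (repD (repZ (rho k0) r0) (repZ (alpha k0) r1))) _ => z cz.
by rewrite n0// nkb.
Qed.

(** If k has parity b, then [delta_(k-1)], [delta_k] and their images under [X b] live in one block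
    and linear combinations suffice. Otherwise the step crosses a block of the inner factor, and U
    or its inverse supplies z or its inverse. *)
Let P_succ k : P (k - 1) -> P k.
Proof.
move=> [rN rD]; have [kb|kb] := parity k; split.
- have -> : X b (dl k) = fun j =>
      (rho k)^-1 * (conjc (alpha k) * X b (dl (k - 1)) j + dl (k - 1) j).
    rewrite (block_operator_delta_r _ kb) (block_operator_delta_l _ kb).
    apply/funext => j; apply/esym/mulinv; rewrite mulrDr mulrA rr; ring.
  by apply: (scaleD rN rD) => z cz; have [-> _] := transfer_match cz kb.
- have -> : dl k = fun j => (rho k)^-1 * (alpha k * dl (k - 1) j + X b (dl (k - 1)) j).
    rewrite (block_operator_delta_l _ kb).
    by apply/funext => j; apply/esym/mulinv; ring.
  by apply: (scaleD rD rN) => z cz; have [_ ->] := transfer_match cz kb; rewrite addrC.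
- have -> : X b (dl k) = fun j =>
      (rho k)^-1 * (alpha k * X b (dl (k - 1)) j + (X b \o X (~~ b)) (dl (k - 1)) j).
    by rewrite Tl//; apply/funext => j; apply/esym/mulinv; ring.
  by apply: (scaleD rN (rep_multiplier multiplier_cmv rD)) => z cz;
    have [-> _] := transfer_other cz kb.
- have -> : dl k = fun j => (rho k)^-1 * (conjc (alpha k) * dl (k - 1) j +
      (XC (~~ b) \o XC b) (X b (dl (k - 1))) j).
    by rewrite TVl//; apply/funext => j; apply/esym/mulinv; ring.
  apply: (scaleD rD (rep_multiplier multiplier_cmvV rN)) => z cz.
  have [_ ->] := transfer_other cz kb. by rewrite (circle_inv cz) addrC.
Qed.

(** The backward step is solved for the vectors of l^2; on the function side the recursion at k is
    substituted, and rho^2 = 1 - |alpha|^2 cancels the extra terms. *)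
Let P_pred k : P k -> P (k - 1).
Proof.
have vinv (x y : 'cV[R[i]]_2) : rho k *: x = y -> (rho k)^-1 *: y = x.
  by move=> <-; rewrite scalerA mulVf ?scale1r// rho_neq0.
have vsc (x y : 'cV[R[i]]_2) : rho k * rho k *: x = y -> rho k *: x = (rho k)^-1 *: y.
  by move=> <-; rewrite !scalerA mulrA mulVf ?mul1r// rho_neq0.
move=> [rN rD]; have [kb|kb] := parity k; split.
- have -> : X b (dl (k - 1)) = fun j =>
      (rho k)^-1 * (- alpha k * X b (dl k) j + dl k j).
    rewrite (block_operator_delta_r _ kb) (block_operator_delta_l _ kb).
    apply/funext => j; apply/esym/mulinv; rewrite mulrDr [rho k * (rho k * _)]mulrA rr; ring.
  apply: (scaleD rN rD) => z cz; have [-> ->] := transfer_match cz kb.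
  apply: vinv; rewrite scalerA mulrC -scalerA -scalerDr; apply: vsc.
  by rewrite rr; apply/colP => l; rewrite !mxE; ring.
- have -> : dl (k - 1) = fun j =>
      (rho k)^-1 * (- conjc (alpha k) * dl k j + X b (dl k) j).
    rewrite (block_operator_delta_r _ kb).
    by apply/funext => j; apply/esym/mulinv; ring.
  apply: (scaleD rD rN) => z cz; have [-> ->] := transfer_match cz kb.
  apply: vinv; rewrite scalerA mulrC -scalerA -scalerDr; apply: vsc.
  by rewrite rr; apply/colP => l; rewrite !mxE; ring.
- have -> : X b (dl (k - 1)) = fun j =>
      (rho k)^-1 * (- conjc (alpha k) * X b (dl k) j + (X b \o X (~~ b)) (dl k) j).
    by rewrite T//; apply/funext => j; apply/esym/mulinv; ring.
  apply: (scaleD rN (rep_multiplier multiplier_cmv rD)) => z cz /=.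
  have [-> ->] := transfer_other cz kb; have z0 := circle_neq0 cz.
  apply: vinv; rewrite !scalerA (mulrC _ (rho k)^-1) (mulrC (z : R[i]) (rho k)^-1).
  rewrite -!scalerA -scalerDr; apply: vsc.
  rewrite rr; apply/colP => l; rewrite !mxE.
  rewrite (_ : z * (z^-1 * n (k - 1) z l 0 + conjc (alpha k) * u (k - 1) z l 0) =
    n (k - 1) z l 0 + conjc (alpha k) * (z * u (k - 1) z l 0)); first by ring.
  by rewrite mulrDr mulVKf// mulrCA.
- have -> : dl (k - 1) = fun j =>
      (rho k)^-1 * (- alpha k * dl k j + (XC (~~ b) \o XC b) (X b (dl k)) j).
    by rewrite TV//; apply/funext => j; apply/esym/mulinv; ring.
  apply: (scaleD rD (rep_multiplier multiplier_cmvV rN)) => z cz /=.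
  have [-> ->] := transfer_other cz kb; have z0 := circle_neq0 cz.
  rewrite -(circle_inv cz).
  apply: vinv; rewrite !scalerA (mulrC _ (rho k)^-1) (mulrC (z : R[i])^-1 (rho k)^-1).
  rewrite -!scalerA -scalerDr; apply: vsc.
  rewrite rr; apply/colP => l; rewrite !mxE.
  rewrite (_ : z^-1 * (alpha k * n (k - 1) z l 0 + z * u (k - 1) z l 0) =
    alpha k * (z^-1 * n (k - 1) z l 0) + u (k - 1) z l 0); first by ring.
  by rewrite mulrDr mulKf// mulrCA.
Qed.

Lemma rep_cmv k : rep (dl k) (u k).
Proof.
suff [_ //] : P k.
have -> : k = k0 + (k - k0) by rewrite addrC subrK.
case: (k - k0) => m.
- elim: m => [|m IH]; first by rewrite addr0; exact: P_init.
  by apply: P_succ; rewrite (_ : k0 + m.+1%:Z - 1 = k0 + m%:Z)//; lia.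
(* [Negz m] stands for -(m + 1), so the base case is already one step below [k0]. *)
- elim: m => [|m IH].
    by have := P_pred P_init.
  by have := P_pred IH; rewrite (_ : k0 + Negz m - 1 = k0 + Negz m.+1)//; lia.
Qed.

End Spectral.

End CMV.

(** * Transposition and the two systems *)

Section ConjugateMeasure.
Context {R : realType}.
Implicit Types (f g : int -> R[i]).

Definition conj_seq f : int -> R[i] := fun k => conjc (f k).

Lemma conj_seqK f : conj_seq (conj_seq f) = f.
Proof. by apply/funext => k; rewrite /conj_seq conjcK. Qed.

Lemma normc2_conj (x : R[i]) : normc2 (conjc x) = normc2 x.
Proof. by rewrite /normc2 ReC ImC sqrrN. Qed.

Lemma l2_conj f : l2 f -> l2 (conj_seq f).
Proof. by apply: (l2_le (C := 1)) => // k; rewrite mul1r normc2_conj. Qed.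

Lemma dotp_conj f g : l2 f -> l2 g ->
  dotp (conj_seq f) (conj_seq g) = conjc (dotp f g).
Proof.
move=> hf hg; apply: dotpE.
have -> : sumZ (fun k => conjc (conj_seq f k) * conj_seq g k) =
    fun n => conjc (sumZ (fun k => conjc (f k) * g k) n).
  apply/funext => n; rewrite /sumZ rmorph_sum; apply: eq_bigr => i _.
  by rewrite rmorphM.
exact: cvgc_conj (dotp_cvg hf hg).
Qed.

Lemma conj_seq_delta k : conj_seq (delta R k) = delta R k.
Proof. by apply/funext => j; rewrite /conj_seq /delta conjc_nat. Qed.

Lemma conj_seq_block (alpha : int -> R[i]) b f :
  conj_seq (block_operator alpha b f) =
  block_operator (fun k => conjc (alpha k)) b (conj_seq f).
Proof.
apply/funext => j; rewrite /conj_seq !block_operatorE !rmorphD !rmorphM /=.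
rewrite !rho_conj.
congr (_ * _ + (_ * _ + _ * _)); case: ifP => _; rewrite ?conjc_rho ?rmorphN ?conjc0//.
Qed.

(** Conjugation of E by the antilinear involution that conjugates coordinates; the two
    antilinearities cancel. *)
Definition conj_pvm (E : set (plane R) -> (int -> R[i]) -> (int -> R[i])) :=
  fun A f => conj_seq (E A (conj_seq f)).

Lemma conj_pvmP E : projection_valued_measure E ->
  projection_valued_measure (conj_pvm E).
Proof.
move=> hE; have h2 A f : measurable A -> l2 f -> l2 (E A (conj_seq f)).
  by move=> mA hf; apply: (pvm_l2 hE) => //; exact: l2_conj.
split.
- by move=> A f mA hf; apply: l2_conj; exact: h2.
- move=> A c f g mA hf hg; rewrite /conj_pvm.
  have -> : conj_seq (fun k => c * f k + g k) =
      (fun k => conjc c * conj_seq f k + conj_seq g k).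
    by apply/funext => k; rewrite /conj_seq rmorphD rmorphM.
  rewrite (pvm_linear hE (conjc c) mA (l2_conj hf) (l2_conj hg)).
  by apply/funext => k; rewrite /conj_seq rmorphD rmorphM /= conjcK.
- move=> A f g mA hf hg; rewrite /conj_pvm.
  have -> : dotp (conj_seq (E A (conj_seq f))) g =
      dotp (conj_seq (E A (conj_seq f))) (conj_seq (conj_seq g)) by rewrite conj_seqK.
  have -> : dotp f (conj_seq (E A (conj_seq g))) =
      dotp (conj_seq (conj_seq f)) (conj_seq (E A (conj_seq g))) by rewrite conj_seqK.
  rewrite (dotp_conj (h2 _ _ mA hf) (l2_conj hg)) (dotp_conj (l2_conj hf) (h2 _ _ mA hg)).
  by rewrite (pvm_selfadjoint hE mA (l2_conj hf) (l2_conj hg)).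
- move=> A B f mA mB hf; rewrite /conj_pvm conj_seqK.
  by rewrite (pvm_setI hE mA mB (l2_conj hf)).
- by move=> f hf; rewrite /conj_pvm (pvm_circle hE (l2_conj hf)) conj_seqK.
- move=> F f mF tF hf; have := pvm_sigma_additive hE mF tF (l2_conj hf).
  have -> // : (fun N => sqnorm (fun k => E (\bigcup_n F n) (conj_seq f) k -
      \sum_(n < N) E (F n) (conj_seq f) k)) = (fun N => sqnorm (fun k =>
      conj_pvm E (\bigcup_n F n) f k - \sum_(n < N) conj_pvm E (F n) f k)).
  apply/funext => N; rewrite /sqnorm; apply: eq_esum => k _.
  rewrite !normc2E -normc2_conj rmorphB rmorph_sum /=.
  by [].
Qed.

Lemma dotp_conj_pvm E A f g : projection_valued_measure E -> measurable A ->
  l2 f -> l2 g -> dotp f (conj_pvm E A g) = conjc (dotp (conj_seq f) (E A (conj_seq g))).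
Proof.
move=> hE mA hf hg; rewrite /conj_pvm -dotp_conj ?conj_seqK//.
  exact: l2_conj.
by apply: (pvm_l2 hE) => //; exact: l2_conj.
Qed.

End ConjugateMeasure.

(* V and W are symmetric, so the complex conjugate of the spectral measure of
   U = VW is the spectral measure of its transpose WV. *)
Lemma conj_spectral (R : realType) (alpha : int -> R[i])
    (E : set (plane R) -> (int -> R[i]) -> (int -> R[i])) b :
  (forall k, `|alpha k| < 1) ->
  spectral_measure (block_operator alpha b \o block_operator alpha (~~ b)) E ->
  spectral_measure (block_operator alpha (~~ b) \o block_operator alpha b) (conj_pvm E).
Proof.
move=> ha [hE hU]; split; first exact: conj_pvmP.
move=> f hf; have hX b' g : l2 g -> l2 (block_operator alpha b' g).
  exact: l2_block_operator.
transitivity (cintegral (fun A => (Re (dotp (conj_seq f) (E A (conj_seq f))))%:E)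
    (unit_circle R) id); last first.
  by apply: eq_setfun_cintegral => A mA; rewrite dotp_conj_pvm// ReC.
rewrite -hU; last exact: l2_conj.
pose Y b' := block_operator (fun k => conjc (alpha k)) b'.
have hY b' g : l2 g -> l2 (Y b' g).
  by apply: l2_block_operator; exact: alphaC_disk.
have -> : (block_operator alpha b \o block_operator alpha (~~ b)) (conj_seq f) =
    conj_seq (Y b (Y (~~ b) f)).
  rewrite /Y !conj_seq_block /=; congr (block_operator _ _ (block_operator _ _ _)).
    by apply/funext => k; rewrite conjcK.
  by apply/funext => k; rewrite conjcK.
rewrite (dotp_conj hf (hY b _ (hY (~~ b) _ hf))).
have h1 := dotp_block_operator ha b hf (hY (~~ b) _ hf).
have h2 := dotp_block_operator ha (~~ b) (hX b _ hf) hf.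
have h3 := dotpC (hX (~~ b) _ (hX b _ hf)) hf.
exact: etrans h3 (congr1 (@conjc R) (etrans h2 h1)).
Qed.

(** * Linear combinations of the two solution pairs *)

Section Solutions.
Context {R : realType}.
Variables (alpha : int -> R[i]) (k0 : int).
Local Notation circle := (unit_circle R).

Lemma transfer_solutionE init u v (z : R[i]) k :
  transfer_solution alpha k0 init u v -> z != 0 ->
  u z k = (rho alpha k)^-1 * (if oddz k
    then alpha k * u z (k - 1) + z * v z (k - 1)
    else conjc (alpha k) * u z (k - 1) + v z (k - 1)) /\
  v z k = (rho alpha k)^-1 * (if oddz k
    then z^-1 * u z (k - 1) + conjc (alpha k) * v z (k - 1)
    else u z (k - 1) + alpha k * v z (k - 1)).
Proof.
move=> h z0; have [_ /(_ k) hk] := h z z0.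
have := congr1 (fun M : 'cV[R[i]]_2 => M 0 0) hk.
have := congr1 (fun M : 'cV[R[i]]_2 => M 1 0) hk.
rewrite /transfer; case: ifP => _; rewrite !mxE !sum_ord2 !mxE /= => -> ->;
  by split; ring.
Qed.

Lemma transfer_solution_init init u v (z : R[i]) :
  transfer_solution alpha k0 init u v -> z != 0 ->
  u z k0 = init z 0 0 /\ v z k0 = init z 1 0.
Proof. by move=> h z0; have [<- _] := h z z0; rewrite !mxE. Qed.

Variables p r q s : R[i] -> int -> R[i].
Hypothesis hpr : transfer_solution alpha k0 (init_pr k0) p r.
Hypothesis hqs : transfer_solution alpha k0 (init_qs k0) q s.

Let comb (c e : 'I_2 -> R[i]) (x y : R[i] -> int -> R[i]) (k : int) (z : plane R) :
  'cV[R[i]]_2 := \col_l (c l * y z k + e l * x z k).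

(** The coefficients depend neither on k nor on the sequences, so the same combination can be
    applied to (p, q) and to (r, s), and the two results again satisfy the recursion. *)
Lemma Rvec_comb : exists c e : 'I_2 -> R[i], forall x y k z,
  Rvec alpha k0 x y k z = comb c e x y k z.
Proof.
rewrite /Rvec; case: (oddz k0).
- exists (fun l => 2^-1 * if l == 0 then rho alpha k0 else - bminus alpha k0),
    (fun l => 2^-1 * if l == 0 then rho alpha k0 else aplus alpha k0) => x y k z.
  apply/colP => l; rewrite !mxE sum_ord2 !mxE /=.
  by case: (l == 0); rewrite /=; ring.
- exists (fun l => 2^-1 * if l == 0 then - rho alpha k0 else conjc (bminus alpha k0)),
    (fun l => 2^-1 * if l == 0 then rho alpha k0 else conjc (aplus alpha k0)) => x y k z.
  apply/colP => l; rewrite !mxE sum_ord2 !mxE /=.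
  by case: (l == 0); rewrite /=; ring.
Qed.

(** For odd [k0] the factor 1 / (2 z) enters the coefficients, so they are chosen after z. *)
Lemma Pvec_comb (z : plane R) : exists c e : 'I_2 -> R[i], forall x y k,
  Pvec alpha k0 x y k z = comb c e x y k z.
Proof.
rewrite /Pvec; case: (oddz k0).
- exists (fun l => (2 * (z : R[i]))^-1 * if l == 0 then - rho alpha k0
      else conjc (bminus alpha k0)),
    (fun l => (2 * (z : R[i]))^-1 * if l == 0 then rho alpha k0
      else conjc (aplus alpha k0)) => x y k.
  apply/colP => l; rewrite !mxE sum_ord2 !mxE /=.
  by case: (l == 0); rewrite /=; ring.
- exists (fun l => 2^-1 * if l == 0 then rho alpha k0 else - bminus alpha k0),
    (fun l => 2^-1 * if l == 0 then rho alpha k0 else aplus alpha k0) => x y k.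
  apply/colP => l; rewrite !mxE sum_ord2 !mxE /=.
  by case: (l == 0); rewrite /=; ring.
Qed.

Lemma comb_transfer c e (z : plane R) k : (z : R[i]) != 0 ->
  comb c e p q k z = (rho alpha k)^-1 *: (if oddz k
    then alpha k *: comb c e p q (k - 1) z + (z : R[i]) *: comb c e r s (k - 1) z
    else conjc (alpha k) *: comb c e p q (k - 1) z + comb c e r s (k - 1) z) /\
  comb c e r s k z = (rho alpha k)^-1 *: (if oddz k
    then (z : R[i])^-1 *: comb c e p q (k - 1) z + conjc (alpha k) *: comb c e r s (k - 1) z
    else comb c e p q (k - 1) z + alpha k *: comb c e r s (k - 1) z).
Proof.
move=> z0; have [p1 r1] := transfer_solutionE k hpr z0.
have [q1 s1] := transfer_solutionE k hqs z0.
split; apply/colP => l; rewrite !mxE ?p1 ?q1 ?r1 ?s1; case: ifP => _; rewrite !mxE; ring.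
Qed.

End Solutions.

(** * Identification of R and P with the represented functions *)

Section Representations.
Context {R : realType}.
Variable alpha : int -> R[i].
Hypothesis alpha_disk : forall k : int, `|alpha k| < 1.
Variable E : set (plane R) -> (int -> R[i]) -> (int -> R[i]).
Variable k0 : int.
Variables p r q s : R[i] -> int -> R[i].
Hypothesis hpr : transfer_solution alpha k0 (init_pr k0) p r.
Hypothesis hqs : transfer_solution alpha k0 (init_qs k0) q s.
Local Notation circle := (unit_circle R).
Let d (l : 'I_2) : int -> R[i] := delta R (k0 - 1 + l%:Z).

Let half2 : 2^-1 * 2 = 1 :> R[i].
Proof. by rewrite mulVf// pnatr_eq0. Qed.

Let delta_col (x y : R[i]) : x *: delta_mx 0 0 + y *: delta_mx 1 0 = cv2 x y.
Proof.
apply/colP => l; rewrite !mxE; move: l.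
by apply: forall_ord2; rewrite /= ?mulr0 ?mulr1 ?addr0 ?add0r.
Qed.

Let delta_col1 : delta_mx 1 0 = cv2 0 1 :> 'cV[R[i]]_2.
Proof. by rewrite -delta_col scale0r add0r scale1r. Qed.

Let eq_cv2 (v : 'cV[R[i]]_2) x y : v 0 0 = x -> v 1 0 = y -> v = cv2 x y.
Proof. by move=> vx vy; apply/colP => l; rewrite !mxE; move: l; apply: forall_ord2. Qed.

(** The partner, representing [V delta_k], is the same combination taken of (p, q). The initial
    values reduce to a + b = 2 and a - b = 2 alpha, or to their conjugates. *)
Lemma rep_Rvec k : spectral_measure (cmvU alpha) E ->
  rep E d (delta R k) (Rvec alpha k0 r s k).
Proof.
move=> hE; apply: (@rep_cmv R alpha alpha_disk false E hE k0 (Rvec alpha k0 p q)).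
- move=> {}k z cz /eqP kb; have [c [e RE]] := Rvec_comb alpha k0.
  by have := comb_transfer hpr hqs c e k (circle_neq0 cz); rewrite kb !RE.
- move=> {}k z cz /eqP kb; have [c [e RE]] := Rvec_comb alpha k0.
  by have := comb_transfer hpr hqs c e k (circle_neq0 cz); rewrite kb !RE.
- move=> z cz; have z0 := circle_neq0 cz.
  have [_ r0] := transfer_solution_init hpr z0.
  have [_ s0] := transfer_solution_init hqs z0.
  rewrite delta_col1 /Rvec; move: r0 s0; rewrite /init_pr /init_qs.
  case: ifP => _; rewrite !mxE /= => r0 s0; apply: eq_cv2;
    rewrite !mxE sum_ord2 !mxE /= r0 s0 /bminus /aplus ?rmorphB ?rmorphD ?rmorph1.
  + by ring.
  + by rewrite -[RHS]half2; ring.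
  + by ring.
  + by rewrite -[RHS]half2; ring.
- move=> z cz; have z0 := circle_neq0 cz.
  have [p0 _] := transfer_solution_init hpr z0.
  have [q0 _] := transfer_solution_init hqs z0.
  rewrite !delta_col /Rvec; move: p0 q0; rewrite /init_pr /init_qs.
  case: (oddz k0); rewrite !mxE /= => p0 q0.
  + have -> : z *: cv2 (rho alpha k0) (alpha k0) =
      cv2 (z * (2^-1 * 2) * rho alpha k0) (z * (2^-1 * 2) * alpha k0).
      by apply/colP => l; rewrite half2 mulr1 !mxE; case: ifP.
    by apply: eq_cv2; rewrite !mxE sum_ord2 !mxE /= p0 q0 /bminus /aplus; ring.
  + have -> : cv2 (rho alpha k0) (conjc (alpha k0)) =
      cv2 ((2^-1 * 2) * rho alpha k0) ((2^-1 * 2) * conjc (alpha k0)).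
      by rewrite half2 !mul1r.
    by apply: eq_cv2; rewrite !mxE sum_ord2 !mxE /= p0 q0 /bminus /aplus
      ?rmorphB ?rmorphD ?rmorph1; ring.
Qed.

(** Here the outer factor is W, and W u = z v makes z times the combination of (r, s) the partner of
    P. The powers of z then fall in the steps of even index, where the transfer matrix itself has
    none. *)
Lemma rep_Pvec k : spectral_measure (cmvW alpha \o cmvV alpha) E ->
  rep E d (delta R k) (Pvec alpha k0 p q k).
Proof.
move=> hE; apply: (@rep_cmv R alpha alpha_disk true E hE k0
  (fun k z => (z : R[i]) *: Pvec alpha k0 r s k z)).
- move=> {}k z cz /eqP kb; have z0 := circle_neq0 cz.
  have [c [e PE]] := Pvec_comb alpha k0 z.
  have [h1 h2] := comb_transfer hpr hqs c e k z0; rewrite !PE h1 h2 kb.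
  split; apply/colP => l; rewrite !mxE; last by ring.
  set P := c l * q _ _ + _; set S := c l * s _ _ + _.
  have e1 : z * (z^-1 * P) = P by rewrite mulVKf.
  by rewrite -[in RHS]e1; ring.
- move=> {}k z cz /eqP kb; have z0 := circle_neq0 cz.
  have [c [e PE]] := Pvec_comb alpha k0 z.
  have [h1 h2] := comb_transfer hpr hqs c e k z0; rewrite !PE h1 h2 kb.
  split; apply/colP => l; rewrite !mxE; first by ring.
  set P := c l * q _ _ + _; set S := c l * s _ _ + _.
  have e1 : z^-1 * (z * S) = S by rewrite mulKf.
  by rewrite -[in LHS]e1; ring.
- move=> z cz; have z0 := circle_neq0 cz.
  have [p0 _] := transfer_solution_init hpr z0.
  have [q0 _] := transfer_solution_init hqs z0.
  have zz : (z : R[i]) * z^-1 = 1 by rewrite divff.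
  rewrite delta_col1 /Pvec; move: p0 q0; rewrite /init_pr /init_qs.
  case: ifP => _; rewrite !mxE /= => p0 q0; apply: eq_cv2;
    rewrite !mxE sum_ord2 !mxE /= p0 q0 /bminus /aplus ?rmorphB ?rmorphD ?rmorph1 ?invfM.
  + by ring.
  + transitivity (2^-1 * 2 * (z * z^-1)); first by ring.
    by rewrite half2 zz mulr1.
  + by ring.
  + by rewrite -[RHS]half2; ring.
- move=> z cz; have z0 := circle_neq0 cz.
  have [_ r0] := transfer_solution_init hpr z0.
  have [_ s0] := transfer_solution_init hqs z0.
  have zz : (z : R[i]) * z^-1 = 1 by rewrite divff.
  rewrite !delta_col /Pvec; move: r0 s0; rewrite /init_pr /init_qs.
  case: (oddz k0); rewrite !mxE /= => r0 s0.
  + have -> : cv2 (rho alpha k0) (conjc (alpha k0)) =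
      cv2 ((2^-1 * 2) * (z * z^-1) * rho alpha k0) ((2^-1 * 2) * (z * z^-1) * conjc (alpha k0)).
      by rewrite half2 zz !mul1r.
    by apply: eq_cv2; rewrite !mxE sum_ord2 !mxE /= r0 s0 /bminus /aplus
      ?rmorphB ?rmorphD ?rmorph1 ?invfM; ring.
  + have -> : z *: cv2 (rho alpha k0) (alpha k0) =
      cv2 (z * (2^-1 * 2) * rho alpha k0) (z * (2^-1 * 2) * alpha k0).
      by apply/colP => l; rewrite half2 mulr1 !mxE; case: ifP.
    by apply: eq_cv2; rewrite !mxE sum_ord2 !mxE /= r0 s0 /bminus /aplus; ring.
Qed.

End Representations.

(** * Assembly: the transposed measure for P, the measure itself for R *)

Unset Implicit Arguments.

Theorem lemma3p4 (R : realType) (alpha : int -> R[i])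
  (alpha_disk : forall k : int, `|alpha k| < 1)
  (E : set (plane R) -> (int -> R[i]) -> (int -> R[i]))
  (E_spectral : spectral_measure (cmvU alpha) E)
  (k0 : int)
  (p r q s : R[i] -> int -> R[i])
  (pr_solution : transfer_solution alpha k0 (init_pr k0) p r)
  (qs_solution : transfer_solution alpha k0 (init_qs k0) q s) :
  complete_orthonormal_system (fun A => (Omega E k0 A)^T)
    (Pvec alpha k0 p q) /\
  complete_orthonormal_system (Omega E k0)
    (Rvec alpha k0 r s).
Proof.
pose d (l : 'I_2) : int -> R[i] := delta R (k0 - 1 + l%:Z).
have d_l2 l : l2 (d l) by exact: l2_delta.
have [hE _] := E_spectral; split.
- have hEc := conj_spectral (b := false) alpha_disk E_spectral.
  apply: (complete_orthonormal_of_rep (conj_pvmP hE) d_l2).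
    (* The basis vectors are real, so passing to the conjugate measure conjugates each entry of
       Omega, which by self-adjointness of [E A] amounts to transposing it. *)
    move=> A l l' mA; rewrite !mxE dotp_conj_pvm// !conj_seq_delta -/(d l) -/(d l').
    by rewrite -(pvm_selfadjoint hE)// dotpC//; exact: (pvm_l2 hE).
  by move=> k; exact: (rep_Pvec alpha_disk pr_solution qs_solution k hEc).
- apply: (complete_orthonormal_of_rep hE d_l2).
    by move=> A l l' mA; rewrite mxE.
  by move=> k; exact: (rep_Rvec alpha_disk pr_solution qs_solution k E_spectral).
Qed.
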